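(* Let $\mathbb F$ be $\mathbb R$ or $\mathbb C$. The moduli space $\mathfrak M_n=\mathfrak M_n(\mathbb F)$ is a $\mathrm T_1$-space for every $n$; but it is a Hausdorff space only for $n\le 4$ (it is Hausdorff for $n\le4$ and not Hausdorff for $n>4$). For any $n$, the open subset of $\mathfrak M_n$ consisting of $\mathbf G$-equivalence classes of divisors with maximum multiplicity satisfying $$\max_j\{m_j\}<n/2$$ is a Hausdorff space and an orbifold. However, if $n>4$, then $\mathfrak M_n$ is not even locally Hausdorff at any point for which $\max_j\{m_j\}\ge n/2$.
   Context: An effective divisor of degree $n$ on the projective line $\mathbb P^1=\mathbb P^1(\mathbb F)$ is a formal sum $\mathcal D=m_1\langle\mathbf p_1\rangle+\cdots+m_k\langle\mathbf p_k\rangle$ with distinct points $\mathbf p_j\in\mathbb P^1(\mathbb F)$, integer multiplicities $m_j\ge1$, and $\sum m_j=n$. The space $\widehat{\mathfrak D}_n$ of all such divisors is topologized by regarding a divisor as the root divisor of a homogeneous polynomial of degree $n$ in two variables up to a nonzero constant: $\widehat{\mathfrak D}_n(\mathbb C)\cong\mathbb P^n(\mathbb C)$, and $\widehat{\mathfrak D}_n(\mathbb R)$ is the closed subset of $\mathbb P^n(\mathbb R)$ of real polynomials all of whose roots are real. The group $\mathbf G=\mathrm{PGL}_2(\mathbb F)$ acts on $\mathbb P^1$ and hence on $\widehat{\mathfrak D}_n$. The open subset $\widehat{\mathfrak D}_n^{\mathsf{fs}}$ consists of divisors with finite stabilizer, equivalently with at least three distinct points. The moduli space is $\mathfrak M_n=\widehat{\mathfrak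 D}_n^{\mathsf{fs}}/\mathbf G$ with the quotient topology. A space is $\mathrm T_1$ if every point is closed. It is locally Hausdorff at a point if the point has a Hausdorff neighborhood. Orbifold: a space $\mathbf Y$ with an (equivalence class of) atlas of charts, each chart being a homeomorphism $W/\mathcal R\cong U$ with $\mathcal R\subset\mathrm{GL}_d(\mathbb F)$ finite, $W$ an $\mathcal R$-invariant open neighborhood of $\mathbf 0\in\mathbb F^d$, $U\subset\mathbf Y$ open, the $U$'s covering $\mathbf Y$; with the compatibility condition that near each point of an overlap the two restricted charts $W_i'/\mathcal R_{i,w_i}$ and $W_j'/\mathcal R_{j,w_j}$ (where $\mathcal R_{i,w_i}$ is the stabilizer of a point $w_i$ over the given point, and $W_i'$ a small invariant neighborhood of it) are related by an analytic isomorphism $W'_i\to W'_j$ equivariant with respect to a group isomorphism $\mathcal R_{i,w_i}\to\mathcal R_{j,w_j}$. *)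

(* Defs.v *)
From HB Require Import structures.
From mathcomp Require Import all_boot all_order all_algebra generic_quotient.
From mathcomp Require Import finmap multiset complex.
From mathcomp Require Import all_classical all_reals all_analysis.

Set Implicit Arguments.
Unset Strict Implicit.
Unset Printing Implicit Defensive.

Import Order.TTheory GRing.Theory Num.Theory.
Import numFieldNormedType.Exports.

Local Open Scope classical_set_scope.
Local Open Scope quotient_scope.
Local Open Scope ring_scope.

Section Proportionality.
Context {F : fieldType} {V : lmodType F} (A : set V).

Definition proportional (u v : A) : bool :=
  `[< exists2 c : F, c != 0 & val v = c *: val u >].

Lemma proportional_equiv : equiv_class_of proportional.
Proof.
split=> [u|u v|v u w].
- by apply/asboolP; exists 1; rewrite ?oner_neq0// scale1r.
- have sym (a b : A) : proportional a b -> proportional b a.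
    move=> /asboolP[c c0 e]; apply/asboolP; exists c^-1; first by rewrite invr_eq0.
    by rewrite e scalerA mulVf// scale1r.
  by apply/idP/idP; exact: sym.
- move=> /asboolP[c c0 e] /asboolP[b b0 e']; apply/asboolP.
  by exists (b * c); rewrite ?mulf_neq0// e' e scalerA.
Qed.

Canonical proportional_equiv_rel := EquivRelPack proportional_equiv.

End Proportionality.

Section ProjectiveLine.
Context (F : numFieldType).

Definition nonzero_vec (n : nat) : set 'cV[F]_n.+1 := [set v | v != 0].
Arguments nonzero_vec : clear implicits.

Definition projspace (n : nat) : Type :=
  quotient_topology {eq_quot (@proportional_equiv_rel F _ (nonzero_vec n))}.

Lemma nonzero_vecP n (v : 'cV[F]_n.+1) : v != 0 -> v \in nonzero_vec n.
Proof. by move=> ?; rewrite inE. Qed.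

Definition proj_pt n (v : 'cV[F]_n.+1) (v0 : v != 0) : projspace n :=
  \pi_(projspace n) (exist _ v (nonzero_vecP v0) : nonzero_vec n).

Notation P1 := (projspace 1).

Definition invertible2 : set 'M[F]_2 := [set A | A \in unitmx].

Definition PGL2 : Type := {eq_quot (@proportional_equiv_rel F _ invertible2)}.

Lemma repr_neq0 n (p : projspace n) : val (repr p) != 0.
Proof. by case: (repr p) => v /=; rewrite inE. Qed.

Lemma repr_unit (g : PGL2) : val (repr g) \in unitmx.
Proof. by case: (repr g) => v /=; rewrite inE. Qed.

Lemma mulmx_unit_neq0 (A : 'M[F]_2) (v : 'cV[F]_2) :
  A \in unitmx -> v != 0 -> A *m v != 0.
Proof.
move=> uA; apply: contraNneq => e.
by rewrite -[v]mul1mx -(mulVmx uA) -mulmxA e mulmx0.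
Qed.

Definition pgl_pt (g : PGL2) (p : P1) : P1 :=
  proj_pt (mulmx_unit_neq0 (repr_unit g) (repr_neq0 p)).

(* An effective divisor is a finite multiset of points; [D p] is the
   multiplicity of [p] and [size D] is the sum of all multiplicities. *)
Definition divisor (n : nat) : Type := {D : {mset P1}%mset | size D == n}.
HB.instance Definition _ n := Choice.on (divisor n).

(* A binary form sum_i a_i X^i Y^(n-i) of degree n is given by its n+1
   coefficients, here those of the dehomogenization at Y = 1.  For p = [x : y],
   the linear form y X - x Y is the one vanishing at p. *)
Definition linear_form (p : P1) : {poly F} :=
  let v := val (repr p) in v 1 0 *: 'X - (v 0 0)%:P.

Definition form_coefs n (D : divisor n) : 'cV[F]_n.+1 :=
  \col_i (\prod_(p <- val D) linear_form p)`_i.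

Lemma linear_form_neq0 p : linear_form p != 0.
Proof.
apply/eqP => /polyP e; have := repr_neq0 p; apply/negP; rewrite negbK.
apply/eqP/matrixP => i j; rewrite mxE ord1.
have := e 0; have := e 1.
rewrite /linear_form !coefB !coefZ !coefX !coefC /= mulr1 subr0 mulr0 sub0r.
move=> e1 /eqP; rewrite oppr_eq0 => /eqP e0.
case: i => [[|[|//]] lt_i] /=.
- by rewrite -[RHS]e0; congr (_ _ _); apply: val_inj.
- by rewrite -[RHS]e1; congr (_ _ _); apply: val_inj.
Qed.

Lemma size_linear_form p : (size (linear_form p) <= 2)%N.
Proof.
apply: leq_trans (size_polyD _ _) _; rewrite geq_max size_polyN.
rewrite (leq_trans (size_scale_leq _ _)) ?size_polyX//=.
by rewrite (leq_trans (size_polyC_leq1 _)).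
Qed.

Lemma form_coefs_neq0 n (D : divisor n) : form_coefs D != 0.
Proof.
case: D => D sD; apply/eqP => /matrixP e.
have : \prod_(p <- D) linear_form p != 0.
  by rewrite prodf_seq_neq0; apply/allP => p _; rewrite linear_form_neq0.
move/negP; apply; apply/eqP/polyP => i; rewrite coef0.
have [lt_i|] := ltnP i n.+1.
  by have := e (Ordinal lt_i) 0; rewrite !mxE.
rewrite -{1}(eqP sD) => le_i; apply: nth_default; apply: leq_trans le_i; clear e sD.
elim: (enum_mset D) => [|p s IH]; first by rewrite big_nil size_poly1.
rewrite big_cons; apply: leq_trans (size_polyMleq _ _) _ => /=.
by have := leq_add (size_linear_form p) IH; case: (_ + _)%N.
Qed.

Definition divisor_form n (D : divisor n) : projspace n :=
  proj_pt (form_coefs_neq0 D).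

(* Divisors carry the subspace topology of their image under the injection
   divisor_form into P^n(F). *)
HB.instance Definition _ n :=
  Topological.copy (divisor n) (initial_topology (@divisor_form n)).

Definition map_divisor (f : P1 -> P1) (D : {mset P1}%mset) : {mset P1}%mset :=
  seq_mset (map f D).

Lemma size_map_divisor n (f : P1 -> P1) (D : divisor n) :
  size (map_divisor f (val D)) == n.
Proof.
by rewrite /map_divisor (perm_size (perm_eq_seq_mset _)) size_map (valP D).
Qed.

Definition pgl_div n (g : PGL2) (D : divisor n) : divisor n :=
  exist (fun E : {mset P1}%mset => size E == n) _
    (size_map_divisor (pgl_pt g) D).

Definition stabilizer n (D : divisor n) : set PGL2 := [set g | pgl_div g D = D].

Definition fs_divisor (n : nat) : set (divisor n) :=
  [set D | finite_set (stabilizer D)].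
Arguments fs_divisor : clear implicits.

Definition pgl_equivalent n (D E : fs_divisor n) : bool :=
  `[< exists g : PGL2, pgl_div g (val D) = val E >].

Definition pgl_class (A : 'M[F]_2) (uA : A \in unitmx) : PGL2 :=
  \pi_PGL2 (exist _ A (mem_set uA) : invertible2).

Lemma pgl_classK (g : PGL2) : pgl_class (repr_unit g) = g.
Proof. by rewrite -[RHS]reprK; congr (\pi _); apply: val_inj. Qed.

Lemma proj_ptK n (p : projspace n) : proj_pt (repr_neq0 p) = p.
Proof. by rewrite -[RHS]reprK; congr (\pi _); apply: val_inj. Qed.

Lemma pi_eqP (V : lmodType F) (A : set V) (u v : A) :
  \pi_{eq_quot (@proportional_equiv_rel F V A)} u =
  \pi_{eq_quot (@proportional_equiv_rel F V A)} v <->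
  exists2 c : F, c != 0 & val v = c *: val u.
Proof. by split=> [/eqmodP/asboolP|e]; last exact/eqmodP/asboolP. Qed.

Lemma pgl_ptE (A : 'M[F]_2) (uA : A \in unitmx) (v : 'cV[F]_2) (v0 : v != 0) :
  pgl_pt (pgl_class uA) (proj_pt v0) = proj_pt (mulmx_unit_neq0 uA v0).
Proof.
have [a a0 /= ea] := (pi_eqP _ _).1 (reprK (pgl_class uA)).
have [b b0 /= eb] := (pi_eqP _ _).1 (reprK (proj_pt v0)).
apply: (pi_eqP _ _).2; exists (a * b); first by rewrite mulf_neq0.
by rewrite /= {1}ea {1}eb -scalemxAl -scalemxAr scalerA.
Qed.

Lemma pgl_pt1 (p : P1) : pgl_pt (pgl_class (unitmx1 F 2)) p = p.
Proof.
rewrite -[in LHS](proj_ptK p) pgl_ptE -[RHS]proj_ptK /proj_pt.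
by congr (\pi _); apply: val_inj; rewrite /= mul1mx.
Qed.

Lemma pgl_ptM (A B : 'M[F]_2) (uA : A \in unitmx) (uB : B \in unitmx)
    (uAB : A *m B \in unitmx) (p : P1) :
  pgl_pt (pgl_class uA) (pgl_pt (pgl_class uB) p) = pgl_pt (pgl_class uAB) p.
Proof.
rewrite -(proj_ptK p) !pgl_ptE /proj_pt.
by congr (\pi _); apply: val_inj; rewrite /= mulmxA.
Qed.

Lemma pgl_div1 n (D : divisor n) : pgl_div (pgl_class (unitmx1 F 2)) D = D.
Proof.
apply: val_inj; rewrite /= /map_divisor -[RHS]seq_mset_id.
by congr seq_mset; rewrite -[RHS]map_id; apply: eq_map => p; rewrite pgl_pt1.
Qed.

Lemma pgl_divM n (A B : 'M[F]_2) (uA : A \in unitmx) (uB : B \in unitmx)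
    (uAB : A *m B \in unitmx) (D : divisor n) :
  pgl_div (pgl_class uA) (pgl_div (pgl_class uB) D) = pgl_div (pgl_class uAB) D.
Proof.
apply: val_inj; rewrite /= /map_divisor; apply/eq_seq_msetP.
apply: perm_trans (perm_map _ (perm_eq_seq_mset _)) _.
by rewrite -map_comp (eq_map (pgl_ptM uA uB uAB)).
Qed.

Lemma pgl_equivalent_equiv n : equiv_class_of (@pgl_equivalent n).
Proof.
split=> [D|D E|E D G].
- by apply/asboolP; exists (pgl_class (unitmx1 F 2)); exact: pgl_div1.
- have sym (D' E' : fs_divisor n) : pgl_equivalent D' E' -> pgl_equivalent E' D'.
    move=> /asboolP[g e]; apply/asboolP.
    have ug := repr_unit g.
    have uV : invmx (val (repr g)) \in unitmx by rewrite unitmx_inv.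
    have uVg : invmx (val (repr g)) *m val (repr g) \in unitmx.
      by rewrite mulVmx// unitmx1.
    exists (pgl_class uV); rewrite -e.
    rewrite -[X in pgl_div X (val D')]pgl_classK (pgl_divM _ _ uVg).
    rewrite -[RHS]pgl_div1; congr pgl_div; congr (\pi _); apply: val_inj.
    by rewrite /= mulVmx.
  by apply/idP/idP; exact: sym.
- move=> /asboolP[g gDE] /asboolP[h hEG]; apply/asboolP.
  have uhg : val (repr h) *m val (repr g) \in unitmx.
    by rewrite unitmx_mul !repr_unit.
  exists (pgl_class uhg); rewrite -hEG -gDE.
  by rewrite -(pgl_divM (repr_unit h) (repr_unit g)) !pgl_classK.
Qed.

Canonical pgl_equivalent_equiv_rel n := EquivRelPack (@pgl_equivalent_equiv n).

Definition moduli (n : nat) : Type :=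
  quotient_topology {eq_quot (@pgl_equivalent_equiv_rel n)}.

Definition max_mult n (D : divisor n) : nat :=
  (\max_(p <- finsupp (val D)) val D p)%N.

Definition moduli_pt n (D : fs_divisor n) : moduli n := \pi_(moduli n) D.

Definition small_mult_locus (n : nat) : set (moduli n) :=
  [set moduli_pt D | D in [set D : fs_divisor n | (2 * max_mult (val D) < n)%N]].
Arguments small_mult_locus : clear implicits.

End ProjectiveLine.

Arguments nonzero_vec : clear implicits.
Arguments fs_divisor : clear implicits.
Arguments small_mult_locus : clear implicits.

Definition locally_hausdorff (T : topologicalType) (x : T) : Prop :=
  exists2 N : set T, nbhs x N & hausdorff_space N.

Section Orbifold.
Context (F : numFieldType) (d : nat).

Definition monomial (a : {ffun 'I_d -> nat}) (v : 'cV[F]_d) : F :=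
  \prod_i v i 0 ^+ a i.

(* Sum over the multi-indices all of whose entries are < N. *)
Definition box_sum (u : {ffun 'I_d -> nat} -> F) (N : nat) : F :=
  \sum_(a : {ffun 'I_d -> 'I_N}) u [ffun i => val (a i)].

(* Near w, f is the sum of an absolutely convergent power series in d variables
   centred at w: real-analytic if F is the real field, holomorphic if F is the
   complex field. *)
Definition analytic_at (f : 'cV[F]_d -> F) (w : 'cV[F]_d) : Prop :=
  exists c : {ffun 'I_d -> nat} -> F, \forall v \near w,
    (exists M : F, forall N,
       box_sum (fun a => `|c a * monomial a (v - w)|) N <= M) /\
    box_sum (fun a => c a * monomial a (v - w)) @ \oo --> f v.

Definition analytic_on (A : set 'cV[F]_d) (f : 'cV[F]_d -> 'cV[F]_d) : Prop :=
  forall w, A w -> forall i, analytic_at (fun v => f v i 0) w.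

Definition analytic_iso (A B : set 'cV[F]_d) (f : 'cV[F]_d -> 'cV[F]_d) : Prop :=
  exists g : 'cV[F]_d -> 'cV[F]_d,
    [/\ f @` A `<=` B, g @` B `<=` A,
        {in A, cancel f g} /\ {in B, cancel g f},
        analytic_on A f & analytic_on B g].

Definition finite_linear_group (G : set 'M[F]_d) : Prop :=
  [/\ finite_set G, G `<=` [set g | g \in unitmx], G 1%:M,
      (forall g h, G g -> G h -> G (g *m h)) & (forall g, G g -> G (invmx g))].

Definition group_iso (G H : set 'M[F]_d) (theta : 'M[F]_d -> 'M[F]_d) : Prop :=
  set_bij G H theta /\
  (forall g h, G g -> G h -> theta (g *m h) = theta g *m theta h).

Section Charts.
Context (Y : topologicalType).

(* The values of chart_map outside chart_dom are irrelevant. *)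
Record chart := Chart {
  chart_group : set 'M[F]_d;
  chart_dom : set 'cV[F]_d;
  chart_map : 'cV[F]_d -> Y }.

Definition chart_image (c : chart) : set Y := chart_map c @` chart_dom c.

(* The last two clauses say that chart_map induces a homeomorphism from the
   quotient space chart_dom / chart_group to chart_image: its fibres are the
   orbits, and a subset of the image is open iff its preimage is. *)
Definition is_chart (c : chart) : Prop :=
  let G := chart_group c in let W := chart_dom c in let phi := chart_map c in
  [/\ finite_linear_group G,
      [/\ open W, W 0 & forall g w, G g -> W w -> W (g *m w)],
      open (chart_image c),
      (forall w w', W w -> W w' ->
         phi w = phi w' <-> exists2 g, G g & w' = g *m w) &
      (forall V : set Y, V `<=` chart_image c ->
         open V <-> open (W `&` phi @^-1` V))].

Definition chart_stab (c : chart) (w : 'cV[F]_d) : set 'M[F]_d :=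
  [set g | chart_group c g /\ g *m w = w].

(* The last clause makes W' / chart_stab c w -> Y injective, i.e. again a
   chart. *)
Definition small_invariant_nbhd (c : chart) (w : 'cV[F]_d) (W' : set 'cV[F]_d) :
    Prop :=
  [/\ open W', W' w, W' `<=` chart_dom c,
      (forall g v, chart_stab c w g -> W' v -> W' (g *m v)) &
      (forall g v, chart_group c g -> W' v -> W' (g *m v) -> chart_stab c w g)].

Definition compatible (c1 c2 : chart) : Prop :=
  forall w1 w2, chart_dom c1 w1 -> chart_dom c2 w2 ->
  chart_map c1 w1 = chart_map c2 w2 ->
  exists (W1 W2 : set 'cV[F]_d) (f : 'cV[F]_d -> 'cV[F]_d)
         (theta : 'M[F]_d -> 'M[F]_d),
    [/\ small_invariant_nbhd c1 w1 W1 /\ small_invariant_nbhd c2 w2 W2,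
        analytic_iso W1 W2 f /\ f w1 = w2,
        group_iso (chart_stab c1 w1) (chart_stab c2 w2) theta,
        (forall g v, chart_stab c1 w1 g -> W1 v ->
           f (g *m v) = theta g *m f v) &
        (forall v, W1 v -> chart_map c2 (f v) = chart_map c1 v)].

Definition orbifold_atlas (A : set chart) : Prop :=
  [/\ A `<=` is_chart,
      \bigcup_(c in A) chart_image c = setT &
      forall c1 c2, A c1 -> A c2 -> compatible c1 c2].

End Charts.
End Orbifold.

Definition orbifold (F : numFieldType) (Y : topologicalType) : Prop :=
  exists (d : nat) (A : set (chart F d Y)), orbifold_atlas A.

(* Main.v *)
Require Import Defs.
From mathcomp Require Import all_boot all_order all_algebra all_fingroup generic_quotient.
From mathcomp Require Import finmap multiset complex.
From mathcomp Require Import all_classical all_reals all_analysis.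
From mathcomp Require Import -(notations) mpoly.
From mathcomp Require Import ring zify.
Set Implicit Arguments.
Unset Strict Implicit.
Unset Printing Implicit Defensive.
Import Order.TTheory GRing.Theory Num.Theory.
Import numFieldNormedType.Exports.
Local Open Scope classical_set_scope.
Local Open Scope quotient_scope.
Local Open Scope ring_scope.

(** A divisor is represented by a tuple of homogeneous coordinates of its points,
    a matrix with two rows; two tuples represent the same point of the moduli
    space when a permutation and a projectivity relate them ([tequiv]). A
    stabilizer is finite exactly when there are three distinct points, and the
    moduli space carries the quotient topology of the tuples ([open_moduli]). All
    questions thus become questions on tuples.

    Separation. Two tuples that are limits of equivalent ones are still related
    by a nonzero matrix, since the matrices can be normalized to a compact set.
    If the limit matrix is invertible, the tuples are equivalent. If it has rank
    one, it sends everything but one point [p] to one point [q]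
    ([degenerate_rel]), so the multiplicities of [p] and [q] add up to at least
    the degree [n]: this cannot happen below [n / 2], which gives the Hausdorff
    locus. For [n <= 4] it only happens between divisors of the form
    [2 p + a + b], which are all equivalent ([tequiv_le4]). If one of the two
    classes is constant, coincident points stay coincident in the limit, and a
    limit of rank one would have at most two distinct points: so points are
    closed.

    Non-separation. If the point at infinity has multiplicity at least [n / 2],
    the other points can be exchanged with as many points at infinity: the
    projectivities [z -> 1 / (t z)] relate tuples that tend to the given divisor
    and to a prescribed partner ([inseparable]). For [n > 4] the partner can be
    chosen arbitrarily close to the given divisor, but inequivalent to it, by
    moving one point while three other ones remain fixed
    ([deformation_inequivalent]).

    Orbifold charts. Every point of a tuple [X] with at least three distinct
    points has an opposite point, in a way that commutes with projectivities
    ([opp]); moving the points towards their opposite ones gives coordinates on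
    the tuples near [X] in which the symmetries of [X] act linearly
    ([symm_nearby]), and unitarily for suitable weights ([weight_symm]). The
    orthogonal complement of the tangent space of the orbit is then a slice: for
    stable [X], compactness and a linear uniqueness argument show that two of its
    points near [0] are equivalent only by a symmetry of [X] ([slice_exists]).
    The equation bringing a tuple back to the slice is quadratic in the unknowns
    and affine in the parameters, and its solutions are analytic
    ([analytic_implicit]). So the slices give charts ([slice_is_chart]), and the
    transition map, which sends a point of one slice to the equivalent point of
    the other one, is analytic and intertwines the symmetries
    ([slice_compatible]). *)

(** * The ground field *)

(** The real and the complex field are treated at once: the proof uses nothing
    else about them. *)
Record local_field (F : numFieldType) : Prop := LocalField {
  lf_compact : compact [set z : F | `|z| <= 1];
  lf_arch : forall x : F, exists N : nat, `|x| <= N%:R;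
  lf_conj : exists conj : {rmorphism F -> F}, forall z, conj z * z = `|z| ^+ 2 }.

Lemma closed_unit_ball (F : numFieldType) : closed [set z : F | `|z| <= 1].
Proof.
move=> z cz /=; apply/negPn/negP; rewrite real_leNgt ?normr_real ?real1// negbK => z1.
have e0 : 0 < `|z| - 1 by rewrite subr_gt0.
have [w [/= w1]] := cz _ (nbhsx_ballx z _ e0).
rewrite -ball_normE /= => zw.
have := le_lt_trans (lerB_dist z w) zw; rewrite ltrD2l ltrN2 => /lt_le_trans/(_ w1).
by rewrite ltxx.
Qed.

Lemma local_field_real (R : realType) : local_field (R : numFieldType).
Proof.
split.
- have -> : [set z : R | `|z| <= 1] = `[-1, 1]%classic.
    by apply/seteqP; split=> z /=; rewrite in_itv/= ler_norml.
  exact: segment_compact.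
- by move=> x; exists (Num.bound `|x|); apply/ltW/archi_boundP.
- exists (idfun : {rmorphism R -> R}) => z.
  by rewrite /= real_normK ?num_real// expr2.
Qed.

Lemma local_field_complex (R : realType) : local_field (complex R : numFieldType).
Proof.
have nRC (x : R) : `|(x%:C)%C| = (`|x|%:C)%C :> R[i].
  by rewrite normc_def /= expr0n addr0 sqrtr_sqr.
split.
- pose f (z : R * R) : (complex R : numFieldType) := (z.1 +i* z.2)%C.
  have cf : continuous f.
    move=> z; apply/cvgrPdist_lt => -[e e'] e0.
    move: e0; rewrite ltcE/= => /andP[/eqP-> e0].
    have e20 : 0 < e / 2 by rewrite divr_gt0.
    have cf1 : \forall t \near z, `|z.1 - t.1| < e / 2.
      by have /cvgrPdist_lt/(_ _ e20) : (t.1 @[t --> z] --> z.1) by apply: cvg_fst.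
    have cf2 : \forall t \near z, `|z.2 - t.2| < e / 2.
      by have /cvgrPdist_lt/(_ _ e20) : (t.2 @[t --> z] --> z.2) by apply: cvg_snd.
    near=> t.
    have -> : f z - f t = ((z.1 - t.1)%:C + 'i * (z.2 - t.2)%:C)%C.
      rewrite /f; apply/eqP; rewrite eq_complex/=.
      by rewrite !mul0r !mul1r !(mulr0, subr0, addr0, add0r, oppr0)// !eqxx.
    apply: le_lt_trans (ler_normD _ _) _.
    rewrite normrM (_ : `|'i%C| = 1); last first.
      by rewrite normc_def/= expr0n expr1n add0r sqrtr1.
    rewrite mul1r !nRC -rmorphD /= ltcR [e in X in _ < X]splitr.
    by apply: ltrD; near: t.
  have Kc : compact (f @` (`[-1, 1]%classic `*` `[-1, 1]%classic)).
    apply: continuous_compact; last by apply: compact_setX; exact: segment_compact.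
    by apply: continuous_subspaceT => z; exact: cf.
  apply: subclosed_compact Kc _.
    exact: closed_unit_ball.
  move=> [a b] /= ab1; exists (a, b) => //.
  move: ab1; rewrite normc_def/= lecR => ab1.
  have ab : a ^+ 2 + b ^+ 2 <= 1.
    by rewrite -(sqrtr1 R) in ab1; rewrite -ler_sqrt.
  by split; rewrite /= in_itv/= -ler_norml -sqrtr_sqr -[leRHS]sqrtr1 ler_sqrt//;
    apply: le_trans ab; rewrite ?lerDl ?lerDr sqr_ge0.
- move=> [a b]; rewrite normc_def/=.
  set r := Num.sqrt _; exists (Num.bound r).
  rewrite -(rmorph_nat (real_complex R)) lecR; apply/ltW/archi_boundP.
  exact: sqrtr_ge0.
- exists (conjc : {rmorphism R[i] -> R[i]}) => z.
  by rewrite sqr_normc mulrC.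
Unshelve. all: by end_near.
Qed.

(** * Continuity of scalar and matrix valued maps *)

Section ContinuityKit.
Context {F : numFieldType} {T : topologicalType}.
Implicit Types f g : T -> F.

Lemma contC (c : F) : continuous (fun _ : T => c).
Proof. by move=> x; exact: cvg_cst. Qed.

Lemma contD f g : continuous f -> continuous g -> continuous (fun x => f x + g x).
Proof. by move=> hf hg x; exact: (cvgD (hf x) (hg x)). Qed.

Lemma contN f : continuous f -> continuous (fun x => - f x).
Proof. by move=> hf x; exact: (cvgN (hf x)). Qed.

Lemma contB f g : continuous f -> continuous g -> continuous (fun x => f x - g x).
Proof. by move=> hf hg; apply: contD => //; exact: contN. Qed.

Lemma contM f g : continuous f -> continuous g -> continuous (fun x => f x * g x).
Proof. by move=> hf hg x; exact: (cvgM (hf x) (hg x)). Qed.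

Lemma cont_norm f : continuous f -> continuous (fun x => `|f x|).
Proof. by move=> hf x; exact: (cvg_norm (hf x)). Qed.

Lemma cont_sum (I : Type) (s : seq I) (P : pred I) (f : I -> T -> F) :
  (forall i, continuous (f i)) -> continuous (fun x => \sum_(i <- s | P i) f i x).
Proof.
move=> hf; elim: s => [|i s IH].
  by under eq_fun do rewrite big_nil; exact: contC.
under eq_fun do rewrite big_cons.
by case: (P i) => //; exact: contD.
Qed.

Lemma cont_prod (I : Type) (s : seq I) (P : pred I) (f : I -> T -> F) :
  (forall i, continuous (f i)) -> continuous (fun x => \prod_(i <- s | P i) f i x).
Proof.
move=> hf; elim: s => [|i s IH].
  by under eq_fun do rewrite big_nil; exact: contC.
under eq_fun do rewrite big_cons.
by case: (P i) => //; exact: contM.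
Qed.

Lemma cont_mx m n (f : T -> 'M[F]_(m, n)) :
  (forall i j, continuous (fun x => f x i j)) -> continuous f.
Proof.
move=> hf x A [E hE sub]; apply: filterS sub _.
have : \forall t \near x, forall ij : 'I_m * 'I_n, E ij.1 ij.2 (f t ij.1 ij.2).
  by apply: filter_forall => -[i j] /=; exact: hf (hE i j).
by apply: filterS => t h i j; exact: (h (i, j)).
Qed.

Lemma cont_entry m n (f : T -> 'M[F]_(m, n)) i j :
  continuous f -> continuous (fun x => f x i j).
Proof.
move=> hf x; have hM : continuous (fun M : 'M[F]_(m, n) => M i j) by exact: coord_continuous.
exact: (continuous_comp (hf x) (hM (f x))).
Qed.

Lemma cont_mulmx m n k (f : T -> 'M[F]_(m, n)) (g : T -> 'M[F]_(n, k)) :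
  continuous f -> continuous g -> continuous (fun x => f x *m g x).
Proof.
move=> hf hg; apply: cont_mx => i j; under eq_fun do rewrite mxE.
by apply: cont_sum => l; apply: contM; exact: cont_entry.
Qed.

Lemma cont_det n (f : T -> 'M[F]_n) : continuous f -> continuous (fun x => \det (f x)).
Proof.
move=> hf; apply: cont_sum => s; apply: contM; first exact: contC.
by apply: cont_prod => i; exact: cont_entry.
Qed.

Lemma open_neq0 f : continuous f -> open [set x | f x != 0].
Proof.
move=> hf; have -> : [set x | f x != 0] = f @^-1` (~` [set 0]).
  by apply/seteqP; split=> x /= /eqP.
apply: open_comp => [x _|]; first exact: hf.
by apply: closed_openC; exact: accessible_closed_set1 (hausdorff_accessible (@norm_hausdorff _ _)) _.
Qed.

Lemma closed_eq0 f : continuous f -> closed [set x | f x = 0].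
Proof.
move=> hf; have -> : [set x | f x = 0] = ~` [set x | f x != 0].
  by apply/seteqP; split=> x /=; [move=> ->; rewrite eqxx|move/negP; rewrite negbK => /eqP].
by apply: open_closedC; exact: open_neq0.
Qed.

Lemma open_norm_lt f (e : F) : continuous f -> open [set x | `|f x| < e].
Proof.
move=> hf; have -> : [set x | `|f x| < e] = f @^-1` (ball 0 e).
  by apply/seteqP; split=> x /=; rewrite -ball_normE /= sub0r normrN.
by apply: open_comp => [x _|]; [exact: hf|exact: ball_open].
Qed.

End ContinuityKit.

Lemma cont_fst (S T : topologicalType) : continuous (@fst S T).
Proof. by move=> z; exact: cvg_fst. Qed.

Lemma cont_snd (S T : topologicalType) : continuous (@snd S T).
Proof. by move=> z; exact: cvg_snd. Qed.

Lemma cont_comp (S T V : topologicalType) (f : S -> T) (g : T -> V) :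
  continuous f -> continuous g -> continuous (fun z => g (f z)).
Proof. by move=> cf cg z; apply: continuous_comp; [exact: cf|exact: cg]. Qed.

Lemma cont_pair (S T V : topologicalType) (f : S -> T) (g : S -> V) :
  continuous f -> continuous g -> continuous (fun x => (f x, g x)).
Proof. by move=> cf cg x; exact: (cvg_pair (cf x) (cg x)). Qed.

Lemma closed_bigU_fin (T : topologicalType) (I : finType) (Z : I -> set T) :
  (forall i, closed (Z i)) -> closed [set t | exists i, Z i t].
Proof.
move=> cZ; have -> : [set t | exists i, Z i t] = \bigcup_(i in [set: I]) Z i.
  by apply/seteqP; split=> t [k]; exists k.
by apply: closed_bigcup; [exact: finite_finset|move=> i _; exact: cZ].
Qed.

(** * Separation *)

Lemma separated_hausdorff (T : topologicalType) :
  (forall x y : T, x <> y -> exists A B : set T,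
     [/\ open A, open B, A x, B y & forall z, A z -> B z -> False]) ->
  hausdorff_space T.
Proof.
move=> h x y cl; apply: contrapT => /h[A [B [oA oB Ax By AB]]].
have [z [Az Bz]] := cl A B (open_nbhs_nbhs (conj oA Ax)) (open_nbhs_nbhs (conj oB By)).
exact: AB Bz.
Qed.

Lemma hausdorff_separated (T : topologicalType) (x y : T) :
  hausdorff_space T -> x <> y -> exists A B : set T,
     [/\ open A, open B, A x, B y & forall z, A z -> B z -> False].
Proof.
rewrite open_hausdorff => h /eqP /h[[A B] /= [Ax By] [oA oB /eqP AB]].
exists A, B; split=> //; [by rewrite inE in Ax|by rewrite inE in By|].
by move=> z Az Bz; suff : set0 z by []; rewrite -AB.
Qed.

(** * Analytic solutions of quadratic equations *)

Section WeightedNorm.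
Context {F : numFieldType} {p : nat}.
Implicit Types (a b : mpoly p F) (m : multinom p) (r : F).

(** A submultiplicative norm dominating the values on the polydisc of radius
    [r]. *)
Definition wnorm r a : F := \sum_(m <- msupp a) `|mcoeff m a| * r ^+ mdeg m.

Lemma wnorm_supp (s : seq (multinom p)) r a :
  uniq s -> {subset msupp a <= s} -> wnorm r a = \sum_(m <- s) `|mcoeff m a| * r ^+ mdeg m.
Proof.
move=> us sub; rewrite (bigID (mem (msupp a)))/= [X in _ + X]big1 ?addr0; last first.
  by move=> m /memN_msupp_eq0->; rewrite normr0 mul0r.
rewrite -big_filter; apply: perm_big; apply: uniq_perm; rewrite ?msupp_uniq ?filter_uniq//.
by move=> m; rewrite mem_filter; case: (boolP (m \in msupp a)) => //= /sub->.
Qed.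

Lemma wnorm_ge0 r a : 0 <= r -> 0 <= wnorm r a.
Proof. by move=> r0; apply: sumr_ge0 => m _; rewrite mulr_ge0// exprn_ge0. Qed.

Lemma wnorm0 r : wnorm r 0 = 0.
Proof. by rewrite /wnorm (perm_big [::]) ?big_nil// msupp0. Qed.

Lemma wnormD r a b : 0 <= r -> wnorm r (a + b) <= wnorm r a + wnorm r b.
Proof.
move=> r0; pose s := undup (msupp a ++ msupp b).
rewrite !(@wnorm_supp s) ?undup_uniq//; last 1 first.
- by move=> m; rewrite /s mem_undup => /msuppD_le.
- rewrite -big_split/=; apply: ler_sum => m _.
  by rewrite -mulrDl ler_wpM2r ?exprn_ge0// mcoeffD ler_normD.
- by move=> m; rewrite /s mem_undup mem_cat => ->; rewrite orbT.
- by move=> m; rewrite /s mem_undup mem_cat => ->.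
Qed.

Lemma wnorm_sum (I : Type) (s : seq I) (P : pred I) (f : I -> mpoly p F) r : 0 <= r ->
  wnorm r (\sum_(i <- s | P i) f i) <= \sum_(i <- s | P i) wnorm r (f i).
Proof.
move=> r0; elim/big_rec2: _ => [|i x a _ le]; first by rewrite wnorm0.
by apply: le_trans (wnormD _ _ r0) _; rewrite lerD2l.
Qed.

Lemma wnormZX r (c : F) m : wnorm r (c *: mpolyX F m) = `|c| * r ^+ mdeg m.
Proof.
have [->|c0] := eqVneq c 0; first by rewrite scale0r wnorm0 normr0 mul0r.
by rewrite /wnorm msuppMCX// big_seq1 mcoeffZ mcoeffX eqxx mulr1.
Qed.

Lemma wnormM r a b : 0 <= r -> wnorm r (a * b) <= wnorm r a * wnorm r b.
Proof.
move=> r0; rewrite mpolyME; apply: le_trans (wnorm_sum _ _ _ r0) _.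
rewrite big_allpairs/= [wnorm r a]/wnorm [wnorm r b]/wnorm big_distrl/=; apply: ler_sum => m _.
rewrite big_distrr/=; apply: ler_sum => m' _.
by rewrite wnormZX mdegD exprD normrM mulrACA.
Qed.

Lemma norm_mcoeff_le r a m : 0 <= r -> `|mcoeff m a| * r ^+ mdeg m <= wnorm r a.
Proof.
move=> r0; case: (boolP (m \in msupp a)) => [ma|/memN_msupp_eq0->]; last first.
  by rewrite normr0 mul0r wnorm_ge0.
rewrite /wnorm (big_rem _ ma)/= lerDl.
by apply: sumr_ge0 => i _; rewrite mulr_ge0// exprn_ge0.
Qed.

Lemma norm_monomial_le (u : 'I_p -> F) t m : (forall i, `|u i| <= t) ->
  `|\prod_i u i ^+ m i| <= t ^+ mdeg m.
Proof.
move=> ut; rewrite normr_prod mdegE expr_sum; apply: ler_prod => i _.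
by rewrite normr_ge0 normrX/= lerXn2r// nnegrE (le_trans _ (ut i)).
Qed.

Lemma norm_meval_le r a (u : 'I_p -> F) : (forall i, `|u i| <= r) ->
  `|meval u a| <= wnorm r a.
Proof.
move=> ur; rewrite mevalE; apply: le_trans (ler_norm_sum _ _ _) _.
by apply: ler_sum => m _; rewrite normrM ler_wpM2l// norm_monomial_le.
Qed.

(** Every monomial that occurs has positive degree. *)
Lemma wnorm_shrink r t a : 0 <= r -> 0 <= t <= 1 -> mcoeff (@mnm0 p) a = 0 ->
  wnorm (t * r) a <= t * wnorm r a.
Proof.
move=> r0 /andP[t0 t1] a0; rewrite /wnorm big_distrr/=; apply: ler_sum => m _.
have [->|m0] := eqVneq m (@mnm0 p); first by rewrite a0 normr0 !mul0r mulr0.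
rewrite mulrCA ler_wpM2l// exprMn ler_wpM2r ?exprn_ge0//.
rewrite -[leRHS]expr1; apply: ler_wiXn2l => //.
by rewrite lt0n mdeg_eq0.
Qed.

Lemma ler_wnorm r r' a : 0 <= r <= r' -> wnorm r a <= wnorm r' a.
Proof.
move=> /andP[r0 rr']; apply: ler_sum => m _; rewrite ler_wpM2l//.
by rewrite lerXn2r// nnegrE (le_trans r0).
Qed.

(** The partial sums defining analyticity run over finite functions; these maps
    identify finite functions with monomials. *)
Definition mnm_of (x : {ffun 'I_p -> nat}) : multinom p :=
  Multinom [tuple x i | i < p].

Definition ffun_of (m : multinom p) : {ffun 'I_p -> nat} := [ffun i => m i].

Definition box (N : nat) : seq (multinom p) :=
  [seq mnm_of [ffun i => val (x i)] | x : {ffun 'I_p -> 'I_N} <- enum {ffun 'I_p -> 'I_N}].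

Lemma box_sumE (u : {ffun 'I_p -> nat} -> F) N :
  box_sum u N = \sum_(m <- box N) u (ffun_of m).
Proof.
rewrite /box_sum /box big_map big_enum/=; apply: eq_bigr => a _; congr u.
by apply/ffunP => i; rewrite !ffunE mnmE ffunE.
Qed.

Lemma box_uniq N : uniq (box N).
Proof.
rewrite map_inj_uniq ?enum_uniq//.
move=> x y /= e; apply/ffunP => i; apply: val_inj.
by have := congr1 (fun m : multinom p => m i) e; rewrite !mnmE !ffunE.
Qed.

Lemma mem_box N m : (m \in box N) = [forall i, m i < N]%N.
Proof.
apply/mapP/forallP => [[x _ ->] i|h].
  by rewrite mnmE ffunE ltn_ord.
exists [ffun i => Ordinal (h i)]; first by rewrite mem_enum.
by apply/mnmP => i; rewrite mnmE !ffunE.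
Qed.

Lemma mdeg_notin_box N m : m \notin box N -> (N <= mdeg m)%N.
Proof.
rewrite mem_box negb_forall => /existsP[j]; rewrite -leqNgt => /leq_trans; apply.
by rewrite mdegE (bigD1 j)//= leq_addr.
Qed.

Lemma monomialE m (v : 'cV[F]_p) : monomial (ffun_of m) v = \prod_i v i 0 ^+ m i.
Proof. by apply: eq_bigr => i _; rewrite ffunE. Qed.

Lemma big_common (V : nmodType) (s t : seq (multinom p)) (g : multinom p -> V) :
  uniq s -> uniq t -> \sum_(m <- s | m \in t) g m = \sum_(m <- t | m \in s) g m.
Proof.
move=> us ut; rewrite -big_filter -[RHS]big_filter; apply: perm_big.
by apply: uniq_perm; rewrite ?filter_uniq// => m; rewrite !mem_filter andbC.
Qed.

Lemma sum_box_le r a N : 0 <= r ->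
  \sum_(m <- box N) `|mcoeff m a| * r ^+ mdeg m <= wnorm r a.
Proof.
move=> r0; rewrite (bigID (mem (msupp a)))/= [X in _ + X]big1 ?addr0; last first.
  by move=> m /memN_msupp_eq0->; rewrite normr0 mul0r.
rewrite /wnorm [leRHS](bigID (mem (box N)))/= big_common ?msupp_uniq ?box_uniq//.
rewrite lerDl.
by apply: sumr_ge0 => i _; rewrite mulr_ge0// exprn_ge0.
Qed.

(** Outside the box the degree is at least [N], so halving the polydisc gains
    [2 ^- N]. *)
Lemma box_tail r a N (v : 'cV[F]_p) : 0 <= r -> (forall i, `|v i 0| <= r / 2) ->
  `|\sum_(m <- box N) mcoeff m a * (\prod_i v i 0 ^+ m i) - meval (fun i => v i 0) a|
    <= 2^-1 ^+ N * wnorm r a.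
Proof.
move=> r0 vr; set g := fun m => mcoeff m a * (\prod_i v i 0 ^+ m i).
have -> : \sum_(m <- box N) g m = \sum_(m <- msupp a | m \in box N) g m.
  rewrite (bigID (mem (msupp a)))/= [X in _ + X]big1 ?addr0; last first.
    by move=> m /memN_msupp_eq0 e; rewrite /g e mul0r.
  by rewrite big_common ?msupp_uniq ?box_uniq.
rewrite mevalE [X in _ - X](bigID (mem (box N)))/= opprD addrA subrr add0r normrN.
apply: le_trans (ler_norm_sum _ _ _) _.
rewrite /wnorm big_distrr/= [leRHS](bigID (mem (box N)))/=.
rewrite ler_wpDl//.
  apply: sumr_ge0 => m _; rewrite mulr_ge0 ?exprn_ge0 ?invr_ge0//.
  by rewrite mulr_ge0 ?exprn_ge0.
apply: ler_sum => m /mdeg_notin_box Nm.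
rewrite normrM mulrCA ler_wpM2l//.
apply: le_trans (norm_monomial_le _ vr) _.
rewrite exprMn mulrC ler_wpM2r ?exprn_ge0//.
by apply: ler_wiXn2l => //; rewrite ?invr_ge0// invf_le1// ler1n.
Qed.

End WeightedNorm.

Section Completeness.
Context {F : numFieldType} (lf : local_field F).

Lemma small_geo (x e : F) : 0 <= x -> 0 < e -> exists N, x * 2^-1 ^+ N <= e.
Proof.
move=> x0 e0; have [N hN] := lf_arch lf (x / e); exists N.
have xe : 0 <= x / e by rewrite divr_ge0// ltW.
move: hN; rewrite ger0_norm// ler_pdivrMr// => hN.
rewrite exprVn ler_pdivrMr ?exprn_gt0// (le_trans hN)// mulrC ler_pM2l//.
by rewrite -natrX ler_nat ltnW// ltn_expl.
Qed.

Lemma compact_disc (x r : F) : compact [set z : F | `|z - x| <= r].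
Proof.
have [r0|r0] := boolP (0 < r); last first.
  have -> : [set z : F | `|z - x| <= r] = if r == 0 then [set x] else set0.
    case: eqP => [->|/eqP rN0]; apply/seteqP; split=> z //=.
    - by rewrite normr_le0 subr_eq0 => /eqP.
    - by move=> ->; rewrite subrr normr0.
    - move=> zr; apply: (negP r0); rewrite lt_def rN0/=.
      exact: le_trans zr.
  by case: ifP => _; [exact: compact_set1|exact: compact0].
have -> : [set z : F | `|z - x| <= r] = (fun z : F => r * z + x) @` [set z : F | `|z| <= 1].
  apply/seteqP; split=> [z /= zr|_ /= [z z1 <-]]; last first.
    by rewrite addrK normrM gtr0_norm// ler_piMr// ltW.
  exists ((z - x) / r) => /=.
    by rewrite normrM normfV (gtr0_norm r0) ler_pdivrMr// mul1r.
  by rewrite mulrC divfK ?gt_eqF// subrK.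
apply: continuous_compact; last exact: lf_compact lf.
apply: continuous_subspaceT; apply: contD; last exact: contC.
by apply: contM; [exact: contC|move=> z; exact: cvg_id].
Qed.

Lemma geometric_dist (V : normedZmodType F) (x : nat -> V) (C : F) :
  (forall k, `|x k.+1 - x k| <= C * 2^-1 ^+ k) ->
  forall k n, `|x (k + n)%N - x k| <= 2 * C * 2^-1 ^+ k.
Proof.
move=> h k n.
have C0 : 0 <= C by have := le_trans (normr_ge0 _) (h 0); rewrite expr0 mulr1.
suff : `|x (k + n)%N - x k| <= 2 * C * 2^-1 ^+ k - 2 * C * 2^-1 ^+ (k + n).
  move/le_trans; apply; rewrite gerBl mulr_ge0 ?mulr_ge0 ?exprn_ge0 ?invr_ge0//.
elim: n => [|n IH]; first by rewrite addn0 !subrr normr0.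
rewrite addnS -[x _.+1](subrK (x (k + n)%N)) -addrA.
apply: le_trans (ler_normD _ _) _.
apply: le_trans (lerD (h _) IH) _.
rewrite exprS le_eqVlt; apply/orP; left; apply/eqP.
by field.
Qed.

Lemma geometric_limit (x : nat -> F) (C : F) :
  (forall k, `|x k.+1 - x k| <= C * 2^-1 ^+ k) ->
  exists l, forall k, `|x k - l| <= 2 * C * 2^-1 ^+ k.
Proof.
move=> h; have hd := geometric_dist h.
have Fx : (x @ \oo) [set z : F | `|z - x 0| <= 2 * C].
  by exists 0 => // k _ /=; have := hd 0 k; rewrite add0n expr0 mulr1.
have [l [_ cl]] := @compact_disc (x 0) (2 * C) _ (fmap_proper_filter x _) Fx.
exists l => k; apply/ler_addgt0Pr => e e0.
have [|y [/= [n kn <-] ly]] := cl [set y | exists2 n, (k <= n)%N & x n = y] _ _ (nbhsx_ballx l _ e0).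
  by exists k => // n kn; exists n.
have := hd k (n - k)%N; rewrite subnKC// => d.
rewrite -[X in `|X|](subrKA (x n)); apply: le_trans (ler_normD _ _) _.
apply: lerD; first by rewrite distrC.
by rewrite distrC; apply: ltW; move: ly; rewrite -ball_normE.
Qed.

End Completeness.

Section SeriesLimit.
Context {F : numFieldType} (lf : local_field F) {p : nat}.

(** The coefficients converge one by one, and on half of the polydisc the terms
    outside of a box are uniformly negligible: so the power series of the limit
    coefficients sums to the limit of the values. *)
Lemma wnorm_limit (Y : nat -> mpoly p F) (r C : F) : 0 < r ->
  (forall k, wnorm r (Y k) <= C) ->
  (forall k, wnorm r (Y k.+1 - Y k) <= C * 2^-1 ^+ k) ->
  exists (c : {ffun 'I_p -> nat} -> F) (f : 'cV[F]_p -> F),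
    forall v : 'cV[F]_p, (forall i, `|v i 0| <= r / 2) ->
    [/\ (forall N, box_sum (fun a => `|c a * monomial a v|) N <= 3 * C),
        (box_sum (fun a => c a * monomial a v) @ \oo --> f v) &
        (forall k, `|meval (fun i => v i 0) (Y k) - f v| <= 2 * C * 2^-1 ^+ k)].
Proof.
move=> r0 YC dY.
have C0 : 0 <= C by exact: le_trans (wnorm_ge0 _ (ltW r0)) (YC 0).
have rn0 k : 0 < r ^+ k by rewrite exprn_gt0.
have exc m : exists l, forall k,
    `|mcoeff m (Y k) - l| <= 2 * (C / r ^+ mdeg m) * 2^-1 ^+ k.
  apply: geometric_limit => // k; rewrite mulrAC ler_pdivlMr// -mcoeffB.
  exact: le_trans (norm_mcoeff_le _ _ (ltW r0)) (dY k).
have exf (v : 'cV[F]_p) : exists l, (forall i, `|v i 0| <= r / 2) -> forall k,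
    `|meval (fun i => v i 0) (Y k) - l| <= 2 * C * 2^-1 ^+ k.
  have [vr|vr] := pselect (forall i, `|v i 0| <= r / 2); last by exists 0.
  have [|l hl] := @geometric_limit _ lf (fun k => meval (fun i => v i 0) (Y k)) C.
    move=> k; rewrite -mevalB; apply: le_trans (dY k); apply: norm_meval_le => i.
    by apply: le_trans (vr i) _; rewrite ler_pdivrMr// ler_peMr ?ler1n// ltW.
  by exists l.
have {exc}[c hc] := choice exc; have {exf}[f hf] := choice exf.
exists (fun a => c (mnm_of a)), f => v vr.
have ffK (m : multinom p) : mnm_of (ffun_of m) = m by apply/mnmP => i; rewrite mnmE ffunE.
have vr1 i : `|v i 0| <= r.
  by apply: le_trans (vr i) _; rewrite ler_pdivrMr// ler_peMr ?ler1n// ltW.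
have term m k : `|c m - mcoeff m (Y k)| * r ^+ mdeg m <= 2 * C * 2^-1 ^+ k.
  rewrite distrC -ler_pdivlMr//; apply: le_trans (hc m k) _.
  by rewrite le_eqVlt; apply/orP; left; apply/eqP; rewrite mulrA -!mulrA [_^-1 * _]mulrC.
pose S N : F := (size (box N : seq (multinom p)))%:R.
have S0 N : 0 <= S N by rewrite ler0n.
have cards N k : \sum_(m <- box N) `|c m - mcoeff m (Y k)| * r ^+ mdeg m
    <= S N * (2 * C) * 2^-1 ^+ k.
  apply: le_trans (ler_sum _ (fun m _ => term m k)) _.
  by rewrite big_const_seq iter_addr_0 count_predT -[leLHS]mulr_natl -[leRHS]mulrA.
have vm (m : multinom p) : `|\prod_i v i 0 ^+ m i| <= r ^+ mdeg m by exact: norm_monomial_le.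
split=> [N||k]; last exact: hf.
- rewrite box_sumE; apply/ler_addgt0Pr => e e0.
  have [k hk] := small_geo lf (mulr_ge0 (S0 N) (mulr_ge0 (ler0n _ 2) C0) : 0 <= S N * (2 * C)) e0.
  apply: (@le_trans _ _ (\sum_(m <- box N) (`|mcoeff m (Y k)| * r ^+ mdeg m
       + `|c m - mcoeff m (Y k)| * r ^+ mdeg m))).
    apply: ler_sum => m _; rewrite ffK monomialE normrM -mulrDl.
    apply: ler_pM => //.
    by rewrite -{1}[c m](subrK (mcoeff m (Y k))) [leRHS]addrC ler_normD.
  rewrite big_split/=; apply: lerD; last exact: le_trans (cards N k) hk.
  apply: le_trans (sum_box_le _ _ (ltW r0)) _.
  by apply: le_trans (YC k) _; rewrite ler_peMl// ler1n.
- have key N : `|box_sum (fun a => c (mnm_of a) * monomial a v) N - f v| <= 2^-1 ^+ N * C.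
    apply/ler_addgt0Pr => e e0.
    have [k hk] := small_geo lf (addr_ge0 (mulr_ge0 (S0 N) (mulr_ge0 (ler0n _ 2) C0)) (mulr_ge0 (ler0n _ 2) C0) : 0 <= S N * (2 * C) + 2 * C) e0.
    rewrite box_sumE.
    under eq_bigr do rewrite ffK monomialE.
    set s := \sum_(_ <- _) _.
    set t := \sum_(m <- box N) mcoeff m (Y k) * (\prod_i v i 0 ^+ m i).
    set y := meval (fun i => v i 0) (Y k).
    have -> : s - f v = (t - y) + ((s - t) + (y - f v)) by ring.
    apply: le_trans (ler_normD _ _) _; apply: lerD.
      apply: le_trans (box_tail _ _ (ltW r0) vr) _.
      by rewrite ler_pM2l ?YC// exprn_gt0// invr_gt0.
    apply: le_trans (ler_normD _ _) _; apply: le_trans hk.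
    rewrite mulrDl; apply: lerD; last exact: hf.
    apply: le_trans (cards N k).
    rewrite /s /t -sumrB; apply: le_trans (ler_norm_sum _ _ _) _.
    by apply: ler_sum => m _; rewrite -mulrBl normrM ler_wpM2l.
  apply/cvgrPdist_le => e e0.
  have [N hN] := small_geo lf C0 e0.
  near=> n; rewrite distrC; apply: le_trans (key n) _; apply: le_trans hN.
  rewrite mulrC ler_wpM2l//; apply: ler_wiXn2l; rewrite ?invr_ge0 ?invf_le1 ?ler1n//.
  by near: n; exact: nbhs_infty_ge.
Unshelve. all: by end_near.
Qed.

End SeriesLimit.

Section QuadraticImplicit.
Context {F : numFieldType} (lf : local_field F) {p m : nat}.
Context (c : 'I_m -> mpoly p F) (l : 'I_m -> 'I_m -> mpoly p F)
  (q : 'I_m -> 'I_m -> 'I_m -> mpoly p F).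
Context (c0 : forall j, mcoeff (@mnm0 p) (c j) = 0)
  (l0 : forall j k, mcoeff (@mnm0 p) (l j k) = 0).

Let Q (y : 'I_m -> mpoly p F) j : mpoly p F :=
  c j + \sum_k l j k * y k + \sum_k \sum_k' q j k k' * (y k * y k').

Let coef_bound : exists2 M, 1 <= M & [/\ forall j, wnorm 1 (c j) <= M,
  forall j k, wnorm 1 (l j k) <= M & forall j k k', wnorm 1 (q j k k') <= M].
Proof.
have bnd (I : finType) (g : I -> mpoly p F) : exists2 M, 0 <= M & forall i, wnorm 1 (g i) <= M.
  exists (\sum_i wnorm 1 (g i)); first by apply: sumr_ge0 => i _; exact: wnorm_ge0.
  by move=> i; rewrite (bigD1 i)//= lerDl; apply: sumr_ge0 => k _; exact: wnorm_ge0.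
have [M1 M10 h1] := bnd _ c.
have [M2 M20 h2] := bnd _ (fun jk => l jk.1 jk.2).
have [M3 M30 h3] := bnd _ (fun jk => q jk.1 jk.2.1 jk.2.2).
exists (1 + M1 + M2 + M3).
  by rewrite -!addrA lerDl !addr_ge0.
split=> [j|j k|j k k'].
- by apply: le_trans (h1 j) _; rewrite addrAC [1 + _]addrC -!addrA lerDl !addr_ge0.
- by apply: le_trans (h2 (j, k)) _; rewrite addrAC [_ + M2]addrC -!addrA lerDl !addr_ge0.
- by apply: le_trans (h3 (j, (k, k'))) _; rewrite lerDr !addr_ge0.
Qed.

(** The radius [r] of the parameters is chosen small enough for [c] and [l] to be
    small, and the radius [rho] of the unknowns small against [q]. *)
Let contraction : exists r rho : F, [/\ 0 < r, 0 < rho,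
  forall j, wnorm r (c j) <= rho / 2 &
  forall y y' D, (forall j, wnorm r (y j) <= rho) -> (forall j, wnorm r (y' j) <= rho) ->
    (forall j, wnorm r (y j - y' j) <= D) ->
    forall j, wnorm r (Q y j - Q y' j) <= D / 2].
Proof.
have [M M1 [cM lM qM]] := coef_bound.
have M0 : 0 < M by exact: lt_le_trans M1.
pose S := M * (m.+1%:R ^+ 2).
have S1 : 1 <= S by rewrite -[leLHS]mulr1 ler_pM// exprn_ege1// ler1n.
have S0 : 0 < S by exact: lt_le_trans S1.
have m0 : 0 <= m%:R :> F by rewrite ler0n.
have mS : m%:R * M <= S.
  rewrite /S mulrC ler_pM2l// (@le_trans _ _ m.+1%:R)// ?ler_nat// expr2.
  by rewrite ler_peMr ?ler0n// ler1n.
have mmS : m%:R * m%:R * M <= S.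
  by rewrite /S mulrC ler_pM2l// expr2 ler_pM// ler_nat.
pose rho := (8 * S)^-1.
have rho0 : 0 < rho by rewrite invr_gt0 mulr_gt0.
have Srho : S * rho = 8^-1 by rewrite /rho; field; rewrite gt_eqF.
pose r := rho / (4 * S).
have r0 : 0 < r by rewrite divr_gt0// mulr_gt0.
have Sr : S * r = rho / 4 by rewrite /r; field; rewrite gt_eqF.
have rho1 : rho <= 1.
  by rewrite invf_le1 ?mulr_gt0// -[leLHS]mulr1 ler_pM// ler1n.
have r1 : r <= 1.
  have : r <= S * r by rewrite ler_peMl// ltW.
  move/le_trans; apply; rewrite Sr.
  by rewrite ler_pdivrMr// mul1r (le_trans rho1)// ler1n.
have shr a : mcoeff (@mnm0 p) a = 0 -> wnorm 1 a <= M -> wnorm r a <= r * M.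
  move=> a0 aM; have := @wnorm_shrink _ _ 1 r a ler01; rewrite r1 ltW// mulr1.
  by move=> /(_ isT a0) /le_trans; apply; rewrite ler_pM2l.
have cS j : wnorm r (c j) <= rho / 4.
  apply: le_trans (shr _ (c0 j) (cM j)) _; rewrite -Sr mulrC ler_pM2r//.
  by rewrite -[leLHS]mulr1 /S ler_pM2l// exprn_ege1// ler1n.
exists r, rho; split=> //.
  move=> j; apply: le_trans (cS j) _; rewrite ler_pM2l//.
  by rewrite lef_pV2 ?posrE// ler_nat.
move=> y y' D yr y'r yD j.
have D0 : 0 <= D by exact: le_trans (wnorm_ge0 _ (ltW r0)) (yD j).
have -> : Q y j - Q y' j = \sum_k l j k * (y k - y' k)
    + \sum_k \sum_k' q j k k' * (y k * (y k' - y' k') + (y k - y' k) * y' k').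
  rewrite /Q.
  have -> : \sum_k l j k * (y k - y' k) = \sum_k l j k * y k - \sum_k l j k * y' k.
    by rewrite -sumrB; apply: eq_bigr => k _; rewrite mulrBr.
  have -> : \sum_k \sum_k' q j k k' * (y k * (y k' - y' k') + (y k - y' k) * y' k') =
      \sum_k \sum_k' q j k k' * (y k * y k') - \sum_k \sum_k' q j k k' * (y' k * y' k').
    rewrite -sumrB; apply: eq_bigr => k _; rewrite -sumrB; apply: eq_bigr => k' _.
    by ring.
  by ring.
apply: le_trans (wnormD _ _ (ltW r0)) _.
have -> : D / 2 = D / 4 + D / 4 by field.
apply: lerD.
  apply: (@le_trans _ _ (\sum_(k < m) r * M * D)).
    apply: le_trans (wnorm_sum _ _ _ (ltW r0)) _; apply: ler_sum => k _.
    apply: le_trans (wnormM _ _ (ltW r0)) _.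
    by apply: ler_pM; rewrite ?wnorm_ge0 ?(ltW r0)// shr.
  rewrite sumr_const card_ord -[leLHS]mulr_natl.
  have -> : m%:R * (r * M * D) = D * (m%:R * M * r) by ring.
  rewrite ler_wpM2l//; apply: (@le_trans _ _ (S * r)); first by rewrite ler_pM2r.
  by rewrite Sr ler_piMl// invr_ge0.
apply: (@le_trans _ _ (\sum_(k < m) \sum_(k' < m) M * (rho * D + D * rho))).
  apply: le_trans (wnorm_sum _ _ _ (ltW r0)) _; apply: ler_sum => k _.
  apply: le_trans (wnorm_sum _ _ _ (ltW r0)) _; apply: ler_sum => k' _.
  apply: le_trans (wnormM _ _ (ltW r0)) _.
  have h0 a : 0 <= wnorm r a by rewrite wnorm_ge0// ltW.
  apply: ler_pM => //.
    by apply: le_trans (qM j k k'); apply: ler_wnorm; rewrite (ltW r0).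
  apply: le_trans (wnormD _ _ (ltW r0)) _.
  by apply: lerD; apply: le_trans (wnormM _ _ (ltW r0)) _; apply: ler_pM.
rewrite !sumr_const !card_ord -mulrnA -[leLHS]mulr_natl natrM.
have -> : m%:R * m%:R * (M * (rho * D + D * rho)) = D * ((m%:R * m%:R * M) * rho * 2).
  by ring.
rewrite ler_wpM2l//; apply: (@le_trans _ _ (S * rho * 2)).
  by rewrite ler_pM2r// ler_pM2r.
by rewrite Srho le_eqVlt; apply/orP; left; apply/eqP; field.
Qed.

Let Y k : 'I_m -> mpoly p F := iter k Q (fun=> 0).

Let Y0 k j : mcoeff (@mnm0 p) (Y k j) = 0.
Proof.
have cM (a b : mpoly p F) : mcoeff (@mnm0 p) b = 0 -> mcoeff (@mnm0 p) (a * b) = 0.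
  by move=> b0; have [-> _] := @mcoeff0_is_multiplicative p F; rewrite b0 mulr0.
elim: k j => [|k IH] j; first by rewrite mcoeff0.
rewrite /Y iterS -/(Y k) /Q !mcoeffD c0 !raddf_sum/= !big1 ?addr0// => i _.
  by rewrite raddf_sum/= big1// => i' _; apply/cM/cM/IH.
by apply/cM/IH.
Qed.

(** The fixed point of the contraction is the limit of its iterates from zero,
    which are polynomials in the parameters and converge in the weighted norm. *)
Lemma analytic_quadratic (w : 'cV[F]_p) : exists f : 'I_m -> 'cV[F]_p -> F,
  [/\ forall j, analytic_at (f j) w, forall j, f j w = 0,
      forall j e, 0 < e -> \forall v \near w, `|f j v| <= e &
      \forall v \near w, forall j, let u := fun i => (v - w) i 0 in
        f j v = meval u (c j) + \sum_k meval u (l j k) * f k v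
          + \sum_k \sum_k' meval u (q j k k') * (f k v * f k' v)].
Proof.
have [r [rho [r0 rho0 crho lip]]] := contraction.
have YS k : Y k.+1 = Q (Y k) by rewrite /Y iterS.
have Q0 j : Q (fun=> 0) j = c j.
  by rewrite /Q !big1 ?addr0// => i _; rewrite ?mulr0// big1// => i' _; rewrite !mulr0.
have Yrho k j : wnorm r (Y k j) <= rho.
  elim: k j => [|k IH] j; first by rewrite wnorm0 ltW.
  rewrite YS -[Q _ j](subrK (Q (fun=> 0) j)).
  apply: le_trans (wnormD _ _ (ltW r0)) _; rewrite [leRHS]splitr Q0.
  apply: lerD => //; rewrite -Q0; apply: lip => // i; first by rewrite wnorm0 ltW.
  by rewrite subr0.
have dY k j : wnorm r (Y k.+1 j - Y k j) <= rho * 2^-1 ^+ k.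
  elim: k j => [|k IH] j; first by rewrite expr0 mulr1 subr0.
  by rewrite !YS exprS mulrCA mulrC; apply: lip; rewrite // -YS.
have lim j := @wnorm_limit _ lf _ (fun k => Y k j) r rho r0 (Yrho^~ j) (dY^~ j).
have {lim}[C hC] := choice lim.
have {hC}[f hf] := choice hC.
have small (t : F) : 0 < t -> \forall v \near w, forall i, `|(v - w) i 0| < t.
  move=> t0; near=> v => i; have : ball w t v by near: v; exact: nbhsx_ballx.
  by case=> _ /(_ i 0); rewrite -ball_normE /= distrC !mxE.
have r20 : 0 < r / 2 by rewrite divr_gt0.
have bound j t (u : 'cV[F]_p) : 0 <= t <= 2^-1 -> (forall i, `|u i 0| <= t * r) ->
    `|f j u| <= t * rho.
  move=> /andP[t0 t2] ut.
  have t1 : t <= 1 by apply: le_trans t2 _; rewrite invf_le1// ler1n.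
  have ur i : `|u i 0| <= r / 2 by apply: le_trans (ut i) _; rewrite mulrC ler_pM2l.
  have [_ _ h] := hf j _ ur.
  apply/ler_addgt0Pr => e e0.
  have [k hk] := small_geo lf (ltW (mulr_gt0 (ltr0n _ 2) rho0) : 0 <= 2 * rho) e0.
  rewrite -[f j u](subKr (meval (fun i => u i 0) (Y k j))).
  apply: le_trans (ler_normB _ _) _; apply: lerD; last exact: le_trans (h k) hk.
  apply: le_trans (norm_meval_le _ ut) _.
  apply: le_trans (wnorm_shrink (ltW r0) _ (Y0 k j)) _; first by rewrite t0.
  by rewrite ler_wpM2l.
exists (fun j v => f j (v - w)); split=> [j|j|j e e0|].
- exists (C j); near=> v.
  have vr : forall i, `|(v - w) i 0| <= r / 2.
    by move=> i; apply: ltW; move: i; near: v; exact: small.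
  by have [h1 h2 _] := hf j _ vr; split=> //; exists (3 * rho).
- have := @bound j 0 (w - w); rewrite !mul0r normr_le0 lexx invr_ge0 ler0n => h.
  by apply/eqP/h => // i; rewrite subrr mxE normr0.
- pose t := e / (2 * (rho + e)).
  have re0 : 0 < rho + e by exact: addr_gt0.
  have t0 : 0 < t by rewrite divr_gt0// mulr_gt0.
  have sm := small (t * r) (mulr_gt0 t0 r0).
  apply: (@filterS _ (nbhs w) _ _ _ _ sm) => v sv.
  apply: (@le_trans _ _ (t * rho)); last first.
    rewrite /t mulrAC ler_pdivrMr ?mulr_gt0// ler_pM2l//.
    by rewrite mulr_natl mulr2n -addrA lerDl addr_ge0 ?ltW// addr_gt0.
  apply: bound.
    rewrite ltW//= /t ler_pdivrMr ?mulr_gt0// mulKf//.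
    by rewrite lerDr ltW.
  by move=> i; exact/ltW/sv.
- suff key (v : 'cV[F]_p) : (forall i, `|(v - w) i 0| < r / 2) ->
      forall j, let u := fun i => (v - w) i 0 in f j (v - w) =
        meval u (c j) + \sum_k meval u (l j k) * f k (v - w)
          + \sum_k \sum_k' meval u (q j k k') * (f k (v - w) * f k' (v - w)).
    exact: (filterS key (small _ r20)).
  move=> sv j u.
  have vr i : `|(v - w) i 0| <= r / 2 by exact/ltW/sv.
  have cvY k : meval u (Y n k) @[n --> \oo] --> f k (v - w).
    have [_ _ h] := hf k _ vr.
    apply/cvgrPdist_le => e e0.
    have [N hN] := small_geo lf (ltW (mulr_gt0 (ltr0n _ 2) rho0) : 0 <= 2 * rho) e0.
    near=> n; rewrite distrC; apply: le_trans (h n) _; apply: le_trans hN.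
    rewrite ler_pM2l ?mulr_gt0//; apply: ler_wiXn2l; rewrite ?invr_ge0 ?invf_le1 ?ler1n//.
    by near: n; exact: nbhs_infty_ge.
  have cvS (g : 'I_m -> nat -> F) (b : 'I_m -> F) :
      (forall i, g i n @[n --> \oo] --> b i) ->
      \sum_i g i n @[n --> \oo] --> \sum_i b i.
    move=> gb; elim: (index_enum _) => [|i s IH].
      by under eq_fun do rewrite big_nil; rewrite big_nil; exact: cvg_cst.
    under eq_fun do rewrite big_cons; rewrite big_cons.
    exact: (cvgD (gb i) IH).
  have c1 : meval u (Y n.+1 j) @[n --> \oo] --> f j (v - w).
    by rewrite (cvg_shiftS (fun n => meval u (Y n j))).
  have c2 : meval u (Y n.+1 j) @[n --> \oo] --> meval u (c j)
      + \sum_k meval u (l j k) * f k (v - w)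
      + \sum_k \sum_k' meval u (q j k k') * (f k (v - w) * f k' (v - w)).
    under eq_fun => n.
      rewrite YS /Q !mevalD !raddf_sum/=.
      under eq_bigr do rewrite mevalM.
      under [X in _ + X]eq_bigr => k _.
        rewrite raddf_sum/=.
        under eq_bigr do rewrite !mevalM.
        over.
      over.
    have c3 : \sum_k meval u (l j k) * meval u (Y n k) @[n --> \oo] -->
        \sum_k meval u (l j k) * f k (v - w).
      by apply: cvS => k; exact: (cvgM (cvg_cst _) (cvY k)).
    have c4 : \sum_k \sum_k' meval u (q j k k') * (meval u (Y n k) * meval u (Y n k'))
        @[n --> \oo] --> \sum_k \sum_k' meval u (q j k k') * (f k (v - w) * f k' (v - w)).
      apply: (@cvS) => k; apply: (@cvS) => k'.
      exact: (cvgM (cvg_cst _) (cvgM (cvY k) (cvY k'))).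
    exact: (cvgD (cvgD (cvg_cst _) c3) c4).
  exact: (cvg_unique (@norm_hausdorff _ _) c1 c2).
Unshelve. all: by end_near.
Qed.

End QuadraticImplicit.

Lemma colB (V : zmodType) k (u v : 'cV[V]_k) i : (u - v) i 0 = u i 0 - v i 0.
Proof. by rewrite !mxE. Qed.

Lemma colD (V : zmodType) k (u v : 'cV[V]_k) i : (u + v) i 0 = u i 0 + v i 0.
Proof. by rewrite mxE. Qed.

Lemma colZ (K : pzRingType) k (a : K) (u : 'cV[K]_k) i : (a *: u) i 0 = a * u i 0.
Proof. by rewrite mxE. Qed.

Section AnalyticImplicit.
Context {F : numFieldType}.

Let aff p (a0 : F) (a : 'I_p -> F) : mpoly p F :=
  mpolyC p a0 + \sum_t a t *: mpolyX F (mnm1 t).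

Let meval_aff p a0 (a : 'I_p -> F) u : meval u (aff a0 a) = a0 + \sum_t a t * u t.
Proof.
rewrite mevalD mevalC raddf_sum/=; congr (_ + _); apply: eq_bigr => t _.
by rewrite mevalZ mevalXU.
Qed.

Let mcoeff_aff p a0 (a : 'I_p -> F) : mcoeff (@mnm0 p) (aff a0 a) = a0.
Proof.
rewrite mcoeffD mcoeffC eqxx mulr1 raddf_sum/= big1 ?addr0// => t _.
by rewrite mcoeffZ mcoeffX mnm1_eq0 mulr0.
Qed.

(** An instance of the analytic implicit function theorem: multiplied by the
    inverse of its linear part, the equation has the fixed point form of
    [analytic_quadratic]. *)
Lemma analytic_implicit (lf : local_field F) p m (T : 'M[F]_m) (w : 'cV[F]_p)
    (C : 'I_p -> 'cV[F]_m) (L : 'I_p -> 'I_m -> 'cV[F]_m)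
    (Q0 : 'I_m -> 'I_m -> 'cV[F]_m) (Q1 : 'I_p -> 'I_m -> 'I_m -> 'cV[F]_m) :
  T \in unitmx -> exists y : 'cV[F]_p -> 'cV[F]_m,
  [/\ forall j, analytic_at (fun u => y u j 0) w, y w = 0,
      forall e, 0 < e -> \forall v \near w, forall j, `|y v j 0| <= e &
      \forall v \near w, let a t := (v - w) t 0 in
        T *m y v + \sum_t a t *: C t + \sum_k y v k 0 *: (\sum_t a t *: L t k)
        + \sum_k \sum_k' (y v k 0 * y v k' 0) *: (Q0 k k' + \sum_t a t *: Q1 t k k') = 0].
Proof.
move=> uT; pose S := - invmx T.
have [||f [fa f0 fs fe]] := @analytic_quadratic F lf p m
  (fun j => aff 0 (fun t => (S *m C t) j 0))
  (fun j k => aff 0 (fun t => (S *m L t k) j 0))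
  (fun j k k' => aff ((S *m Q0 k k') j 0) (fun t => (S *m Q1 t k k') j 0)) _ _ w.
- by move=> j; rewrite mcoeff_aff.
- by move=> j k; rewrite mcoeff_aff.
have linS (a : 'I_p -> F) (M : 'I_p -> 'cV[F]_m) j :
    (S *m \sum_t a t *: M t) j 0 = \sum_t (S *m M t) j 0 * a t.
  rewrite mulmx_sumr summxE; apply: eq_bigr => t _.
  by rewrite -scalemxAr mxE mulrC.
exists (fun u => \col_j f j u); split.
- by move=> j; have := fa j; congr (analytic_at _ w); apply/funext => u; rewrite mxE.
- by apply/matrixP => j k; rewrite !mxE f0.
- have fs' e (e0 : 0 < e) : \forall v \near w, forall j, `|f j v| <= e.
    exact: (@filter_forall _ _ (fun j v => `|f j v| <= e) (nbhs w) _ (fun j => fs j e e0)).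
  by move=> e e0; apply: filterS (fs' e e0) => v h j; rewrite mxE.
apply: filterS fe => v h; set y := \col_j _.
set E3 := \sum_k _; set E1 := \sum_t _; set E2 := \sum_k _.
suff -> : y = S *m (E1 + E2 + E3) by rewrite /S mulNmx mulmxN mulKVmx// -!addrA addNr.
apply/matrixP => j z; rewrite ord1 [LHS]mxE h.
rewrite !mulmxDr !colD; congr (_ + _ + _).
- by rewrite meval_aff add0r linS.
- rewrite mulmx_sumr summxE; apply: eq_bigr => k _.
  by rewrite meval_aff add0r -scalemxAr colZ linS mulrC mxE.
rewrite mulmx_sumr summxE; apply: eq_bigr => k _.
rewrite mulmx_sumr summxE; apply: eq_bigr => k' _.
by rewrite meval_aff -scalemxAr colZ mulmxDr colD linS mulrC !mxE.
Qed.

Lemma near_mx (T : topologicalType) m k (f : T -> 'M[F]_(m, k)) (w : T) :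
  (forall e, 0 < e -> \forall v \near w, forall i j, `|(f v - f w) i j| <= e) ->
  f v @[v --> w] --> f w.
Proof.
move=> h A [E hE sub]; apply: filterS sub _.
have hij (ij : 'I_m * 'I_k) : \forall t \near w, E ij.1 ij.2 (f t ij.1 ij.2).
  have : (fun t => f t ij.1 ij.2) @ w --> f w ij.1 ij.2.
    apply/cvgrPdist_le => e e0; apply: filterS (h e e0) => t ht.
    by rewrite distrC; have := ht ij.1 ij.2; rewrite !mxE.
  by move=> /(_ _ (hE _ _)).
have : \forall t \near w, forall ij : 'I_m * 'I_k, E ij.1 ij.2 (f t ij.1 ij.2).
  exact: filter_forall.
by apply: filterS => t ht i j; exact: (ht (i, j)).
Qed.

(** Only the constant coefficient of the power series changes. *)
Lemma analytic_addc d (f : 'cV[F]_d -> F) w a :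
  analytic_at f w -> analytic_at (fun u => a + f u) w.
Proof.
move=> [c hc]; pose z : {ffun 'I_d -> nat} := [ffun=> 0%N].
pose dl (x : {ffun 'I_d -> nat}) : F := if x == z then a else 0.
have bD (u u' : {ffun 'I_d -> nat} -> F) N :
    box_sum (fun x => u x + u' x) N = box_sum u N + box_sum u' N by rewrite /box_sum big_split.
have b1 (u : {ffun 'I_d -> nat} -> F) N : (forall x, x != z -> u x = 0) -> box_sum u N.+1 = u z.
  move=> hu; rewrite /box_sum (bigD1 [ffun=> ord0])//= big1 ?addr0.
    by congr u; apply/ffunP => i; rewrite !ffunE.
  move=> x xz; apply: hu; apply: contra_neq xz => /ffunP e; apply/ffunP => i.
  by have := e i; rewrite !ffunE => h; exact: val_inj.
have mz v : monomial z v = 1 by rewrite /monomial big1// => i _; rewrite ffunE expr0.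
exists (fun x => dl x + c x); apply: filterS hc => v [[M hM] cv]; split.
  pose D N := box_sum (fun x => `|dl x * monomial x (v - w)|) N.
  exists (`|a| + D 0%N + M) => N; apply: (@le_trans _ _ (D N + M)).
    apply: le_trans (lerD (lexx (D N)) (hM N)).
    rewrite -bD; apply: ler_sum => x _; rewrite mulrDl; exact: ler_normD.
  rewrite lerD2r; case: N => [|N]; first by rewrite lerDr.
  rewrite /D b1 => [|x /negPf xz]; last by rewrite /dl xz mul0r normr0.
  by rewrite /dl eqxx mz mulr1 lerDl; apply: sumr_ge0.
have : a + box_sum (fun x => c x * monomial x (v - w)) N @[N --> \oo] --> a + f v.
  by apply: cvgD => //; exact: cvg_cst.
have e N : box_sum (fun x => (dl x + c x) * monomial x (v - w)) N.+1 =
    a + box_sum (fun x => c x * monomial x (v - w)) N.+1.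
  transitivity (box_sum (fun x => dl x * monomial x (v - w) + c x * monomial x (v - w)) N.+1).
    by congr box_sum; apply/funext => x; rewrite mulrDl.
  rewrite bD b1 => [|x /negPf xz]; first by rewrite /dl eqxx mz mulr1.
  by rewrite /dl xz mul0r.
rewrite -cvg_shiftS -[X in _ -> X]cvg_shiftS.
by under [X in _ -> (X @ _ --> _)]eq_fun do rewrite e.
Qed.

End AnalyticImplicit.

(** * Tuples of points of the projective line *)

Section Wedge.
Context {F : fieldType}.

(** A tuple of points of the projective line is a matrix with two rows whose
    columns are homogeneous coordinates: [wdg] vanishes when two of its points
    coincide, and [nzc] excludes the columns that are no coordinates. *)
Definition wdg {n m} (X : 'M[F]_(2, n)) (i : 'I_n) (Y : 'M[F]_(2, m)) (j : 'I_m) : F :=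
  X 0 i * Y 1 j - X 1 i * Y 0 j.

Definition nzc {n} (X : 'M[F]_(2, n)) (i : 'I_n) : bool := (X 0 i != 0) || (X 1 i != 0).

Lemma ord2 (k : 'I_2) : k = 0 \/ k = 1.
Proof. by case: k => [[|[|//]] ?]; [left|right]; apply: val_inj. Qed.

Lemma mul2E m n (A : 'M[F]_(m, 2)) (X : 'M[F]_(2, n)) i j :
  (A *m X) i j = A i 0 * X 0 j + A i 1 * X 1 j.
Proof.
rewrite mxE !big_ord_recl big_ord0 addr0; congr (_ * _ + A i _ * X _ j);
  exact: val_inj.
Qed.

Lemma det2E (A : 'M[F]_2) : \det A = A 0 0 * A 1 1 - A 0 1 * A 1 0.
Proof.
rewrite (expand_det_row _ 0) !big_ord_recl big_ord0 addr0 /cofactor !det_mx11 !mxE /=.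
rewrite addn0 expr0 mul1r expr1 mulN1r mulrN.
by congr (A _ _ * A _ _ - A _ _ * A _ _); apply: val_inj.
Qed.

Section Identities.
Context {n m k : nat} (X : 'M[F]_(2, n)) (Y : 'M[F]_(2, m)) (Z : 'M[F]_(2, k)).

Lemma wdgC i j : wdg X i Y j = - wdg Y j X i.
Proof. by rewrite /wdg; ring. Qed.

Lemma wdgxx i : wdg X i X i = 0.
Proof. by rewrite /wdg; ring. Qed.

Lemma wdg_mul (A : 'M[F]_2) i j : wdg (A *m X) i (A *m Y) j = \det A * wdg X i Y j.
Proof. by rewrite /wdg !mul2E det2E; ring. Qed.

Lemma wdg_plucker r i j l :
  wdg X i Z l * Y r j = wdg Y j Z l * X r i + wdg X i Y j * Z r l.
Proof. by rewrite /wdg; case: (ord2 r) => ->; ring. Qed.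

Lemma wdg_trans i j l : nzc Y j -> wdg X i Y j = 0 -> wdg Y j Z l = 0 -> wdg X i Z l = 0.
Proof.
move=> Yj xy yz; have h r := wdg_plucker r i j l.
case/orP: Yj => Y0; [have := h 0|have := h 1]; rewrite xy yz !mul0r addr0 => /eqP;
  by rewrite mulf_eq0 (negPf Y0) orbF => /eqP.
Qed.

Lemma wdg_scale i j : nzc Y j -> wdg X i Y j = 0 -> exists c, forall r, X r i = c * Y r j.
Proof.
move=> /orP[Y0|Y0] /eqP; rewrite subr_eq0 => /eqP e.
  exists (X 0 i / Y 0 j) => r; case: (ord2 r) => ->; first by rewrite divfK.
  by rewrite mulrAC e mulfK.
exists (X 1 i / Y 1 j) => r; case: (ord2 r) => ->; last by rewrite divfK.
by rewrite mulrAC -e mulfK.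
Qed.

End Identities.

Lemma wdg_sym n m (X : 'M[F]_(2, n)) (Y : 'M[F]_(2, m)) i j :
  (wdg X i Y j == 0) = (wdg Y j X i == 0).
Proof. by rewrite wdgC oppr_eq0. Qed.

Lemma nzc_mul n (A : 'M[F]_2) (X : 'M[F]_(2, n)) i :
  A \in unitmx -> nzc (A *m X) i = nzc X i.
Proof.
have aux (B : 'M[F]_2) (Z : 'M[F]_(2, n)) : nzc (B *m Z) i -> nzc Z i.
  apply: contraTT; rewrite /nzc !negb_or !negbK => /andP[/eqP e0 /eqP e1].
  by rewrite !mul2E e0 e1 !mulr0 addr0 !eqxx.
move=> uA; apply/idP/idP; first exact: aux.
by rewrite -{1}[X](mulKmx uA); exact: aux.
Qed.

(** Lagrange interpolation of a binary quadratic form. *)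
Lemma quadratic_interpolation n (X : 'M[F]_(2, n)) i j k (a b c u v : F) :
  let q x y := a * x ^+ 2 + b * (x * y) + c * y ^+ 2 in
  let w l := u * X 1 l - v * X 0 l in
  q u v * (wdg X i X j * wdg X i X k * wdg X j X k) =
    q (X 0 i) (X 1 i) * w j * w k * wdg X j X k
    - q (X 0 j) (X 1 j) * w i * w k * wdg X i X k
    + q (X 0 k) (X 1 k) * w i * w j * wdg X i X j.
Proof. by rewrite /= /wdg; ring. Qed.

Lemma quadratic_three_zeros n (X : 'M[F]_(2, n)) i j k (a b c : F) :
  wdg X i X j != 0 -> wdg X i X k != 0 -> wdg X j X k != 0 ->
  (forall l, l \in [:: i; j; k] ->
    a * X 0 l ^+ 2 + b * (X 0 l * X 1 l) + c * X 1 l ^+ 2 = 0) ->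
  [/\ a = 0, b = 0 & c = 0].
Proof.
move=> ij ik jk h.
have qi := h i (mem_head _ _).
have qj : a * X 0 j ^+ 2 + b * (X 0 j * X 1 j) + c * X 1 j ^+ 2 = 0.
  by apply: h; rewrite !inE eqxx orbT.
have qk : a * X 0 k ^+ 2 + b * (X 0 k * X 1 k) + c * X 1 k ^+ 2 = 0.
  by apply: h; rewrite !inE eqxx !orbT.
have q0 u v : a * u ^+ 2 + b * (u * v) + c * v ^+ 2 = 0.
  have /eqP := quadratic_interpolation X i j k a b c u v.
  rewrite /= qi qj qk !mul0r subr0 addr0 !mulf_eq0 (negPf ij) (negPf ik) (negPf jk) !orbF.
  by move/eqP.
have a0 : a = 0 by have := q0 1 0; rewrite expr1n !(mulr0, mulr1, addr0, expr0n).
have c0 : c = 0 by have := q0 0 1; rewrite expr1n !(mulr0, mulr1, mul0r, add0r, expr0n).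
by split=> //; have := q0 1 1; rewrite a0 c0 !mul0r !mulr1 add0r addr0.
Qed.

Lemma rank_one (A : 'M[F]_2) : A != 0 -> \det A = 0 ->
  exists p q : 'cV[F]_2, [/\ nzc p 0, nzc q 0 &
    forall n (X : 'M[F]_(2, n)) i r, (A *m X) r i = wdg p 0 X i * q r 0].
Proof.
move=> A0; rewrite det2E => /eqP; rewrite subr_eq0 => /eqP d0.
pose v2 (a b : F) : 'cV[F]_2 := \col_r (if r == 0 then a else b).
have v20 a b : v2 a b 0 0 = a by rewrite mxE.
have v21 a b : v2 a b 1 0 = b by rewrite mxE.
have [[A00 A01]|h0] := pselect (A 0 0 = 0 /\ A 0 1 = 0).
  exists (v2 (A 1 1) (- A 1 0)), (v2 0 1); split.
  - rewrite /nzc v20 v21 oppr_eq0 orbC -negb_and; apply: contra A0 => /andP[/eqP e0 /eqP e1].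
    by apply/eqP/matrixP => i j; case: (ord2 i) (ord2 j) => -> [] ->; rewrite !mxE.
  - by rewrite /nzc v21 oner_eq0 orbT.
  - move=> n X i r; rewrite mul2E /wdg v20 v21; case: (ord2 r) => ->.
      by rewrite A00 A01 v20; ring.
    by rewrite v21; ring.
have nz : (A 0 1 != 0) || (- A 0 0 != 0).
  rewrite oppr_eq0 -negb_and; apply/negP => /andP[/eqP e1 /eqP e0]; exact: h0.
pose c := if A 0 0 == 0 then A 1 1 / A 0 1 else A 1 0 / A 0 0.
have [c0 c1] : A 1 0 = c * A 0 0 /\ A 1 1 = c * A 0 1.
  rewrite /c; case: eqP => [e|/eqP e].
    have e1 : A 0 1 != 0 by move: nz; rewrite e oppr0 eqxx orbF.
    split; last by rewrite divfK.
    by move: d0; rewrite e mul0r => /esym/eqP; rewrite mulf_eq0 (negPf e1)/= mulr0 => /eqP.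
  by rewrite divfK//; split=> //; rewrite mulrAC [_ * A 0 1]mulrC -d0 mulrC mulKf.
exists (v2 (A 0 1) (- A 0 0)), (v2 1 c); split.
- by rewrite /nzc v20 v21.
- by rewrite /nzc v20 oner_eq0.
- move=> n X i r; rewrite mul2E /wdg v20 v21; case: (ord2 r) => ->.
    by rewrite v20; ring.
  by rewrite v21 c0 c1; ring.
Qed.

End Wedge.

Section TupleRelation.
Context {F : fieldType} {n : nat}.
Implicit Types (X Y Z : 'M[F]_(2, n)) (A B : 'M[F]_2) (s t : {perm 'I_n}).

(** The matrix may be singular, so that the relation survives limits of
    projectivities. *)
Definition rel_by A s X Y := forall i, wdg (A *m X) i Y (s i) = 0.

Definition good X := forall i, nzc X i.

Definition three X := exists i j k,
  [/\ wdg X i X j != 0, wdg X i X k != 0 & wdg X j X k != 0].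

Definition good3 X := good X /\ three X.

Definition tequiv X Y := exists2 A, A \in unitmx & exists s, rel_by A s X Y.

Definition cmult X i := #|[set j | wdg X i X j == 0]%SET|.

Definition pmult (p : 'cV[F]_2) X := #|[set i | wdg p 0 X i == 0]%SET|.

(** Stability of binary forms in the sense of geometric invariant theory. *)
Definition stable X := good3 X /\ forall i, (2 * cmult X i < n)%N.

Lemma rel_by1 X : rel_by 1%:M 1%g X X.
Proof. by move=> i; rewrite mul1mx perm1 wdgxx. Qed.

Lemma rel_byV A s X Y : A \in unitmx -> rel_by A s X Y -> rel_by (invmx A) s^-1%g Y X.
Proof.
move=> uA h j; rewrite -[X in wdg _ _ X _](mulKmx uA) wdg_mul wdgC.
by have := h (s^-1%g j); rewrite permKV => ->; rewrite oppr0 mulr0.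
Qed.

Lemma rel_byM A B s t X Y Z : good Y -> rel_by A s X Y -> rel_by B t Y Z ->
  rel_by (B *m A) (s * t)%g X Z.
Proof.
move=> gY h k i; have [c hc] := wdg_scale (gY (s i)) (h i).
rewrite permM -mulmxA.
have -> : wdg (B *m (A *m X)) i Z (t (s i)) = c * wdg (B *m Y) (s i) Z (t (s i)).
  by rewrite /wdg !(mul2E B) !hc; ring.
by rewrite k mulr0.
Qed.

Lemma rel_by_good A s X Y : A \in unitmx -> good X -> rel_by A s X Y ->
  exists c : 'I_n -> F, forall i r, Y r (s i) = c i * (A *m X) r i.
Proof.
move=> uA gX h.
suff /choice[c hc] : forall i, exists c, forall r, Y r (s i) = c * (A *m X) r i by exists c.
move=> i; apply: wdg_scale; first by rewrite nzc_mul.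
by rewrite wdgC h oppr0.
Qed.

Lemma rel_by_wdg A s X Y i j : A \in unitmx -> good X -> good Y -> rel_by A s X Y ->
  (wdg Y (s i) Y (s j) == 0) = (wdg X i X j == 0).
Proof.
move=> uA gX gY h; have [c hc] := rel_by_good uA gX h.
have c0 l : c l != 0.
  by apply/negP => /eqP c0; have := gY (s l); rewrite /nzc !hc c0 !mul0r eqxx.
have -> : wdg Y (s i) Y (s j) = c i * c j * wdg (A *m X) i (A *m X) j.
  by rewrite /wdg !hc; ring.
by rewrite wdg_mul !mulf_eq0 !(negPf (c0 _))/=; move: uA; rewrite unitmxE unitfE => /negPf->.
Qed.

Lemma rel_by_good3 A s X Y : A \in unitmx -> good3 X -> good Y -> rel_by A s X Y -> good3 Y.
Proof.
move=> uA [gX [i [j [k [ij ik jk]]]]] gY h; split=> //.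
by exists (s i), (s j), (s k); rewrite !(rel_by_wdg _ _ uA gX gY h).
Qed.

Lemma rel_by_cmult A s X Y i : A \in unitmx -> good X -> good Y -> rel_by A s X Y ->
  cmult Y (s i) = cmult X i.
Proof.
move=> uA gX gY h; rewrite /cmult -[RHS](card_imset _ (@perm_inj _ s)); apply: eq_card => j.
rewrite inE; apply/idP/imsetP => [e|[l + ->]]; last by rewrite inE (rel_by_wdg _ _ uA gX gY h).
by exists (s^-1%g j); rewrite ?permKV// inE -(rel_by_wdg _ _ uA gX gY h) permKV.
Qed.

Lemma rel_by_stable A s X Y : A \in unitmx -> stable X -> good Y -> rel_by A s X Y -> stable Y.
Proof.
move=> uA [g3 sX] gY h; split; first exact: rel_by_good3 h.
by move=> i; rewrite -(permKV s i) (rel_by_cmult _ uA g3.1 gY h).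
Qed.

Lemma tequiv_refl X : tequiv X X.
Proof. by exists 1%:M; [exact: unitmx1|exists 1%g; exact: rel_by1]. Qed.

(** A degenerate limit of projectivities sends everything but one point [p] to
    one point [q], so the multiplicities of [p] and [q] add up to at least
    the degree. *)
Lemma degenerate_rel A s X Y : A != 0 -> \det A = 0 -> rel_by A s X Y ->
  exists p q : 'cV[F]_2, [/\ nzc p 0, nzc q 0 &
    forall i, wdg p 0 X i = 0 \/ wdg q 0 Y (s i) = 0].
Proof.
move=> A0 d0 h; have [p [q [p0 q0 pq]]] := rank_one A0 d0.
exists p, q; split=> // i; have := h i.
have -> : wdg (A *m X) i Y (s i) = wdg p 0 X i * wdg q 0 Y (s i).
  by rewrite /wdg !(pq _ X); rewrite /wdg; ring.
by move/eqP; rewrite mulf_eq0 => /orP[/eqP|/eqP]; [left|right].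
Qed.

Lemma card_parallel_le X (p : 'cV[F]_2) : good X -> nzc p 0 ->
  [set i | wdg p 0 X i == 0]%SET = finset.set0 \/
  exists2 i, wdg p 0 X i == 0 & [set j | wdg p 0 X j == 0]%SET = [set j | wdg X i X j == 0]%SET.
Proof.
move=> gX p0; have [->|[l]] := finset.set_0Vmem [set i | wdg p 0 X i == 0]%SET; first by left.
rewrite inE => pl; right; exists l => //; apply/setP => j; rewrite !inE.
apply/idP/idP => /eqP h; apply/eqP.
  by apply: wdg_trans p0 _ h; rewrite wdgC (eqP pl) oppr0.
by apply: wdg_trans (gX l) (eqP pl) h.
Qed.

(** Two multiplicities below one half cannot add up to the degree. *)
Lemma stable_rel_unit A s X Y : stable X -> stable Y -> A != 0 -> rel_by A s X Y ->
  A \in unitmx.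
Proof.
move=> [[gX tX] sX] [[gY _] sY] A0 h; rewrite unitmxE unitfE; apply/negP => /eqP d0.
have [p [q [p0 q0 pq]]] := degenerate_rel A0 d0 h.
have half Z (r : 'cV[F]_2) : good Z -> nzc r 0 -> (forall i, (2 * cmult Z i < n)%N) ->
    (2 * pmult r Z < n)%N.
  move=> gZ r0 sZ; rewrite /pmult; case: (card_parallel_le gZ r0) => [->|[l _ ->]]; last exact: sZ.
  by rewrite cards0 muln0; case: tX => i _; apply: leq_ltn_trans (ltn_ord i).
have hX := half X p gX p0 sX; have hY := half Y q gY q0 sY.
have : [set: 'I_n]%SET \subset [set i | wdg p 0 X i == 0]%SET :|: s @^-1: [set i | wdg q 0 Y i == 0]%SET.
  by apply/fintype.subsetP => i _; rewrite !inE; case: (pq i) => ->; rewrite eqxx ?orbT.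
move=> /subset_leq_card; rewrite cardsT card_ord.
move=> /leq_trans/(_ (leq_card_setU _ _)).
rewrite card_preimset; last exact: perm_inj.
rewrite -/(pmult p X) -/(pmult q Y); lia.
Qed.

End TupleRelation.

(** * The topology of divisors *)

Section ProjectiveSpace.
Context {F : numFieldType} {n : nat}.
Implicit Types v w : 'cV[F]_n.+1.

Lemma proj_pt_eq v w (v0 : v != 0) (w0 : w != 0) :
  proj_pt v0 = proj_pt w0 <-> exists2 c : F, c != 0 & w = c *: v.
Proof. exact: pi_eqP. Qed.

Lemma proj_ptP (x : projspace F n) : exists v (v0 : v != 0), x = proj_pt v0.
Proof. by exists (val (repr x)), (repr_neq0 x); rewrite proj_ptK. Qed.

Lemma open_vec_neq0 : open [set v : 'cV[F]_n.+1 | v != 0].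
Proof.
have -> : [set v : 'cV[F]_n.+1 | v != 0] = \bigcup_(i in [set: 'I_n.+1]) [set v : 'cV[F]_n.+1 | v i 0 != 0].
  apply/seteqP; split=> v /=.
    move=> v0; apply: contrapT => h; apply: (negP v0); apply/eqP/matrixP => i j.
    rewrite ord1 mxE; apply/eqP/negPn/negP => vi; apply: h; by exists i.
  by case=> i _ /=; apply: contra => /eqP->; rewrite mxE.
apply: bigcup_open => i _; apply: open_neq0.
exact: cont_entry (fun v => @cvg_id _ _).
Qed.

Lemma open_proj_pt (U : set (projspace F n)) :
  open U <-> open [set v | exists v0 : v != 0, U (proj_pt v0)].
Proof.
split=> [[W0 oW eW]|oU].
  have -> : [set v | exists v0 : v != 0, U (proj_pt v0)] = W0 `&` [set v | v != 0].
    apply/seteqP; split=> [v /= [v0 Uv]|v /= [Wv v0]].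
      split=> //; have : (\pi_(projspace F n) @^-1` U) (exist _ v (nonzero_vecP v0)) by [].
      by rewrite -eW.
    exists v0.
    by have : (set_val @^-1` W0) (exist _ v (nonzero_vecP v0) : nonzero_vec F n) by []; rewrite eW.
  by apply: openI => //; exact: open_vec_neq0.
exists [set v | exists v0 : v != 0, U (proj_pt v0)] => //.
apply/seteqP; split=> -[v vP] /=.
  move=> [v0]; congr (U _); rewrite /proj_pt; congr (\pi _); exact: val_inj.
move=> Uv; have v0 : v != 0 by have := vP; rewrite inE.
by exists v0; move: Uv; congr (U _); rewrite /proj_pt; congr (\pi _); exact: val_inj.
Qed.

Lemma projspace_hausdorff : hausdorff_space (projspace F n).
Proof.
apply: separated_hausdorff => x y xy.
have [v [v0 ex]] := proj_ptP x; have [w [w0 ey]] := proj_ptP y.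
(* some 2 x 2 minor of the pair (v, w) does not vanish *)
have [[i1 j1] /= mij] : exists ij : 'I_n.+1 * 'I_n.+1,
    v ij.1 0 * w ij.2 0 - v ij.2 0 * w ij.1 0 != 0.
  apply: contrapT => h; apply: xy; rewrite ex ey.
  have [i0 vi] : exists i, v i 0 != 0.
    apply: contrapT => h'; apply: (negP v0); apply/eqP/matrixP => i j.
    by rewrite ord1 mxE; apply/eqP/negPn/negP => vi; apply: h'; exists i.
  have e j : w j 0 = (w i0 0 / v i0 0) * v j 0.
    apply/eqP; rewrite mulrAC; apply/eqP; apply: (mulIf vi); rewrite divfK//.
    apply/eqP; rewrite -subr_eq0; apply/negPn/negP => hh; apply: h; exists (i0, j) => /=.
    by rewrite mulrC [v j 0 * _]mulrC.
  apply/proj_pt_eq; exists (w i0 0 / v i0 0).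
    apply: (contraNneq _ w0) => e0; apply/eqP/matrixP => j k.
    by rewrite ord1 e e0 mul0r mxE.
  by apply/matrixP => j k; rewrite ord1 e mxE.
pose m (a b : 'cV[F]_n.+1) := a i1 0 * b j1 0 - a j1 0 * b i1 0.
have cm : continuous (fun ab : 'cV[F]_n.+1 * 'cV[F]_n.+1 => m ab.1 ab.2).
  have c1 k : continuous (fun ab : 'cV[F]_n.+1 * 'cV[F]_n.+1 => ab.1 k 0).
    by apply: cont_entry => z; exact: cvg_fst.
  have c2 k : continuous (fun ab : 'cV[F]_n.+1 * 'cV[F]_n.+1 => ab.2 k 0).
    by apply: cont_entry => z; exact: cvg_snd.
  by apply: contB; apply: contM.
have /= [[A B] [/= Av Bw] AB] : nbhs (v, w) [set ab | m ab.1 ab.2 != 0].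
  by apply: open_nbhs_nbhs; split=> //; exact: open_neq0.
move: Av Bw; rewrite !nbhsE => -[A' [oA' A'v] sA] [B' [oB' B'w] sB].
pose sat (C : set 'cV[F]_n.+1) : set (projspace F n) :=
  [set z | exists u (u0 : u != 0), C u /\ z = proj_pt u0].
have osat C : open C -> open (sat C).
  move=> oC; apply/open_proj_pt.
  have -> : [set u | exists u0 : u != 0, sat C (proj_pt u0)] =
      \bigcup_(c in [set c : F | c != 0]) ((fun u => c *: u) @^-1` C `&` [set u | u != 0]).
    apply/seteqP; split=> u /=.
      move=> [u0 [u' [u0' [Cu']]]] /proj_pt_eq[c c0 e].
      by exists c => //; split=> //=; rewrite -e.
    move=> [c c0 [/= Cu u0]]; exists u0; exists (c *: u).
    have cu0 : c *: u != 0 by rewrite scaler_eq0 negb_or c0.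
    by exists cu0; split=> //; apply/proj_pt_eq; exists c.
  apply: bigcup_open => c _; apply: openI; last exact: open_vec_neq0.
  by apply: open_comp => // u _; exact: scaler_continuous.
exists (sat A'), (sat B'); split; [exact: osat|exact: osat|by exists v, v0|by exists w, w0|].
move=> z [a [a0 [Aa ->]]] [b [b0 [Bb]]].
move=> /proj_pt_eq[c c0 e].
have := AB (a, b) (conj (sA _ Aa) (sB _ Bb)); rewrite /= /m e !mxE.
by rewrite !(mulrCA _ c) -mulrBr mulrC [a j1 0 * _]mulrC subrr mul0r eqxx.
Qed.

End ProjectiveSpace.

Section DivisorOfTuple.
Context {F : numFieldType}.

Lemma pt0_neq0 : (const_mx 1 : 'cV[F]_2) != 0.
Proof. by apply/eqP => /matrixP/(_ 0 0); rewrite !mxE => /eqP; rewrite oner_eq0. Qed.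

(** A total function, to be applied to the columns of any matrix; the value at
    the zero vector is arbitrary. *)
Definition pt_of (v : 'cV[F]_2) : projspace F 1 :=
  match pselect (v != 0) with
  | left v0 => proj_pt v0
  | right _ => proj_pt pt0_neq0
  end.

Lemma nzcE n (X : 'M[F]_(2, n)) i : nzc X i = (col i X != 0).
Proof.
apply/idP/idP.
  by apply: contraTN => /eqP/matrixP e; have := e 0 0; have := e 1 0;
    rewrite !mxE /nzc => -> ->; rewrite eqxx.
apply: contraNT; rewrite /nzc negb_or !negbK => /andP[/eqP e0 /eqP e1].
by apply/eqP/matrixP => r k; rewrite !mxE; case: (ord2 r) => ->.
Qed.

Lemma pt_ofE v (v0 : v != 0) : pt_of v = proj_pt v0.
Proof.
rewrite /pt_of; case: pselect => // v0'; congr proj_pt; exact: Prop_irrelevance.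
Qed.

Lemma pt_of_repr (p : projspace F 1) : pt_of (val (repr p)) = p.
Proof. by rewrite (pt_ofE (repr_neq0 p)) proj_ptK. Qed.

Lemma pt_of_eq m n (X : 'M[F]_(2, m)) (Y : 'M[F]_(2, n)) i j : nzc X i -> nzc Y j ->
  (pt_of (col i X) == pt_of (col j Y)) = (wdg X i Y j == 0).
Proof.
move=> Xi Yj; have X0 := Xi; have Y0 := Yj; move: X0 Y0; rewrite !nzcE => X0 Y0.
rewrite (pt_ofE X0) (pt_ofE Y0); apply/eqP/eqP.
  move=> /proj_pt_eq[c c0 /matrixP e]; have e0 := e 0 0; have e1 := e 1 0.
  by move: e0 e1; rewrite !mxE /wdg => -> ->; ring.
move=> w0; apply/proj_pt_eq; have [c hc] : exists c, forall r, Y r j = c * X r i.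
  by apply: wdg_scale => //; rewrite wdgC w0 oppr0.
exists c; last by apply/matrixP => r k; rewrite !mxE hc.
by apply/negP => /eqP c0; move: Yj; rewrite /nzc !hc c0 !mul0r eqxx.
Qed.

Lemma pt_of_eqP m n (X : 'M[F]_(2, m)) (Y : 'M[F]_(2, n)) i j : nzc X i -> nzc Y j ->
  pt_of (col i X) = pt_of (col j Y) <-> wdg X i Y j = 0.
Proof. by move=> Xi Yj; split=> [/eqP|/eqP h]; [|apply/eqP]; rewrite pt_of_eq// => /eqP. Qed.

Lemma pgl_pt_of (g : PGL2 F) n (X : 'M[F]_(2, n)) i : nzc X i ->
  pgl_pt g (pt_of (col i X)) = pt_of (col i (val (repr g) *m X)).
Proof.
move=> Xi; have X0 := Xi; rewrite nzcE in X0.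
rewrite (pt_ofE X0) -[in LHS](pgl_classK g) pgl_ptE.
have Y0 : val (repr g) *m col i X != 0 by exact: mulmx_unit_neq0 (repr_unit g) X0.
have e : col i (val (repr g) *m X) = val (repr g) *m col i X.
  by apply/matrixP => r k; rewrite !mxE; apply: eq_bigr => l _; rewrite mxE.
rewrite e (pt_ofE Y0); congr proj_pt; exact: Prop_irrelevance.
Qed.

Context {n : nat}.
Implicit Types X Y : 'M[F]_(2, n).

Definition pts X : n.-tuple (projspace F 1) := [tuple pt_of (col i X) | i < n].

Lemma size_pts X : size (seq_mset (pts X)) == n.
Proof. by rewrite (perm_size (perm_eq_seq_mset _)) size_tuple. Qed.

Definition div_of X : divisor F n :=
  exist (fun D : {mset projspace F 1}%mset => size D == n) _ (size_pts X).

Lemma div_of_eq X Y : good X -> good Y ->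
  div_of X = div_of Y <-> exists s : {perm 'I_n}, forall i, wdg X i Y (s i) = 0.
Proof.
move=> gX gY; split.
  move=> e0; have pe : perm_eq (pts X) (pts Y) by apply/eq_seq_msetP; exact: (congr1 (fun D : divisor F n => val D) e0).
  have {pe} [s e] := (@tuple_permP _ n (pts X) (pts Y)) pe; exists s => i.
  apply/eqP; rewrite -pt_of_eq//; apply/eqP.
  have : nth (pt_of (col i X)) (pts X) i = nth (pt_of (col i X)) [tuple tnth (pts Y) (s i) | i < n] i.
    by rewrite e.
  by rewrite -!tnth_nth !tnth_mktuple.
move=> [s h]; apply: val_inj; apply/eq_seq_msetP/(@tuple_permP _ n (pts X) (pts Y)); exists s.
congr val; apply: eq_from_tnth => i; rewrite !tnth_mktuple.
by apply/eqP; rewrite pt_of_eq// h.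
Qed.

Lemma div_of_surj (D : divisor F n) : exists2 X, good X & div_of X = D.
Proof.
have sD : size (val D : seq _) = n by exact/eqP/(valP D).
pose t : n.-tuple (projspace F 1) := Tuple (introT eqP sD).
pose X : 'M[F]_(2, n) := \matrix_(r, i) val (repr (tnth t i)) r 0.
have cX i : col i X = val (repr (tnth t i)).
  by apply/matrixP => r k; rewrite !mxE ord1.
exists X; first by move=> i; rewrite nzcE cX repr_neq0.
apply: val_inj; change (seq_mset (pts X) = val D); have -> : pts X = t.
  by apply: eq_from_tnth => i; rewrite tnth_mktuple cX pt_of_repr.
exact: seq_mset_id.
Qed.

Lemma pgl_div_of (g : PGL2 F) X : good X ->
  pgl_div g (div_of X) = div_of (val (repr g) *m X).
Proof.
move=> gX; apply: val_inj; rewrite /= /map_divisor; apply/eq_seq_msetP.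
apply: perm_trans (perm_map _ (perm_eq_seq_mset _)) _.
rewrite /pts /= -map_comp; apply/seq.permP => a; congr count; apply: eq_map => i /=.
exact: pgl_pt_of.
Qed.

(** The dehomogenized binary form with the given roots. *)
Definition tpoly X : {poly F} := \prod_(i < n) (X 1 i *: 'X - (X 0 i)%:P).

Definition tcoefs X : 'cV[F]_n.+1 := \col_k (tpoly X)`_k.

Lemma form_coefs_div_of X : good X ->
  exists2 c : F, c != 0 & form_coefs (div_of X) = c *: tcoefs X.
Proof.
move=> gX.
have /choice[c hc] : forall i, exists c : F, c != 0 /\
    linear_form (pt_of (col i X)) = c *: (X 1 i *: 'X - (X 0 i)%:P).
  move=> i; have X0 : col i X != 0 by rewrite -nzcE.
  have := pt_ofE X0; rewrite -[LHS]pt_of_repr (pt_ofE (repr_neq0 _)).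
  move=> /esym/proj_pt_eq[c c0 e]; exists c; split=> //.
  by rewrite /linear_form e !mxE scalerBr scalerA polyCM mul_polyC.
exists (\prod_i c i); first by apply/prodf_neq0 => i _; case: (hc i).
apply/matrixP => k j; rewrite !mxE -coefZ; congr (_`_k).
have -> : \prod_(p <- val (div_of X)) linear_form p = \prod_(i < n) linear_form (tnth (pts X) i).
  by rewrite (perm_big _ (perm_eq_seq_mset (pts X))) big_tuple.
have e i : linear_form (tnth (pts X) i) = c i *: (X 1 i *: 'X - (X 0 i)%:P).
  by rewrite tnth_mktuple; case: (hc i).
congr polyseq; rewrite /tpoly -scaler_prod.
by transitivity (\prod_(i < n) (c i *: (X 1 i *: 'X - (X 0 i)%:P))); first exact: (eq_bigr _ (fun i _ => e i)).
Qed.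

Lemma tcoefs_neq0 X : good X -> tcoefs X != 0.
Proof.
move=> gX; have [c c0 e] := form_coefs_div_of gX.
by have := form_coefs_neq0 (div_of X); rewrite e scaler_eq0 negb_or => /andP[].
Qed.

Lemma divisor_form_div_of X (X0 : tcoefs X != 0) : good X ->
  divisor_form (div_of X) = proj_pt X0.
Proof.
move=> gX; have [c c0 e] := form_coefs_div_of gX; apply/esym/proj_pt_eq.
by exists c.
Qed.

Lemma cont_tcoefs : continuous tcoefs.
Proof.
have ce r i : continuous (fun X : 'M[F]_(2, n) => X r i) by exact: cont_entry (fun v => @cvg_id _ _).
have key (s : seq 'I_n) l :
    continuous (fun X : 'M[F]_(2, n) => (\prod_(i <- s) (X 1 i *: 'X - (X 0 i)%:P))`_l).
  elim: s l => [|i s IH] l.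
    rewrite (_ : (fun X => _) = fun=> (1 : {poly F})`_l); first exact: contC.
    by apply/funext => X; rewrite big_nil.
  rewrite (_ : (fun X => _) = fun X : 'M[F]_(2, n) => \sum_(a < l.+1)
      (X 1 i * (a == 1 :> nat)%:R - (if a == 0 :> nat then X 0 i else 0))
      * (\prod_(i <- s) (X 1 i *: 'X - (X 0 i)%:P))`_(l - a)); last first.
    apply/funext => X; rewrite big_cons coefM; apply: eq_bigr => a _.
    by rewrite coefB coefZ coefX coefC.
  apply: cont_sum => a; apply: contM; last exact: IH.
  apply: contB; first by apply: contM => //; exact: contC.
  by case: (a == 0 :> nat) => //; exact: contC.
apply: cont_mx => k j; rewrite (_ : (fun X => _) = fun X => (tpoly X)`_k); first exact: key.
by apply/funext => X; rewrite mxE.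
Qed.

Lemma open_good : open [set X : 'M[F]_(2, n) | good X].
Proof.
have -> : [set X : 'M[F]_(2, n) | good X] = ~` (\bigcup_(i in [set: 'I_n]) ~` [set X : 'M[F]_(2, n) | nzc X i]).
  apply/seteqP; split=> [X gX [i _ h]|X h i]; first exact: h (gX i).
  by apply: contrapT => hi; apply: h; exists i.
apply: closed_openC; apply: closed_bigcup; first exact: finite_finset.
move=> i _; apply: open_closedC.
have ce r : continuous (fun X => X r i) by exact: cont_entry (fun v => @cvg_id _ _).
have -> : [set X : 'M[F]_(2, n) | nzc X i] = [set X : 'M[F]_(2, n) | X 0 i != 0] `|` [set X : 'M[F]_(2, n) | X 1 i != 0].
  by apply/seteqP; split=> X /= /orP.
by apply: openU; exact: open_neq0.
Qed.

(** The topology of the divisors comes from the coefficients of their forms,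
    which are continuous in the coordinates of the roots. *)
Lemma open_div_of (U : set (divisor F n)) : open U -> open [set X : 'M[F]_(2, n) | good X /\ U (div_of X)].
Proof.
move=> [W0 /open_proj_pt oW eW].
have -> : [set X : 'M[F]_(2, n) | good X /\ U (div_of X)] =
    [set X : 'M[F]_(2, n) | good X] `&` tcoefs @^-1` [set v | exists v0 : v != 0, W0 (proj_pt v0)].
  apply/seteqP; split=> X /= [gX h]; split=> //.
    exists (tcoefs_neq0 gX); rewrite -divisor_form_div_of//.
    by move: h; rewrite -eW.
  by case: h => X0 h; rewrite -eW /= (divisor_form_div_of X0).
apply: openI; first exact: open_good.
by apply: open_comp => // X _; exact: cont_tcoefs.
Qed.

End DivisorOfTuple.

Section DivisorHausdorff.
Context {F : numFieldType} {n : nat}.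
Implicit Types X Y : 'M[F]_(2, n).

Let fin X : seq F := [seq X 0 i / X 1 i | i <- enum 'I_n & X 1 i != 0].

Let v2 (x y : F) : 'cV[F]_2 := \col_r (if r == 0 then x else y).

Let colE (v : 'cV[F]_2) : col 0 v = v.
Proof. by apply/matrixP => r k; rewrite !mxE ord1. Qed.

Let tpoly_fin X : good X -> exists2 a, a != 0 & tpoly X = a *: \prod_(x <- fin X) ('X - x%:P).
Proof.
move=> gX; exists (\prod_i (if X 1 i != 0 then X 1 i else - X 0 i)).
  apply/prodf_neq0 => i _; case: ifP => [//|/negbFE/eqP X1].
  by have := gX i; rewrite /nzc X1 eqxx orbF oppr_eq0.
rewrite /fin big_map big_filter big_enum_cond/= [X in _ *: X]big_mkcond/= /tpoly -scaler_prod.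
apply: eq_bigr => i _; case: ifP => [X1|/negbFE/eqP X1].
  by rewrite scalerBr; congr (_ - _); rewrite -mul_polyC -polyCM mulrC divfK.
by rewrite X1 scale0r sub0r -polyCN alg_polyC.
Qed.

Let perm_pts X : good X -> perm_eq (pts X)
  ([seq pt_of (v2 x 1) | x <- fin X] ++ nseq (n - size (fin X)) (pt_of (v2 1 0))).
Proof.
move=> gX; pose f i := pt_of (col i X).
have -> : (pts X : seq _) = [seq f i | i <- enum 'I_n] by [].
have p := perm_map f (permEl (perm_filterC (fun i => X 1 i != 0) (enum 'I_n))).
rewrite map_cat in p; rewrite perm_sym; move: p; congr (perm_eq _ _).
congr (_ ++ _).
  rewrite /fin -[RHS]map_comp; apply/eq_in_map => i; rewrite mem_filter => /andP[X1 _] /=.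
  rewrite /f -(colE (v2 _ _)); apply/pt_of_eqP => //.
    by rewrite /nzc !mxE/= oner_eq0 orbT.
  by rewrite /wdg !mxE/= mulr1 mulrC divfK// subrr.
have sz : (size (fin X) + count (predC (fun i => X 1%R i != 0%R)) (enum 'I_n))%N = n.
  by rewrite size_map size_filter count_predC size_enum_ord.
rewrite -[in RHS]sz addKn -size_filter.
set t := [seq x <- enum 'I_n | _]; have : all (fun i => X 1 i == 0) t.
  by apply/allP => i; rewrite mem_filter /= negbK => /andP[].
elim: t => //= i t IH /andP[/eqP X1 at_]; rewrite -IH//; congr cons.
rewrite /f -(colE (v2 _ _)); apply/pt_of_eqP => //.
  by rewrite /nzc !mxE/= oner_eq0.
by rewrite /wdg !mxE/= X1 mulr0 mul0r subrr.
Qed.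

(** The finite roots are the roots of the dehomogenized form, and the
    multiplicity of the root at infinity is the drop of its degree. *)
Lemma tcoefs_inj X Y c : good X -> good Y -> c != 0 -> tcoefs Y = c *: tcoefs X ->
  div_of X = div_of Y.
Proof.
move=> gX gY c0 e.
have szp (Z : 'M[F]_(2, n)) : (size (tpoly Z) <= n.+1)%N.
  rewrite /tpoly; apply: leq_trans (size_poly_prod_leq _ _) _ => /=.
  rewrite leq_subLR addnS ltnS cardT size_enum_ord addnn.
  apply: (@leq_trans (\sum_(i < n) 2)).
    apply: leq_sum => i _; apply: leq_trans (size_polyD _ _) _; rewrite geq_max size_polyN.
    rewrite (leq_trans (size_scale_leq _ _)) ?size_polyX//=.
    by rewrite (leq_trans (size_polyC_leq1 _)).
  by rewrite sum_nat_const card_ord muln2.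
have {}e : tpoly Y = c *: tpoly X.
  apply/polyP => k; have [kn|kn] := ltnP k n.+1.
    by have /matrixP/(_ (Ordinal kn) 0) := e; rewrite !mxE coefZ.
  rewrite nth_default ?(leq_trans (szp _))// nth_default//.
  by rewrite (leq_trans (size_scale_leq _ _))// (leq_trans (szp _)).
have [a a0 ea] := tpoly_fin gX; have [b b0 eb] := tpoly_fin gY.
have pf : perm_eq (fin X) (fin Y).
  apply: prod_XsubC_eq.
  have : b *: \prod_(x <- fin Y) ('X - x%:P) = (c * a) *: \prod_(x <- fin X) ('X - x%:P).
    by rewrite -eb e ea scalerA.
  move=> h; have := congr1 lead_coef h.
  rewrite !lead_coefZ !lead_coef_prod_XsubC !mulr1 => bca; rewrite bca in h.
  by apply/esym/(scalerI _ h); rewrite mulf_neq0.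
apply: val_inj; apply/eq_seq_msetP.
apply: perm_trans (perm_pts gX) _; rewrite perm_sym; apply: perm_trans (perm_pts gY) _.
by rewrite (perm_size pf) perm_cat// perm_map// perm_sym.
Qed.

Lemma divisor_hausdorff : hausdorff_space (divisor F n).
Proof.
apply: separated_hausdorff => D E DE.
have [X gX eX] := div_of_surj D; have [Y gY eY] := div_of_surj E.
have dDE : divisor_form D <> divisor_form E.
  rewrite -eX -eY (divisor_form_div_of (tcoefs_neq0 gX))// (divisor_form_div_of (tcoefs_neq0 gY))//.
  move=> /proj_pt_eq[c c0 e]; apply: DE; rewrite -eX -eY; exact: tcoefs_inj e.
have [A [B [oA oB AD BE AB]]] := hausdorff_separated (@projspace_hausdorff F n) dDE.
exists (@divisor_form F n @^-1` A), (@divisor_form F n @^-1` B); split=> //.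
- by exists A.
- by exists B.
- by move=> z; exact: AB.
Qed.

End DivisorHausdorff.

Section UnitTuples.
Context {F : numFieldType} (lf : local_field F).

Lemma compact_box m n (r : F) : compact [set X : 'M[F]_(m, n) | forall i j, `|X i j| <= r].
Proof.
pose B := [set v : 'rV[F]_(m * n) | forall i, [set z : F | `|z| <= r] (v ord0 i)].
have cB : compact B.
  apply: (@rV_compact _ _ (fun=> [set z : F | `|z| <= r])) => i; have := @compact_disc F lf 0 r; congr (compact _).
  by apply/seteqP; split=> z /=; rewrite subr0.
have -> : [set X : 'M[F]_(m, n) | forall i j, `|X i j| <= r] = vec_mx @` B.
  apply/seteqP; split=> [X Xr|_ [v vB <-] i j]; last by rewrite mxE; exact: vB.
  exists (mxvec X); last exact: mxvecK.
  by move=> k /=; case/mxvec_indexP: k => i j; rewrite mxvecE.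
apply: continuous_compact => //; apply: continuous_subspaceT; apply: cont_mx => i j.
under eq_fun do rewrite mxE.
exact: cont_entry (fun v => @cvg_id _ _).
Qed.

Context {n : nat}.
Implicit Types X Y : 'M[F]_(2, n).

(** Tuples of vectors of maximum norm one; every divisor has coordinates in
    this compact set. *)
Definition unit_tuples : set 'M[F]_(2, n) :=
  [set X : 'M[F]_(2, n) | (forall r i, `|X r i| <= 1) /\ forall i, (`|X 0 i| - 1) * (`|X 1 i| - 1) = 0].

Lemma compact_unit_tuples : compact unit_tuples.
Proof.
have ce r i : continuous (fun X : 'M[F]_(2, n) => X r i) by exact: cont_entry (fun v => @cvg_id _ _).
have -> : unit_tuples = [set X : 'M[F]_(2, n) | forall r i, `|X r i| <= 1] `&`
    \bigcap_(i in [set: 'I_n]) [set X : 'M[F]_(2, n) | (`|X 0 i| - 1) * (`|X 1 i| - 1) = 0].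
  by apply/seteqP; split=> [X [h k]|X [h k]]; split=> // i; [move=> _; exact: k|exact: (k i I)].
apply: compact_closedI; first exact: compact_box.
apply: closed_bigI => i _; apply: closed_eq0.
by apply: contM; apply: contB; [exact: cont_norm|exact: contC|exact: cont_norm|exact: contC].
Qed.

Lemma unit_tuples_good X : unit_tuples X -> good X.
Proof.
move=> [_ h] i; have := h i; move/eqP; rewrite mulf_eq0 !subr_eq0 /nzc.
by case/orP => /eqP X1; apply/orP; [left|right]; rewrite -normr_eq0 X1 oner_eq0.
Qed.

Lemma div_of_unit (D : divisor F n) : exists2 X, unit_tuples X & div_of X = D.
Proof.
have [X gX <-] := div_of_surj D.
pose c i := if `|X 0 i| <= `|X 1 i| then `|X 1 i| else `|X 0 i|.
have c0 i : 0 < c i.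
  rewrite /c; have := gX i; rewrite /nzc -!normr_gt0.
  case: (real_leP (normr_real (X 0 i)) (normr_real (X 1 i))) => h.
    by case/orP => // /lt_le_trans; apply.
  by case/orP => // /lt_trans; apply.
pose Y : 'M[F]_(2, n) := \matrix_(r, i) (X r i / c i).
have nY r i : `|Y r i| = `|X r i| / c i by rewrite mxE normrM normfV (gtr0_norm (c0 i)).
have uY : unit_tuples Y.
  split=> [r i|i]; rewrite !nY.
    rewrite ler_pdivrMr// mul1r /c.
    case: (real_leP (normr_real (X 0 i)) (normr_real (X 1 i))) => h;
      case: (ord2 r) => -> //; exact: ltW.
  apply/eqP; rewrite mulf_eq0 !subr_eq0.
  have := c0 i; rewrite /c; case: ifP => _ h.
    by rewrite (divff (negbT (gt_eqF h))) eqxx orbT.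
  by rewrite (divff (negbT (gt_eqF h))) eqxx.
exists Y => //; apply/div_of_eq; [exact: unit_tuples_good|by []|].
exists 1%g => i; rewrite perm1 /wdg !mxE; have := gt_eqF (c0 i) => /negbT h; by field.
Qed.

Lemma compact_div_of (C : set 'M[F]_(2, n)) : compact C -> (forall X, C X -> good X) ->
  compact (div_of @` C).
Proof.
move=> cC gC; apply: continuous_compact => //; apply: continuous_in_subspaceT.
move=> X /set_mem CX U; rewrite nbhsE => -[V [oV VX] VU].
apply: (@filterS _ _ _ [set Z : 'M[F]_(2, n) | good Z /\ V (div_of Z)]).
  by move=> Z [_ /VU].
by apply: open_nbhs_nbhs; split; [exact: open_div_of|split=> //; exact: gC].
Qed.

End UnitTuples.

(** * The moduli space in terms of tuples *)

Lemma max_mset_lt (K : choiceType) (D : {mset K}%mset) n : (0 < n)%N ->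
  (2 * (\max_(p <- finsupp D) D p) < n)%N <-> forall p, (2 * D p < n)%N.
Proof.
move=> n0; split=> h.
  move=> p; have [->|p0] := posnP (D p); first by rewrite muln0.
  apply: leq_ltn_trans h; rewrite leq_mul2l/=.
  by apply: leq_bigmax_seq => //; rewrite mem_finsupp -lt0n.
elim: (enum_fset _) => [|p s IH]; first by rewrite big_nil muln0.
by rewrite big_cons maxnMr gtn_max h.
Qed.

Section Stabilizers.
Context {F : numFieldType} {n : nat}.
Implicit Types X Y : 'M[F]_(2, n).

Lemma rel_by_scalar (C : 'M[F]_2) X : three X -> rel_by C 1%g X X -> C = (C 0 0)%:M.
Proof.
move=> [i [j [k [ij ik jk]]]] h.
have [|c1 c2 c3] := @quadratic_three_zeros _ _ X i j k (- C 1 0) (C 0 0 - C 1 1) (C 0 1) ij ik jk.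
  by move=> l _; have := h l; rewrite perm1 /wdg !mul2E => <-; ring.
apply/matrixP => r s; rewrite mxE; case: (ord2 r) (ord2 s) => -> [] ->; rewrite ?mulr1n ?mulr0n//.
  by apply/eqP; rewrite -oppr_eq0 c1.
by apply/esym/eqP; rewrite -subr_eq0 c2.
Qed.

Lemma rel_by_unique (A B : 'M[F]_2) s X Y : B \in unitmx -> three X -> good X -> good Y ->
  rel_by A s X Y -> rel_by B s X Y -> exists c, A = c *: B.
Proof.
move=> uB tX gX gY hA hB.
have h := rel_byM gY hA (rel_byV uB hB); rewrite mulgV in h.
exists ((invmx B *m A) 0 0); rewrite -mul_scalar_mx -[A in LHS](mulKVmx uB) [in LHS](rel_by_scalar tX h).
by rewrite scalar_mxC.
Qed.

Lemma pgl_div_class (A : 'M[F]_2) (uA : A \in unitmx) X : good X ->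
  pgl_div (pgl_class uA) (div_of X) = div_of (A *m X).
Proof.
move=> gX; rewrite pgl_div_of//.
have [c c0 e] := (pi_eqP _ _).1 (reprK (pgl_class uA)).
apply/div_of_eq; rewrite /= in e.
- by move=> i; rewrite nzc_mul ?repr_unit.
- by move=> i; rewrite nzc_mul.
exists 1%g => i; rewrite perm1 {2}e -scalemxAl.
by rewrite /wdg [in X in _ * X - _]mxE [in X in _ - _ * X]mxE; ring.
Qed.

Lemma pgl_class_eq (A B : 'M[F]_2) (uA : A \in unitmx) (uB : B \in unitmx) :
  pgl_class uA = pgl_class uB <-> exists2 c : F, c != 0 & B = c *: A.
Proof. exact: pi_eqP. Qed.

Lemma wdg_complement (p : 'cV[F]_2) : nzc p 0 -> exists q : 'cV[F]_2, wdg p 0 q 0 != 0.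
Proof.
case/orP => p0.
  exists (\col_r (if r == 0 then 0 else 1)).
  by rewrite /wdg !mxE/= mulr1 mulr0 subr0.
exists (\col_r (if r == 0 then 1 else 0)).
by rewrite /wdg !mxE/= mulr1 mulr0 sub0r oppr_eq0.
Qed.

Lemma two_points X : good X -> ~ three X ->
  exists p q : 'cV[F]_2, wdg p 0 q 0 != 0 /\
    forall i, wdg p 0 X i = 0 \/ wdg q 0 X i = 0.
Proof.
move=> gX n3.
have colw i j : wdg (col i X) 0 X j = wdg X i X j by rewrite /wdg !mxE.
have [[i [j ij]]|par] := pselect (exists i j, wdg X i X j != 0).
  exists (col i X), (col j X); split; first by move: ij; rewrite /wdg !mxE.
  move=> k; rewrite !colw; apply: contrapT => /not_orP[/eqP ik /eqP jk].
  by apply: n3; exists i, j, k.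
have [[i _]|no] := pselect (exists i : 'I_n, True).
  have [|q pq] := @wdg_complement (col i X); first by rewrite /nzc !mxE; exact: gX.
  exists (col i X), q; split=> // j; left; rewrite colw; apply: contrapT => /eqP h.
  by apply: par; exists i, j.
have [|q pq] := @wdg_complement (const_mx 1); first by rewrite /nzc !mxE oner_eq0.
by exists (const_mx 1), q; split=> // j; exfalso; apply: no; exists j.
Qed.

(** A divisor supported on two points is fixed by all dilations with these
    two fixed points. *)
Lemma fs_three X : good X -> fs_divisor F n (div_of X) -> three X.
Proof.
move=> gX fsX; apply: contrapT => /(two_points gX)[p [q [pq X2]]].
pose w := wdg p 0 q 0.
pose A (t : F) : 'M[F]_2 := \matrix_(r, c)
  (if c == 0 then (q 1 0 * p r 0 - t * p 1 0 * q r 0) / w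
   else (- q 0 0 * p r 0 + t * p 0 0 * q r 0) / w).
have A0 t r : A t r 0 = (q 1 0 * p r 0 - t * p 1 0 * q r 0) / w by rewrite mxE.
have A1 t r : A t r 1 = (- q 0 0 * p r 0 + t * p 0 0 * q r 0) / w by rewrite mxE.
have detA t : \det (A t) = t by rewrite det2E !A0 !A1; move: pq; rewrite /w /wdg => ?; field.
have Ap t r : (A t *m p) r 0 = p r 0.
  by rewrite mul2E A0 A1; move: pq; rewrite /w /wdg => ?; field.
have Aq t r : (A t *m q) r 0 = t * q r 0.
  by rewrite mul2E A0 A1; move: pq; rewrite /w /wdg => ?; field.
have relA t : rel_by (A t) 1%g X X.
  move=> i; rewrite perm1.
  have -> : wdg (A t *m X) i X i = (t - 1) * wdg p 0 X i * wdg q 0 X i / w.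
    by rewrite [LHS]/wdg !mul2E !A0 !A1 ![wdg _ _ X _]/wdg; ring.
  by case: (X2 i) => ->; rewrite ?mulr0 !mul0r.
have uA (k : nat) : A k.+1%:R \in unitmx by rewrite unitmxE detA unitfE pnatr_eq0.
have stab k : stabilizer (div_of X) (pgl_class (uA k)).
  rewrite /stabilizer /= pgl_div_class//; apply/div_of_eq => //.
    by move=> i; rewrite nzc_mul.
  by exists 1%g; exact: relA.
have inj : injective (fun k => pgl_class (uA k)).
  move=> k l /pgl_class_eq[c c0 e].
  have [r pr] : exists r, p r 0 != 0.
    apply: contrapT => h; move: pq; rewrite /w /wdg.
    have p0 r : p r 0 = 0 by apply: contrapT => /eqP pr; apply: h; exists r.
    by rewrite !p0 !mul0r subrr eqxx.
  have [s qs] : exists r, q r 0 != 0.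
    apply: contrapT => h; move: pq; rewrite /w /wdg.
    have q0 t : q t 0 = 0 by apply: contrapT => /eqP qt; apply: h; exists t.
    by rewrite !q0 !mulr0 subrr eqxx.
  have c1 : c = 1.
    have := Ap l.+1%:R r; rewrite e -scalemxAl mxE Ap => h.
    by apply: (mulIf pr); rewrite h mul1r.
  have := Aq l.+1%:R s; rewrite e c1 scale1r Aq => /(mulIf qs)/eqP.
  by rewrite eqr_nat eqSS => /eqP.
apply: infinite_nat; have := finite_preimage (f := fun k => pgl_class (uA k)) _ fsX.
have -> : (fun k => pgl_class (uA k)) @^-1` stabilizer (div_of X) = setT.
  by apply/seteqP; split=> // k _; exact: stab.
by apply; move=> k l _ _; exact: inj.
Qed.

(** A projectivity is determined by its values at three points, so only
    finitely many of them permute the points of the divisor. *)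
Lemma three_fs X : good X -> three X -> fs_divisor F n (div_of X).
Proof.
move=> gX tX; rewrite /fs_divisor /=.
apply: (@sub_finite_set _ _ (\bigcup_(s in [set: {perm 'I_n}])
    [set g : PGL2 F | rel_by (val (repr g)) s X X])).
  move=> g; rewrite /stabilizer/= pgl_div_of// => /div_of_eq[|//|s hs]; last by exists s.
  by move=> i; rewrite nzc_mul ?repr_unit.
apply: bigcup_finite; first exact: finite_finset.
move=> s _; have [[g hg]|no] := pselect (exists g : PGL2 F, rel_by (val (repr g)) s X X).
  apply: (@sub_finite_set _ _ [set g]); last exact: finite_set1.
  move=> h hh /=; rewrite -(pgl_classK h) -(pgl_classK g).
  have [c e] := rel_by_unique (repr_unit g) tX gX gX hh hg.
  apply/esym/pgl_class_eq; exists c => //; apply: contraTneq (repr_unit h) => c0.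
  rewrite e c0 scale0r unitmxE det0 unitr0//.
apply: (@sub_finite_set _ _ set0); last exact: finite_set0.
by move=> g hg; apply: no; exists g.
Qed.

End Stabilizers.

Section Moduli.
Context {F : numFieldType} (lf : local_field F) {n : nat}.
Implicit Types (X Y : 'M[F]_(2, n)) (x y : moduli F n).

Definition represents X x : Prop :=
  good X /\ exists D : fs_divisor F n, val D = div_of X /\ moduli_pt D = x.

Lemma represents_good3 X x : represents X x -> good3 X.
Proof.
move=> [gX [D [eD _]]]; split=> //; apply: fs_three => //.
by rewrite -eD; case: D {eD} => D /=; rewrite inE.
Qed.

Lemma good3_represents X : good3 X -> exists x, represents X x.
Proof.
move=> [gX tX]; have fD := mem_set (three_fs gX tX).
pose D : fs_divisor F n := exist _ (div_of X) fD.
by exists (moduli_pt D); split=> //; exists D.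
Qed.

Lemma fs_represents (D : fs_divisor F n) :
  exists2 X, unit_tuples X & represents X (moduli_pt D) /\ val D = div_of X.
Proof.
have [X uX eX] := div_of_unit (val D).
by exists X => //; split=> //; split; [exact: unit_tuples_good|exists D].
Qed.

Lemma moduli_represents x : exists2 X, unit_tuples X & represents X x.
Proof.
have [X uX [rX _]] := fs_represents (repr x); exists X => //.
by move: rX; rewrite /moduli_pt reprK.
Qed.

Lemma represents_eq X Y x y : represents X x -> represents Y y -> x = y <-> tequiv X Y.
Proof.
move=> [gX [D [eD <-]]] [gY [E [eE <-]]].
have -> : moduli_pt D = moduli_pt E <-> exists g : PGL2 F, pgl_div g (val D) = val E.
  rewrite /moduli_pt; split; first by move/eqmodP/asboolP.
  by move=> h; apply/eqmodP/asboolP.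
rewrite eD eE; split.
  move=> [g]; rewrite pgl_div_of// => /div_of_eq[|//|s hs].
    by move=> i; rewrite nzc_mul ?repr_unit.
  by exists (val (repr g)); [exact: repr_unit|exists s].
move=> [A uA [s hs]]; exists (pgl_class uA); rewrite pgl_div_class//.
apply/div_of_eq => //; last by exists s.
by move=> i; rewrite nzc_mul.
Qed.

Lemma represents_fun X x y : represents X x -> represents X y -> x = y.
Proof. by move=> hx hy; apply/(represents_eq hx hy); exact: tequiv_refl. Qed.

Lemma represents_tequiv X Y x : represents X x -> good Y -> tequiv X Y -> represents Y x.
Proof.
move=> hX gY [A uA [s hs]]; have h3 := represents_good3 hX.
have [y hy] := good3_represents (rel_by_good3 uA h3 gY hs).
suff -> : x = y by [].
by apply/(represents_eq hX hy); exists A => //; exists s.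
Qed.

(** The compact set of the unit tuples maps onto the Hausdorff space of the
    divisors, so this map is closed: hence the topology of the moduli space is
    the quotient topology of the tuples as well. *)
Lemma open_moduli (V : set (moduli F n)) :
  open V <-> open [set X | exists2 x, V x & represents X x].
Proof.
split.
  move=> [U oU eU].
  have -> : [set X | exists2 x, V x & represents X x] =
      [set X : 'M[F]_(2, n) | good X /\ (U `&` fs_divisor F n) (div_of X)].
    apply/seteqP; split=> X /=.
      move=> [x Vx [gX [D [eD Dx]]]]; split=> //.
      rewrite -eD; split; last by case: D {eD Dx} => D /=; rewrite inE.
      by have : (set_val @^-1` U) D by rewrite eU /= -/(moduli_pt D) Dx.
    move=> [gX [UX fX]]; pose D : fs_divisor F n := exist _ (div_of X) (mem_set fX).
    exists (moduli_pt D); last by split=> //; exists D.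
    by have : (set_val @^-1` U) D by []; rewrite eU.
  have -> : [set X : 'M[F]_(2, n) | good X /\ (U `&` fs_divisor F n) (div_of X)] =
     [set X : 'M[F]_(2, n) | good X /\ U (div_of X)] `&`
       \bigcup_(t in [set: 'I_n * 'I_n * 'I_n]) [set X : 'M[F]_(2, n) |
         wdg X t.1.1 X t.1.2 * wdg X t.1.1 X t.2 * wdg X t.1.2 X t.2 != 0].
    apply/seteqP; split=> X /=.
      move=> [gX [UX /(fs_three gX)[i [j [k [ij ik jk]]]]]]; split=> //.
      by exists (i, j, k) => //=; rewrite !mulf_neq0.
    move=> [[gX UX] [[[i j] k] _ /=]].
    rewrite !mulf_eq0 !negb_or => /andP[/andP[ij ik] jk]; split=> //; split=> //.
    by apply: three_fs => //; exists i, j, k.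
  apply: openI; first exact: open_div_of.
  apply: bigcup_open => t _; apply: open_neq0.
  have ce r i : continuous (fun X : 'M[F]_(2, n) => X r i) by exact: cont_entry (fun v => @cvg_id _ _).
  by do !apply: contM; apply: contB; apply: contM.
move=> oW; set W := [set X | _] in oW.
have cC : compact (unit_tuples `&` ~` W).
  by apply: compact_closedI; [exact: compact_unit_tuples|exact: open_closedC].
have := compact_closed (@divisor_hausdorff F n)
  (compact_div_of cC (fun X h => unit_tuples_good h.1)).
move=> /closed_openC oU.
exists (~` (div_of @` (unit_tuples `&` ~` W))) => //.
apply/seteqP; split=> D /=.
  move=> h; have [X uX [rX eX]] := fs_represents D.
  apply: contrapT => nV; apply: h; exists X; last by rewrite -eX.
  split=> // -[x Vx rx]; apply: nV.
  by rewrite -[\pi_ _ _]/(moduli_pt D) (represents_fun rX rx).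
move=> VD [X [uX nW] eX]; apply: nW; exists (moduli_pt D) => //.
by split; [exact: unit_tuples_good|exists D].
Qed.

Lemma open_good3 : open [set X : 'M[F]_(2, n) | good3 X].
Proof.
have -> : [set X : 'M[F]_(2, n) | good3 X] = [set X | exists2 x, setT x & represents X x].
  apply/seteqP; split=> X /=; last by move=> [x _ /represents_good3].
  by move=> /good3_represents[x rx]; exists x.
by apply/open_moduli; exact: openT.
Qed.

(** The tuples equivalent to a member of [U] form a union of copies of [U] under
    projectivities, permutations and rescalings of the columns. *)
Lemma open_moduli_image (U : set 'M[F]_(2, n)) : open U ->
  open [set x | exists2 X, U X & represents X x].
Proof.
move=> oU; apply/open_moduli.
have -> : [set X | exists2 x, [set x | exists2 X, U X & represents X x] x & represents X x] =
    \bigcup_(t in [set t : 'M[F]_2 * {perm 'I_n} * 'rV[F]_n | t.1.1 \in unitmx /\ forall i, t.2 0 i != 0])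
      ([set X : 'M[F]_(2, n) | good3 X] `&`
       (fun X => \matrix_(r, i) (t.2 0 i * (t.1.1 *m X) r (t.1.2 i))) @^-1` U).
  apply/seteqP; split=> X /=.
    move=> [x [Y UY rY] rX]; have g3 := represents_good3 rX.
    have [gY _] := represents_good3 rY.
    have [A uA [s hs]] := (represents_eq rX rY).1 erefl.
    have [c hc] := rel_by_good uA g3.1 hs.
    exists (A, s^-1%g, \row_i c (s^-1%g i)) => /=.
      split=> // i; rewrite mxE; apply/eqP => c0.
      by have := gY (s (s^-1%g i)); rewrite /nzc !hc c0 !mul0r eqxx.
    split=> //=; rewrite (_ : \matrix_(_, _) _ = Y)//.
    apply/matrixP => r i; rewrite mxE [X in X * _]mxE.
    by rewrite -{3}(permKV s i) hc.
  move=> [[[A s] c] /= [uA c0] [g3 Um]].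
  have [x rx] := good3_represents g3; exists x => //.
  set Y := \matrix_(r, i) _ in Um; exists Y => //.
  have YE r i : Y r i = c 0 i * (A *m X) r (s i) by rewrite mxE.
  have gA i : nzc (A *m X) i by rewrite nzc_mul//; exact: g3.1.
  apply: (represents_tequiv rx).
    by move=> i; have := gA (s i); rewrite /nzc !YE !mulf_eq0 (negPf (c0 i)).
  by exists A => //; exists s^-1%g => i; rewrite /wdg !YE permKV; ring.
apply: bigcup_open => -[[A s] c] /= _; apply: openI; first exact: open_good3.
apply: open_comp => // X _; apply: cont_mx => r i.
rewrite (_ : (fun X => _) = fun X : 'M[F]_(2, n) => c 0 i * (A *m X) r (s i)); last first.
  by apply/funext => Y; rewrite mxE.
apply: contM; first exact: contC.
apply: cont_entry; apply: cont_mulmx; first exact: cst_continuous.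
by move=> Z; exact: cvg_id.
Qed.

(** The multiplicities of a divisor are read off a tuple of coordinates. *)
Lemma max_mult_stable X : good3 X -> (2 * max_mult (div_of X) < n)%N <-> stable X.
Proof.
move=> g3; have gX := g3.1.
have multE i : val (div_of X) (pt_of (col i X)) = cmult X i.
  rewrite /div_of /= mset_seqE /pts /= count_map /cmult cardsE cardE -size_filter.
  rewrite enumT /= /enum_mem; congr size; apply: eq_filter => j /=.
  rewrite -[RHS]/(wdg X i X j == 0) wdg_sym; apply/idP/idP.
    by move=> /eqP h; apply/eqP/(pt_of_eqP (gX j) (gX i)).
  by move=> /eqP h; apply/eqP/(pt_of_eqP (gX j) (gX i)).
have n0 : (0 < n)%N by case: g3.2 => i _; exact: leq_ltn_trans (ltn_ord i).
split=> [h|[_ h]].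
  split=> // i; rewrite -multE.
  exact: ((max_mset_lt (val (div_of X)) n0).1 h (pt_of (col i X))).
apply/(max_mset_lt (val (div_of X)) n0) => p.
have [->|p0] := posnP (val (div_of X) p); first by rewrite muln0.
have : p \in (pts X : seq _).
  by move: p0; rewrite /div_of /= mset_seqE -has_count has_pred1.
by move=> /mapP[i _ ->]; rewrite multE.
Qed.

Lemma represents_small X x : represents X x -> small_mult_locus F n x <-> stable X.
Proof.
move=> rX; have g3 := represents_good3 rX; split.
  move=> [D /= hD Dx]; have [Y uY [rY eY]] := fs_represents D.
  have gY := represents_good3 rY; have sY : stable Y by apply/(max_mult_stable gY); rewrite -eY.
  rewrite Dx in rY; have [A uA [s hs]] := (represents_eq rY rX).1 erefl.
  exact: rel_by_stable uA sY g3.1 hs.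
move=> sX; case: rX => gX [D [eD Dx]]; exists D => //=; rewrite eD.
by apply/(max_mult_stable g3).
Qed.

Lemma open_small_mult_locus : open (small_mult_locus F n).
Proof.
apply/open_moduli.
have -> : [set X | exists2 x, small_mult_locus F n x & represents X x] =
    [set X : 'M[F]_(2, n) | good3 X] `&` ~` (\bigcup_(t in [set t : 'I_n * {set 'I_n} | (n <= 2 * #|t.2|)%N])
      \bigcap_(j in [set j | j \in t.2]) [set X : 'M[F]_(2, n) | wdg X t.1 X j = 0]).
  apply/seteqP; split=> X /=.
    move=> [x sx rx]; have g3 := represents_good3 rx; split=> // -[[i S] /= nS h].
    have [_ /(_ i)] := (represents_small rx).1 sx; rewrite ltnNge => /negP; apply.
    apply: leq_trans nS _; rewrite leq_mul2l/= /cmult; apply: subset_leq_card.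
    by apply/fintype.subsetP => j jS; rewrite inE; apply/eqP/h.
  move=> [g3 h]; have [x rx] := good3_represents g3; exists x => //.
  apply/(represents_small rx); split=> // i; rewrite ltnNge; apply/negP => ni.
  apply: h; exists (i, [set j | wdg X i X j == 0]%SET) => //= j /=.
  by rewrite inE => /eqP.
apply: openI; first exact: open_good3.
apply: closed_openC; apply: closed_bigcup; first exact: finite_finset.
move=> t _; apply: closed_bigI => j _; apply: closed_eq0.
have ce r i : continuous (fun X : 'M[F]_(2, n) => X r i) by exact: cont_entry (fun v => @cvg_id _ _).
by apply: contB; apply: contM.
Qed.

Lemma open_stable : open [set X : 'M[F]_(2, n) | stable X].
Proof.
have -> : [set X : 'M[F]_(2, n) | stable X] =
    [set X | exists2 x, small_mult_locus F n x & represents X x].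
  apply/seteqP; split=> X /=; last by move=> [x sx rX]; exact/(represents_small rX).
  by move=> sX; have [x rX] := good3_represents sX.1; exists x => //; apply/(represents_small rX).
by apply/open_moduli; exact: open_small_mult_locus.
Qed.

End Moduli.

(** * Limits of projectivities: separation *)

(** The tube lemma. *)
Lemma closed_projection (S T : topologicalType) (K : set S) (Z : set (S * T)) :
  compact K -> closed Z -> closed [set t | exists2 s, K s & Z (s, t)].
Proof.
move=> cK cZ; rewrite -[X in closed X]setCK; apply: open_closedC.
rewrite openE => t nt; rewrite /interior.
have h s : K s -> \forall s' \near s & t' \near t, ~ Z (s', t').
  move=> Ks; have [[A B] /= [As Bt] AB] : nbhs (s, t) (~` Z).
    apply: open_nbhs_nbhs; split; first exact: closed_openC.
    by move=> Zst; apply: nt; exists s.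
  by exists (A, B) => // -[s' t'] /= [As' Bt']; exact: (AB (s', t')).
have nc := (compact_near_coveringP K).1 cK T (nbhs t) (fun t s => ~ Z (s, t)) (nbhs_filter t) h.
by apply: filterS nc => t' Kt' [s Ks Zst]; exact: Kt' Ks Zst.
Qed.

Section UnitMatrices.
Context {F : numFieldType} (lf : local_field F).

(** The unit sphere of the maximum norm: the product vanishes when some entry
    has norm one. *)
Definition unit_matrices : set 'M[F]_2 :=
  [set A | (forall i j, `|A i j| <= 1) /\ \prod_i \prod_j (`|A i j| - 1) = 0].

Lemma compact_unit_matrices : compact unit_matrices.
Proof.
apply: compact_closedI; first exact: compact_box.
apply: closed_eq0; apply: cont_prod => i; apply: cont_prod => j.
apply: contB; last exact: contC.
by apply: cont_norm; exact: cont_entry (fun v => @cvg_id _ _).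
Qed.

Lemma unit_matrices_neq0 A : unit_matrices A -> A != 0.
Proof.
move=> [_ h]; apply: contra_eqN h => /eqP ->.
apply/prodf_neq0 => i _; apply/prodf_neq0 => j _.
by rewrite mxE normr0 sub0r oppr_eq0 oner_eq0.
Qed.

Lemma unit_matrices_scale A : A != 0 -> exists2 c : F, c != 0 & unit_matrices (c *: A).
Proof.
move=> A0.
have [ij _ maxA] := @real_arg_maxP F _ (0, 0) xpredT (fun ij : 'I_2 * 'I_2 => `|A ij.1 ij.2|)
   isT (fun ij _ => normr_real _).
have Aij : A ij.1 ij.2 != 0.
  apply: contra A0 => /eqP e; apply/eqP/matrixP => i j; rewrite mxE; apply/eqP.
  by rewrite -normr_le0 (le_trans (maxA (i, j) isT))// e normr0.
exists (A ij.1 ij.2)^-1; first by rewrite invr_eq0.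
have nA i j : `|((A ij.1 ij.2)^-1 *: A) i j| = `|A i j| / `|A ij.1 ij.2|.
  by rewrite mxE normrM normfV mulrC.
split=> [i j|].
  by rewrite nA ler_pdivrMr ?normr_gt0// mul1r; exact: (maxA (i, j)).
rewrite (bigD1 ij.1)//= (bigD1 ij.2)//= nA divff ?normr_eq0// subrr.
by rewrite !mul0r.
Qed.

End UnitMatrices.

Section Separation.
Context {F : numFieldType} (lf : local_field F) {n : nat}.
Implicit Types (X Y : 'M[F]_(2, n)) (x y : moduli F n).

Lemma rel_by_scale (c : F) (A : 'M[F]_2) s X Y : rel_by A s X Y -> rel_by (c *: A) s X Y.
Proof.
move=> h i; have -> : wdg (c *: A *m X) i Y (s i) = c * wdg (A *m X) i Y (s i).
  by rewrite -scalemxAl /wdg [in X in X * _ - _]mxE [in X in _ - X * _]mxE; ring.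
by rewrite h mulr0.
Qed.

Lemma cont_wdg (T : topologicalType) m k (f : T -> 'M[F]_(2, m)) (g : T -> 'M[F]_(2, k)) i j :
  continuous f -> continuous g -> continuous (fun t => wdg (f t) i (g t) j).
Proof. by move=> cf cg; apply: contB; apply: contM; exact: cont_entry. Qed.

(** Being unrelated by every nonzero, possibly degenerate, matrix is an open
    condition because the matrices can be normalized to lie in a compact set. *)
Lemma near_unrelated s X Y : (forall A, A != 0 -> ~ rel_by A s X Y) ->
  nbhs (X, Y) [set t | forall A, A != 0 -> ~ rel_by A s t.1 t.2].
Proof.
move=> nrel.
pose Z := [set t : 'M[F]_2 * ('M[F]_(2, n) * 'M[F]_(2, n)) | rel_by t.1 s t.2.1 t.2.2].
have cZ : closed Z.
  have -> : Z = \bigcap_(i in [set: 'I_n])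
      [set t : 'M[F]_2 * ('M[F]_(2, n) * 'M[F]_(2, n)) | wdg (t.1 *m t.2.1) i t.2.2 (s i) = 0].
    by apply/seteqP; split=> t h i; [move=> _; exact: h|exact: (h i I)].
  apply: closed_bigI => i _; apply: closed_eq0; apply: cont_wdg.
    apply: cont_mulmx; first exact: cont_fst.
    exact: (cont_comp (@cont_snd _ _) (@cont_fst _ _)).
  exact: (cont_comp (@cont_snd _ _) (@cont_snd _ _)).
have /closed_openC oC := closed_projection (compact_unit_matrices lf) cZ.
have : nbhs (X, Y) (~` [set t | exists2 A, unit_matrices A & Z (A, t)]).
  apply: open_nbhs_nbhs; split=> // -[A uA ZA].
  exact: nrel (unit_matrices_neq0 uA) ZA.
apply: filterS => t nt A A0 h; apply: nt.
have [c c0 uA] := unit_matrices_scale A0.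
by exists (c *: A) => //; exact: rel_by_scale.
Qed.

Lemma separated_tuples X Y : (forall A s, A != 0 -> ~ rel_by A s X Y) ->
  exists U V : set 'M[F]_(2, n), [/\ open U, open V, U X, V Y &
    forall X' Y' A s, U X' -> V Y' -> A != 0 -> ~ rel_by A s X' Y'].
Proof.
move=> nrel.
have : nbhs (X, Y) [set t | forall s A, A != 0 -> ~ rel_by A s t.1 t.2].
  have near_s s := @near_unrelated s X Y (fun A => nrel A s).
  exact: (@filter_forall _ _ (fun (s : {perm 'I_n}) t => forall A, A != 0 -> ~ rel_by A s t.1 t.2)
    (nbhs (X, Y)) _ near_s).
move=> [[U V] /= [UX VY] UV].
move: UX VY; rewrite !nbhsE => -[U' [oU' U'X] sU] [V' [oV' V'Y] sV].
exists U', V'; split=> // X' Y' A s UX' VY' A0.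
exact: (UV (X', Y') (conj (sU _ UX') (sV _ VY')) s A A0).
Qed.

Lemma separated_moduli X Y x y : represents X x -> represents Y y ->
  (forall A s, A != 0 -> ~ rel_by A s X Y) ->
  exists U V : set (moduli F n), [/\ open U, open V, U x, V y & forall z, U z -> V z -> False].
Proof.
move=> rX rY /separated_tuples[U [V [oU oV UX VY UV]]].
exists [set x : moduli F n | exists2 X, U X & represents X x], [set x : moduli F n | exists2 X, V X & represents X x].
split; [exact: open_moduli_image|exact: open_moduli_image|by exists X|by exists Y|].
move=> z [X' UX' rX'] [Y' VY' rY'].
have [A uA [s hs]] := (represents_eq rX' rY').1 erefl.
apply: UV hs => //; apply: contraTneq uA => ->; by rewrite unitmxE det0 unitr0.
Qed.

(** For a fixed source, coincident points stay coincident in the limit, so a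
    degenerate limit has at most two distinct points. *)
Lemma moduli_T1 x : closed [set x].
Proof.
have [X0 _ rX0] := moduli_represents x.
have gX0 := (represents_good3 rX0).1.
rewrite -[X in closed X]setCK; apply: open_closedC; apply/(open_moduli lf).
pose Z s := [set t : 'M[F]_2 * 'M[F]_(2, n) | rel_by t.1 s X0 t.2 /\
  forall i j, wdg X0 i X0 j = 0 -> wdg t.2 (s i) t.2 (s j) = 0].
have cZ s : closed (Z s).
  have -> : Z s = \bigcap_(i in [set: 'I_n])
      [set t : 'M[F]_2 * 'M[F]_(2, n) | wdg (t.1 *m X0) i t.2 (s i) = 0] `&`
    \bigcap_(ij in [set ij : 'I_n * 'I_n | wdg X0 ij.1 X0 ij.2 = 0])
      [set t : 'M[F]_2 * 'M[F]_(2, n) | wdg t.2 (s ij.1) t.2 (s ij.2) = 0].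
    apply/seteqP; split=> t [h k]; split.
    - by move=> i _; exact: h.
    - by move=> [i j] /= ij; exact: k.
    - by move=> i; exact: (h i I).
    - by move=> i j ij; exact: (k (i, j) ij).
  apply: closedI; apply: closed_bigI => i _; apply: closed_eq0; apply: cont_wdg.
  - by apply: cont_mulmx; [exact: cont_fst|exact: cst_continuous].
  - exact: cont_snd.
  - exact: cont_snd.
  - exact: cont_snd.
have := closed_bigU_fin (fun s => closed_projection (compact_unit_matrices lf) (cZ s)).
move=> /closed_openC oC.
set C := [set t | _] in oC.
have -> : [set X | exists2 y, (~` [set x]) y & represents X y] =
    [set X : 'M[F]_(2, n) | exists2 y, setT y & represents X y] `&` ~` C.
  apply/seteqP; split=> Y /=.
    move=> [y yx rY]; split; first by exists y.
    move=> [s [A uA [hs par]]]; apply: yx.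
    have A0 := unit_matrices_neq0 uA.
    have [uA'|] := boolP (A \in unitmx).
      by apply/esym/(represents_eq rX0 rY); exists A => //; exists s.
    rewrite unitmxE unitfE negbK => /eqP d0.
    have [p [q [p0 q0 pq]]] := degenerate_rel A0 d0 hs.
    have [_ [i [j [k [ij ik jk]]]]] := represents_good3 rY.
    have pq' l : wdg p 0 X0 (s^-1%g l) = 0 \/ wdg q 0 Y l = 0.
      by have := pq (s^-1%g l); rewrite permKV.
    have h1 l m : wdg p 0 X0 (s^-1%g l) = 0 -> wdg p 0 X0 (s^-1%g m) = 0 -> wdg Y l Y m = 0.
      move=> pl pm; have := par (s^-1%g l) (s^-1%g m); rewrite !permKV; apply.
      by apply: wdg_trans p0 _ pm; rewrite wdgC pl oppr0.
    have h2 l m : wdg q 0 Y l = 0 -> wdg q 0 Y m = 0 -> wdg Y l Y m = 0.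
      by move=> ql qm; apply: wdg_trans q0 _ qm; rewrite wdgC ql oppr0.
    case: (pq' i) (pq' j) (pq' k) => hi [] hj [] hk;
      first [by move: ij; rewrite (h1 _ _ hi hj) eqxx | by move: ij; rewrite (h2 _ _ hi hj) eqxx
        | by move: ik; rewrite (h1 _ _ hi hk) eqxx | by move: ik; rewrite (h2 _ _ hi hk) eqxx
        | by move: jk; rewrite (h1 _ _ hj hk) eqxx | by move: jk; rewrite (h2 _ _ hj hk) eqxx].
  move=> [[y _ rY] nC]; exists y => //= yx; apply: nC; rewrite yx in rY.
  have [A uA [s hs]] := (represents_eq rX0 rY).1 erefl.
  have A0 : A != 0 by apply: contraTneq uA => ->; rewrite unitmxE det0 unitr0.
  have [c c0 ucA] := unit_matrices_scale A0.
  exists s, (c *: A) => //; split; first exact: rel_by_scale.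
  move=> i j ij; apply/eqP; rewrite (rel_by_wdg _ _ uA gX0 (represents_good3 rY).1 hs).
  exact/eqP.
by apply: openI => //; apply/(open_moduli lf); exact: openT.
Qed.

Lemma small_mult_hausdorff : hausdorff_space (small_mult_locus F n : Type).
Proof.
apply: separated_hausdorff => -[x sx] [y sy] xy.
have {}xy : x <> y by move=> e; apply: xy; exact: val_inj.
have [X _ rX] := moduli_represents x; have [Y _ rY] := moduli_represents y.
have [A s A0 hs|U [V [oU oV Ux Vy UV]]] := separated_moduli rX rY.
  have stX := (represents_small rX).1 (set_mem sx).
  have stY := (represents_small rY).1 (set_mem sy).
  apply: xy; apply/(represents_eq rX rY); exists A; last by exists s.
  exact: stable_rel_unit hs.
exists (set_val @^-1` U), (set_val @^-1` V); split=> //; first by exists U.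
- by exists V.
- by move=> z; exact: UV.
Qed.

Lemma three_transitive m k (X : 'M[F]_(2, m)) (Y : 'M[F]_(2, k)) a b c a' b' c' :
  wdg X a X b != 0 -> wdg X a X c != 0 -> wdg X b X c != 0 ->
  wdg Y a' Y b' != 0 -> wdg Y a' Y c' != 0 -> wdg Y b' Y c' != 0 ->
  exists2 A : 'M[F]_2, A \in unitmx &
    [/\ wdg (A *m X) a Y a' = 0, wdg (A *m X) b Y b' = 0 & wdg (A *m X) c Y c' = 0].
Proof.
move=> ab ac bc ab' ac' bc'.
pose u := wdg Y c' Y b' * wdg X a X c; pose v := wdg Y a' Y c' * wdg X c X b.
pose A : 'M[F]_2 := \matrix_(r, s)
  (if s == 0 then u * X 1 b * Y r a' - v * X 1 a * Y r b'
   else - u * X 0 b * Y r a' + v * X 0 a * Y r b').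
have A0 r : A r 0 = u * X 1 b * Y r a' - v * X 1 a * Y r b' by rewrite mxE.
have A1 r : A r 1 = - u * X 0 b * Y r a' + v * X 0 a * Y r b' by rewrite mxE.
exists A.
  rewrite unitmxE unitfE det2E !A0 !A1.
  have -> : (u * X 1 b * Y 0 a' - v * X 1 a * Y 0 b') * (- u * X 0 b * Y 1 a' + v * X 0 a * Y 1 b')
    - (- u * X 0 b * Y 0 a' + v * X 0 a * Y 0 b') * (u * X 1 b * Y 1 a' - v * X 1 a * Y 1 b') =
    u * v * wdg X a X b * wdg Y a' Y b' by rewrite /wdg; ring.
  rewrite /u /v (wdgC Y Y c' b') (wdgC X X c b) !mulf_neq0// oppr_eq0//.
by split; rewrite /wdg !mul2E !A0 !A1 /u /v /wdg; ring.
Qed.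

Lemma three_off X (p : 'cV[F]_2) : three X -> nzc p 0 ->
  exists c d, [/\ wdg X c X d != 0, wdg p 0 X c != 0 & wdg p 0 X d != 0].
Proof.
move=> [i [j [k [ij ik jk]]]] p0.
have h l m : wdg X l X m != 0 -> wdg p 0 X l == 0 -> wdg p 0 X m != 0.
  move=> lm /eqP pl; apply: contra lm => /eqP pm; apply/eqP.
  by apply: wdg_trans p0 _ pm; rewrite wdgC pl oppr0.
have [pi|pi] := boolP (wdg p 0 X i == 0).
  by exists j, k; split=> //; apply: h pi.
have [pj|pj] := boolP (wdg p 0 X j == 0); last by exists i, j.
by exists i, k; split=> //; exact: h pj.
Qed.

(** In degree at most four a degenerate limit relates two divisors of the
    form [2p + a + b], and these are all equivalent. *)
Lemma tequiv_le4 A s X Y : (n <= 4)%N -> good3 X -> good3 Y -> A != 0 -> rel_by A s X Y ->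
  tequiv X Y.
Proof.
move=> n4 [gX tX] [gY tY] A0 hs.
have [uA|] := boolP (A \in unitmx); first by exists A => //; exists s.
rewrite unitmxE unitfE negbK => /eqP d0.
have [p [q [p0 q0 pq]]] := degenerate_rel A0 d0 hs.
have [c [d [cd pc pd]]] := three_off tX p0.
have [a [b]] := three_off tY q0.
rewrite -(permKV s a) -(permKV s b); set c' := s^-1%g a; set d' := s^-1%g b => -[cd' qc qd].
have {}pq i : (wdg p 0 X i == 0) || (wdg q 0 Y (s i) == 0).
  by case: (pq i) => ->; rewrite eqxx ?orbT.
have qc' : wdg q 0 Y (s c) = 0 by apply/eqP; have := pq c; rewrite (negPf pc).
have qd' : wdg q 0 Y (s d) = 0 by apply/eqP; have := pq d; rewrite (negPf pd).
have pc' : wdg p 0 X c' = 0 by apply/eqP; have := pq c'; rewrite (negPf qc) orbF.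
have pd' : wdg p 0 X d' = 0 by apply/eqP; have := pq d'; rewrite (negPf qd) orbF.
have ne i j : wdg p 0 X i != 0 -> wdg p 0 X j = 0 -> i != j.
  by move=> pi pj; apply: contraNneq pi => ->; rewrite pj.
have cdN : c != d by apply: contraNneq cd => ->; rewrite wdgxx.
have cdN' : c' != d' by apply: contraNneq cd' => ->; rewrite wdgxx.
have cc' := ne _ _ pc pc'; have cd1 := ne _ _ pc pd'.
have dc' := ne _ _ pd pc'; have dd' := ne _ _ pd pd'.
have un : uniq [:: c; d; c'; d'].
  by rewrite /= !inE !negb_or cdN cc' cd1 dc' dd' cdN'.
have all4 i : i \in [:: c; d; c'; d'].
  have [|_ ->] := uniq_min_size un (fun i _ => mem_enum 'I_n i); last by rewrite mem_enum.
  by rewrite size_enum_ord.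
have nonpar (W : 'M[F]_(2, n)) (r : 'cV[F]_2) i j :
    nzc W i -> wdg r 0 W i = 0 -> wdg r 0 W j != 0 -> wdg W i W j != 0.
  move=> Wi ri rj; apply: contra rj => /eqP ij; apply/eqP; exact: wdg_trans Wi ri ij.
have [||||||B uB [h1 h2 h3]] := @three_transitive _ _ X Y c' c d (s c) (s c') (s d') => //.
- exact: (nonpar X p _ _ (gX _) pc' pc).
- exact: (nonpar X p _ _ (gX _) pc' pd).
- exact: (nonpar Y q _ _ (gY _) qc' qc).
- exact: (nonpar Y q _ _ (gY _) qc' qd).
exists B => //; exists (tperm c c' * tperm d d' * s)%g => i.
have tc : (tperm c c' * tperm d d' * s)%g c = s c'.
  by rewrite !permM tpermL tpermD// 1?eq_sym.
have tc' : (tperm c c' * tperm d d' * s)%g c' = s c.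
  by rewrite !permM tpermR tpermD// 1?eq_sym.
have td : (tperm c c' * tperm d d' * s)%g d = s d'.
  by rewrite !permM (@tpermD _ c c' d) ?tpermL// 1?eq_sym.
have td' : (tperm c c' * tperm d d' * s)%g d' = s d.
  by rewrite !permM (@tpermD _ c c' d') ?tpermR// 1?eq_sym.
have := all4 i; rewrite !inE => /or4P[] /eqP->; rewrite ?tc ?td ?tc' ?td'//.
have p1 : wdg (B *m X) d' (B *m X) c' = 0.
  rewrite wdg_mul (_ : wdg X d' X c' = 0) ?mulr0//.
  by apply: wdg_trans p0 _ pc'; rewrite wdgC pd' oppr0.
have h4 : wdg (B *m X) d' Y (s c) = 0.
  by apply: wdg_trans _ p1 h1; rewrite nzc_mul.
apply: wdg_trans (gY (s c)) h4 _.
by apply: wdg_trans q0 _ qd'; rewrite wdgC qc' oppr0.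
Qed.

Lemma moduli_hausdorff_le4 : (n <= 4)%N -> hausdorff_space (moduli F n).
Proof.
move=> n4; apply: separated_hausdorff => x y xy.
have [X _ rX] := moduli_represents x; have [Y _ rY] := moduli_represents y.
apply: (separated_moduli rX rY) => A s A0 hs; apply: xy; apply/(represents_eq rX rY).
exact: tequiv_le4 n4 (represents_good3 rX) (represents_good3 rY) A0 hs.
Qed.

End Separation.

(** * Divisors with a point of large multiplicity *)

Section NonHausdorff.
Context {F : numFieldType} (lf : local_field F) {n : nat}.
Implicit Types (X Y W E : 'M[F]_(2, n)) (x y : moduli F n) (P : {set 'I_n}).

(** In coordinates: the finite points [a i] on [P], and infinity elsewhere. *)
Definition std_tuple P (a : 'I_n -> F) : 'M[F]_(2, n) :=
  \matrix_(r, i) if i \in P then (if r == 0 then a i else 1) else (r == 0)%:R.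

Lemma std_tuple0 P a i : std_tuple P a 0 i = if i \in P then a i else 1.
Proof. by rewrite mxE. Qed.

Lemma std_tuple1 P a i : std_tuple P a 1 i = (i \in P)%:R.
Proof. by rewrite mxE; case: ifP. Qed.

Lemma nbhs0_neq0 (U : set F) : nbhs 0 U -> exists2 t, t != 0 & U t.
Proof.
move=> /nbhs_ballP[e /= e0 eU]; exists (e / 2); first by rewrite gt_eqF// divr_gt0.
apply: eU; rewrite -ball_normE /= sub0r normrN gtr0_norm ?divr_gt0//.
by rewrite ltr_pdivrMr// ltr_pMr// ltr1n.
Qed.

(** The projectivities [z -> 1 / (t z)] push the points of [P] to infinity and
    pull a cluster of the remaining points, placed near infinity, back to any
    prescribed position. *)
Lemma inseparable P a (s : {perm 'I_n}) W x y (U V : set (moduli F n)) :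
  represents (std_tuple P a) x -> represents W y ->
  (forall i, i \in P -> W 1 (s i) = 0 /\ W 0 (s i) = 1) ->
  (forall i, i \notin P -> W 1 (s i) != 0) ->
  open U -> open V -> U x -> V y -> exists2 z, U z & V z.
Proof.
move=> rX rW WP WN /(open_moduli lf) oU /(open_moduli lf) oV Ux Vy.
(* [Z t] and [Z' t] tend to the two given tuples as [t] tends to [0], and are
   exchanged by the projectivity [z -> 1 / (t z)] *)
pose Z (t : F) : 'M[F]_(2, n) := \matrix_(r, i)
  if i \in P then (if r == 0 then a i else 1)
  else (if r == 0 then 1 else t * (W 0 (s i) / W 1 (s i))).
pose Z' (t : F) : 'M[F]_(2, n) := \matrix_(r, j)
  if s^-1%g j \in P then (if r == 0 then 1 else t * a (s^-1%g j)) else W r j.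
have cid : continuous (fun t : F => t) by move=> t; exact: cvg_id.
have cZ : continuous Z.
  apply: cont_mx => r i; rewrite (_ : (fun t => _) = fun t => if i \in P then (if r == 0 then a i else 1)
    else (if r == 0 then 1 else t * (W 0 (s i) / W 1 (s i)))); last by apply/funext => t; rewrite mxE.
  case: (i \in P); case: (r == 0); do ?exact: contC.
  by apply: contM => //; exact: contC.
have cZ' : continuous Z'.
  apply: cont_mx => r i; rewrite (_ : (fun t => _) = fun t => if s^-1%g i \in P
      then (if r == 0 then 1 else t * a (s^-1%g i)) else W r i); last by apply/funext => t; rewrite mxE.
  case: (s^-1%g i \in P); case: (r == 0); do ?exact: contC.
  by apply: contM => //; exact: contC.
have Z0 : Z 0 = std_tuple P a.
  apply/matrixP => r i; rewrite !mxE; case: ifP => // _.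
  by case: (ord2 r) => ->; rewrite ?mul0r.
have Z'0 : Z' 0 = W.
  apply/matrixP => r j; rewrite mxE; case: ifP => // /WP; rewrite permKV => -[W1 W0].
  by case: (ord2 r) => ->; rewrite ?mul0r.
have n1 : nbhs (0 : F) (Z @^-1` [set X | exists2 x, U x & represents X x]).
  by apply: cZ; apply: open_nbhs_nbhs; split=> //; rewrite Z0; exists x.
have n2 : nbhs (0 : F) (Z' @^-1` [set X | exists2 x, V x & represents X x]).
  by apply: cZ'; apply: open_nbhs_nbhs; split=> //; rewrite Z'0; exists y.
have [t t0 [/= [u Uu ru] [v Vv rv]]] := nbhs0_neq0 (filterI n1 n2).
exists u => //; suff -> : u = v by [].
apply/(represents_eq ru rv).
pose A : 'M[F]_2 := \matrix_(r, c) if r == c then 0 else if r == 0 then 1 else t.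
have [A00 A01 A10 A11] : [/\ A 0 0 = 0, A 0 1 = 1, A 1 0 = t & A 1 1 = 0] by split; rewrite mxE.
exists A; first by rewrite unitmxE unitfE det2E A00 A01 A10 A11 mul0r mul1r sub0r oppr_eq0.
exists s => i; rewrite /wdg !mul2E A00 A01 A10 A11 !mxE permK.
case: ifP => [_|/negbT/WN h] /=; first by ring.
by field.
Qed.

Lemma perm_into P : (2 * #|P| <= n)%N -> exists s : {perm 'I_n}, forall i, i \in P -> s i \notin P.
Proof.
move=> hP; pose l1 := enum P ++ enum (~: P); pose l2 := enum (~: P) ++ enum P.
have sz : (#|P| + #|~: P|)%N = n by rewrite cardsC card_ord.
have in1 i : i \in l1 by rewrite mem_cat !mem_enum inE orbN.
have u2 : uniq l2.
  rewrite cat_uniq !enum_uniq /= andbT; apply/hasPn => i; rewrite !mem_enum inE => ->//.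
have s2 : size l2 = n by rewrite size_cat -!cardE addnC.
have s1 : size l1 = n by rewrite size_cat -!cardE.
have lt1 i : (index i l1 < n)%N by rewrite -[X in (_ < X)%N]s1 index_mem.
have inj : injective (fun i => nth i l2 (index i l1)).
  move=> i j /= e; have := e; rewrite (set_nth_default j) ?s2// => /eqP.
  rewrite nth_uniq ?s2// => /eqP ij.
  by rewrite -(nth_index i (in1 i)) ij (set_nth_default j) ?s1// nth_index.
exists (perm inj) => i iP; rewrite permE.
have : nth i l2 (index i l1) \in enum (~: P).
  rewrite nth_cat.
  have lt : (index i l1 < size (enum (~: P)))%N.
    rewrite /l1 index_cat mem_enum iP -cardE.
    apply: (@leq_trans #|P|); first by rewrite cardE index_mem mem_enum.
    by move: hP sz; lia.
  by rewrite lt mem_nth.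
by rewrite mem_enum inE.
Qed.

(** A one-parameter deformation fixing three points and moving a fourth one
    meets each equivalence class finitely often, hence leaves it arbitrarily
    close to the start. *)
Lemma deformation_inequivalent X E i j k l (O : set 'M[F]_(2, n)) :
  nbhs X O -> (forall W, O W -> good W) ->
  wdg X j X k != 0 -> wdg X j X l != 0 -> wdg X k X l != 0 ->
  (forall r, E r j = 0) -> (forall r, E r k = 0) -> (forall r, E r l = 0) ->
  wdg X i E i != 0 ->
  exists e, [/\ e != 0, O (X + e *: E) & ~ tequiv X (X + e *: E)].
Proof.
move=> nO gO jk jl kl Ej Ek El Ei.
pose W e := X + e *: E.
have cW : continuous W.
  apply: cont_mx => r c; rewrite (_ : (fun t => _) = fun e => X r c + e * E r c); last first.
    by apply/funext => e; rewrite !mxE.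
  by apply: contD; [exact: contC|apply: contM; [move=> ?; exact: cvg_id|exact: contC]].
have W0 : W 0 = X by rewrite /W scale0r addr0.
have : nbhs (0 : F) (W @^-1` O) by apply: cW; rewrite W0.
move=> /nbhs_ballP[d /= d0 dO].
pose e (N : nat) : F := d / N.+2%:R.
have e0 N : e N != 0 by rewrite mulf_neq0 ?gt_eqF// invr_gt0.
have eO N : O (W (e N)).
  apply: dO; rewrite -ball_normE /= sub0r normrN gtr0_norm ?divr_gt0//.
  by rewrite ltr_pdivrMr// ltr_pMr// ltr1n.
apply: contrapT => no.
have /choice[As hAs] : forall N, exists As : 'M[F]_2 * {perm 'I_n},
    As.1 \in unitmx /\ rel_by As.1 As.2 X (W (e N)).
  move=> N; apply: contrapT => h; apply: no; exists (e N); split; [exact: e0|exact: eO|].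
  by move=> [A uA [s hs]]; apply: h; exists (A, s).
have Wfix N c r : (forall r, E r c = 0) -> W (e N) r c = X r c.
  by move=> Ec; rewrite !mxE Ec mulr0 addr0.
have gX : good X by rewrite -W0; apply: gO; apply: dO; exact: ballxx.
have inj : injective (fun N => (As N).2).
  move=> N M sNM; have [uN hN] := hAs N; have [uM hM] := hAs M; rewrite /= in sNM.
  rewrite sNM in hN; have h := rel_byM gX (rel_byV uN hN) hM; rewrite mulVg in h.
  set B := (As M).1 *m invmx (As N).1 in h.
  have uB : B \in unitmx by rewrite unitmx_mul uM unitmx_inv.
  clearbody B.
  have [|c1 c2 c3] := @quadratic_three_zeros _ _ X j k l (- B 1 0) (B 0 0 - B 1 1) (B 0 1) jk jl kl.
    move=> c hc; have Ec r : E r c = 0 by move: hc; rewrite !inE => /or3P[] /eqP->.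
    by have := h c; rewrite perm1 /wdg !mul2E !Wfix// => <-; ring.
  have B10 : B 1 0 = 0 by apply/eqP; rewrite -oppr_eq0 c1.
  have B11 : B 1 1 = B 0 0 by apply/esym/eqP; rewrite -subr_eq0 c2.
  have B00 : B 0 0 != 0.
    by move: uB; rewrite unitmxE unitfE det2E c3 B10 B11 mul0r subr0 mulf_eq0 negb_or => /andP[].
  have WE K r : W (e K) r i = X r i + e K * E r i by rewrite !mxE.
  have : B 0 0 * (e M - e N) * wdg X i E i = 0.
    by have := h i; rewrite perm1 /wdg !mul2E c3 B10 B11 !WE => <-; ring.
  move/eqP; rewrite !mulf_eq0 (negPf B00) (negPf Ei) orbF/= subr_eq0 => /eqP.
  by rewrite /e => /(mulfI (lt0r_neq0 d0))/invr_inj/eqP; rewrite eqr_nat => /eqP[->].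
apply: infinite_nat.
rewrite -(preimage_setT (fun N => (As N).2)); apply: finite_preimage.
  by move=> N M _ _; exact: inj.
exact: finite_finset.
Qed.

Lemma represents_std X x i : represents X x -> 
  exists a, represents (std_tuple [set j | wdg X i X j != 0]%SET a) x.
Proof.
move=> rX; have [gX tX] := represents_good3 rX.
have [|q pq] := @wdg_complement _ (col i X); first by rewrite /nzc !mxE; exact: gX.
have {}pq : X 0 i * q 1 0 - X 1 i * q 0 0 != 0 by move: pq; rewrite /wdg !mxE.
pose a j := (X 0 j * q 1 0 - X 1 j * q 0 0) / wdg X i X j.
exists a; apply: (represents_tequiv rX).
  by move=> j; rewrite /nzc std_tuple0 std_tuple1; case: ifP; rewrite ?oner_eq0 ?orbT.
pose A : 'M[F]_2 := \matrix_(r, c)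
  if r == 0 then (if c == 0 then q 1 0 else - q 0 0) else (if c == 0 then - X 1 i else X 0 i).
have [A00 A01 A10 A11] : [/\ A 0 0 = q 1 0, A 0 1 = - q 0 0, A 1 0 = - X 1 i & A 1 1 = X 0 i].
  by split; rewrite mxE.
exists A.
  rewrite unitmxE unitfE det2E A00 A01 A10 A11.
  by rewrite (_ : _ - _ = X 0 i * q 1 0 - X 1 i * q 0 0)//; ring.
exists 1%g => j; rewrite perm1 /wdg !mul2E A00 A01 A10 A11 std_tuple0 std_tuple1 inE.
case: eqP => [h|/eqP h] /=.
  by transitivity (- wdg X i X j); [rewrite /wdg; ring|rewrite /wdg h oppr0].
by rewrite /a; move: h; rewrite /wdg => h; field.
Qed.

Lemma not_locally_hausdorff X x : (4 < n)%N -> represents X x -> ~ stable X ->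
  ~ locally_hausdorff x.
Proof.
move=> n4 rX nst [N + hN]; rewrite nbhsE => -[U [oU Ux] UN].
have [i hi] : exists i, (n <= 2 * cmult X i)%N.
  apply: contrapT => h; apply: nst; split; first exact: represents_good3 rX.
  by move=> i; rewrite ltnNge; apply/negP => hi; apply: h; exists i.
have [a] := represents_std i rX; set P := [set j | _]%SET => rY.
have Psmall : (2 * #|P| <= n)%N.
  have : (cmult X i + #|P|)%N = n.
    rewrite -[RHS]card_ord -(cardsC [set j | wdg X i X j == 0]%SET); congr (_ + _)%N.
    by apply: eq_card => j; rewrite !inE.
  by move: hi; lia.
have [s sP] := perm_into Psmall.
set Y := std_tuple P a in rY.
have oO := (open_moduli lf _).1 oU.
set O := [set X | _] in oO.
have nO : nbhs Y O by apply: open_nbhs_nbhs; split=> //; exists x.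
have gO W : O W -> good W by move=> [z _ /represents_good3[]].
have [|b [c [bc pb pc]]] := @three_off _ _ Y (\col_r (r == 0)%:R) (represents_good3 rY).2.
  by rewrite /nzc !mxE /= oner_eq0.
have inP j : wdg (\col_r (r == 0)%:R : 'cV[F]_2) 0 Y j != 0 -> j \in P.
  by rewrite /wdg !mxE /= mul1r mul0r subr0; case: (j \in P); rewrite // eqxx.
have {pb}bP := inP _ pb; have {pc}cP := inP _ pc.
have Yd j : j \in P -> wdg Y j Y (s b) != 0.
  move=> jP; rewrite /wdg !std_tuple0 !std_tuple1 (negPf (sP b bP)) jP /=.
  by rewrite mulr0 mul1r sub0r oppr_eq0 oner_eq0.
have cbN : b != c by apply: contraNneq bc => ->; rewrite wdgxx.
(* [Y + e *: E] is inseparable from [Y], by [s], and inequivalent to it *)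
suff [E [h1 h2 h3 [j Ej]]] : exists E : 'M[F]_(2, n),
    [/\ forall i r, i \in P -> E r (s i) = 0,
        forall i e, e != 0 -> i \notin P -> (Y + e *: E) 1 (s i) != 0,
        forall r, E r b = 0 /\ E r c = 0 &
        exists j, wdg Y j E j != 0].
  have [e [e0 OW nW]] := deformation_inequivalent nO gO bc (Yd b bP) (Yd c cP)
    (fun r => (h3 r).1) (fun r => (h3 r).2) (fun r => h1 b r bP) Ej.
  case: OW => y Uy rW.
  have xy : x <> y by move/(represents_eq rY rW).
  pose x' : N := exist _ x (mem_set (UN _ Ux)); pose y' : N := exist _ y (mem_set (UN _ Uy)).
  have [|A [B [[A' oA' eA] [B' oB' eB] Ax By AB]]] := @hausdorff_separated _ x' y' hN.
    by move/(congr1 val).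
  have A'x : A' x by rewrite -eA in Ax.
  have B'y : B' y by rewrite -eB in By.
  have q1 l : l \in P -> (Y + e *: E) 1 (s l) = 0 /\ (Y + e *: E) 0 (s l) = 1.
    by move=> lP; rewrite !mxE (negPf (sP l lP)) !(h1 l _ lP) !mulr0 !addr0.
  have q2 l : l \notin P -> (Y + e *: E) 1 (s l) != 0 by move=> lP; exact: h2.
  have [z [A'z Uz] [B'z _]] := inseparable rY rW q1 q2 (openI oA' oU) (openI oB' oU)
      (conj A'x Ux) (conj B'y Uy).
  apply: (AB (exist _ z (mem_set (UN _ Uz)))); first by rewrite -eA.
  by rewrite -eB.
(* if [s] preserves infinity at some index, the image can be moved away from
   infinity; otherwise [P] has a third point, since [4 < n], that can be moved *)
have [[l lP slP]|no] := pselect (exists2 l, l \notin P & s l \notin P).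
  exists (\matrix_(r, j) ((r == 1) && (j \notin P) && (s^-1%g j \notin P))%:R); split.
  - by move=> j r jP; rewrite mxE permK jP !andbF.
  - move=> j e e0 jP; rewrite [_ 1 _]mxE std_tuple1 !mxE permK jP /= andbT.
    by case: (s j \in P) => /=; rewrite ?mulr0 ?addr0 ?oner_eq0// add0r mulr1.
  - by move=> r; rewrite !mxE bP cP /= andbF.
  - exists (s l); rewrite /wdg std_tuple0 std_tuple1 !mxE permK (negPf slP) lP /=.
    by rewrite mulr1 mul0r subr0 oner_eq0.
have sN l : l \notin P -> s l \in P.
  by move=> lP; apply: contrapT => /negP slP; apply: no; exists l.
have Pcard : (2 < #|P|)%N.
  suff : (#|~: P| <= #|P|)%N by have := cardsC P; rewrite card_ord; lia.
  rewrite -(card_imset _ (@perm_inj _ s)); apply: subset_leq_card.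
  by apply/fintype.subsetP => _ /imsetP[l + ->]; rewrite inE => /sN.
have [j jP /andP[jb jc]] : exists2 j, j \in P & (j != b) && (j != c).
  have : (0 < #|P :\ b :\ c|)%N.
    have := cardsD1 b P; have := cardsD1 c (P :\ b).
    have cb : c != b by rewrite eq_sym.
    rewrite in_setD1 bP cP cb /= => e1 e2.
    by move: Pcard; rewrite e2 e1 !add1n.
  by case/card_gt0P => j; rewrite !in_setD1 => /and3P[jc jb jP]; exists j => //; rewrite jb jc.
exists (\matrix_(r, l) ((r == 0) && (l == j))%:R); split.
- move=> l r lP; rewrite mxE; case: eqP => [_|//] /=; case: eqP => // e.
  by have := sP l lP; rewrite e jP.
- move=> l e e0 lP; rewrite [_ 1 _]mxE std_tuple1 !mxE (sN l lP) /= mulr0 addr0.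
  exact: oner_neq0.
- by move=> r; rewrite !mxE (eq_sym b) (negPf jb) (eq_sym c) (negPf jc) !andbF.
- exists j; rewrite /wdg std_tuple0 std_tuple1 !mxE jP eqxx /=.
  by rewrite mulr0 mulr1 sub0r oppr_eq0 oner_eq0.
Qed.

Lemma moduli_not_locally_hausdorff : (4 < n)%N -> forall D : fs_divisor F n,
  (n <= 2 * max_mult (val D))%N -> ~ locally_hausdorff (moduli_pt D).
Proof.
move=> n4 D hD; have [X _ [rX eX]] := fs_represents D.
apply: (not_locally_hausdorff n4 rX).
move/(max_mult_stable (represents_good3 rX)); rewrite -eX ltnNge.
by rewrite hD.
Qed.

(** In degree at least five, the divisor with one point of multiplicity
    [n - 2] and two simple points spoils separation. *)
Lemma moduli_not_hausdorff : (4 < n)%N -> ~ hausdorff_space (moduli F n).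
Proof.
move=> n4 hM.
pose i0 : 'I_n := Ordinal (ltn_trans (isT : 0 < 4)%N n4).
pose i1 : 'I_n := Ordinal (ltn_trans (isT : 1 < 4)%N n4).
pose i2 : 'I_n := Ordinal (ltn_trans (isT : 2 < 4)%N n4).
pose P : {set 'I_n} := [set i0; i1]%SET; pose a i : F := (i == i1)%:R.
have [e00 e10] : std_tuple P a 0 i0 = 0 /\ std_tuple P a 1 i0 = 1.
  by rewrite std_tuple0 std_tuple1 !inE eqxx.
have [e01 e11] : std_tuple P a 0 i1 = 1 /\ std_tuple P a 1 i1 = 1.
  by rewrite std_tuple0 std_tuple1 !inE eqxx orbT /a eqxx.
have [e02 e12] : std_tuple P a 0 i2 = 1 /\ std_tuple P a 1 i2 = 0.
  by rewrite std_tuple0 std_tuple1 !inE.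
have g3 : good3 (std_tuple P a).
  split.
    by move=> j; rewrite /nzc std_tuple0 std_tuple1; case: ifP; rewrite ?oner_eq0 ?orbT.
  by exists i0, i1, i2; rewrite /wdg !(e00, e10, e01, e11, e02, e12) !(mulr0, mul0r, mulr1, sub0r, subr0) !oppr_eq0 oner_eq0.
have [x rx] := good3_represents g3.
apply: (not_locally_hausdorff n4 rx).
  move=> [_ /(_ i2)]; apply/negP; rewrite -leqNgt.
  have : (n - 2 <= cmult (std_tuple P a) i2)%N.
    have -> : (n - 2)%N = #|~: P| by have := cardsC P; rewrite cards2 card_ord /=; lia.
    apply: subset_leq_card; apply/fintype.subsetP => j; rewrite inE => jP; rewrite inE.
    by rewrite /wdg std_tuple1 std_tuple0 std_tuple1 std_tuple0 (negPf jP) !inE /= !(mulr0, mul0r) subr0.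
  by lia.
exists setT; first exact: filterT.
apply: separated_hausdorff => y z yz.
have [|A [B [oA oB Ay Bz AB]]] := @hausdorff_separated _ (val y) (val z) hM.
  by move=> e; apply: yz; exact: val_inj.
exists (set_val @^-1` A), (set_val @^-1` B); split=> //; [by exists A|by exists B|].
by move=> w; exact: AB.
Qed.

End NonHausdorff.

(** * Slices *)

Section Opposite.
Context {F : numFieldType} {n : nat}.
Implicit Types (X Y : 'M[F]_(2, n)) (v w : 'cV[F]_n) (g : 'M[F]_2) (s : {perm 'I_n}).

(** The barycenter of the points other than the [i]-th one, computed in the
    affine chart where that point is at infinity; it commutes with
    projectivities and differs from the [i]-th point. *)
Definition opp X : 'M[F]_(2, n) :=
  \matrix_(r, i) \sum_(j | wdg X i X j != 0) X r j / wdg X i X j.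

Definition nopp X i : F := #|[pred j | wdg X i X j != 0]|%:R.

Lemma wdg_opp X i : wdg X i (opp X) i = nopp X i.
Proof.
rewrite /wdg !mxE !big_distrr/= -sumrB.
under eq_bigr => j h do rewrite !mulrA -mulrBl -/(wdg X i X j) divff//.
by rewrite sumr_const.
Qed.

Lemma nopp_neq0 X i : three X -> good X -> nopp X i != 0.
Proof.
move=> tX gX; rewrite pnatr_eq0 -lt0n; apply/card_gt0P.
have [|c [_ [_ hc _]]] := @three_off _ _ X (col i X) tX; first by rewrite /nzc !mxE; exact: gX.
by exists c; move: hc; rewrite inE /wdg !mxE.
Qed.

(** Moving every point towards its opposite one: up to rescaling the columns,
    these are affine coordinates on the tuples around [X]. *)
Definition nearby X v : 'M[F]_(2, n) := \matrix_(r, i) (X r i + v i 0 * opp X r i).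

Lemma nearby0 X : nearby X 0 = X.
Proof. by apply/matrixP => r i; rewrite !mxE mul0r addr0. Qed.

Lemma wdg_nearby X v w i : wdg (nearby X w) i (nearby X v) i = nopp X i * (v i 0 - w i 0).
Proof. by rewrite -wdg_opp /wdg ![nearby _ _ _ _]mxE; ring. Qed.

Lemma cont_nearby (T : topologicalType) X (f : T -> 'cV[F]_n) :
  continuous f -> continuous (fun t => nearby X (f t)).
Proof.
move=> cf; apply: cont_mx => r i.
rewrite (_ : (fun t => _) = fun t => X r i + f t i 0 * opp X r i); last first.
  by apply/funext => t; rewrite mxE.
by apply: contD; [exact: contC|apply: contM; [exact: cont_entry|exact: contC]].
Qed.

(** The factors [c] keep track of the homogeneous coordinates. *)
Definition symm X g s (c : 'I_n -> F) : Prop :=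
  g \in unitmx /\ forall i r, X r (s i) = c i * (g *m X) r i.

Lemma symm_neq0 X g s c i : good X -> symm X g s c -> c i != 0.
Proof.
by move=> gX [_ h]; apply/negP => /eqP c0; have := gX (s i); rewrite /nzc !h c0 !mul0r eqxx.
Qed.

Lemma symm_wdg X g s c i j : symm X g s c ->
  wdg X (s i) X (s j) = c i * c j * \det g * wdg X i X j.
Proof. by move=> [_ h]; rewrite -mulrA -wdg_mul /wdg !h; ring. Qed.

Lemma symm1 X : symm X 1%:M 1%g (fun=> 1).
Proof. by split=> [|i r]; rewrite ?unitmx1// mul1mx perm1 mul1r. Qed.

Lemma symmV X g s c : good X -> symm X g s c -> symm X (invmx g) s^-1%g (fun i => (c (s^-1%g i))^-1).
Proof.
move=> gX sX; have [ug h] := sX; split=> [|i r]; first by rewrite unitmx_inv.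
have c0 := symm_neq0 (s^-1%g i) gX sX.
apply: (mulfI c0); rewrite mulrA divff// mul1r mul2E.
have e q : X q i = c (s^-1%g i) * (g *m X) q (s^-1%g i) by rewrite -h permKV.
rewrite !e mulrCA [_ * (c _ * _)]mulrCA -mulrDr -mul2E mulmxA.
by rewrite mulVmx// mul1mx.
Qed.

Lemma symmM X g s c g' s' c' : symm X g s c -> symm X g' s' c' ->
  symm X (g' *m g) (s * s')%g (fun i => c' (s i) * c i).
Proof.
move=> [ug h] [ug' h']; split=> [|i r]; first by rewrite unitmx_mul ug'.
by rewrite permM h' -mulmxA !(mul2E g') !h; ring.
Qed.

Lemma rel_by_symm X g s : good X -> g \in unitmx -> rel_by g s X X -> exists c, symm X g s c.
Proof. by move=> gX ug /(rel_by_good ug gX)[c hc]; exists c; split. Qed.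

(** The diagonal part of the action of a symmetry in the coordinates [nearby]. *)
Definition sfactor g (c : 'I_n -> F) i : F := c i ^+ 2 * \det g.

Lemma sfactor_neq0 X g s c i : good X -> symm X g s c -> sfactor g c i != 0.
Proof.
move=> gX sX; rewrite mulf_neq0 ?expf_neq0 ?(symm_neq0 _ gX sX)//.
by have [] := sX; rewrite unitmxE unitfE.
Qed.

Lemma symm_opp X g s c i r : good X -> symm X g s c ->
  opp X r (s i) = (c i * \det g)^-1 * (g *m opp X) r i.
Proof.
move=> gX sX; have [ug h] := sX; have c0 j := symm_neq0 j gX sX.
have d0 : \det g != 0 by move: ug; rewrite unitmxE unitfE.
rewrite mul2E !mxE (reindex_inj (@perm_inj _ s))/=.
move hD : (\det g) d0 => D d0.
rewrite (eq_bigl (fun j => wdg X i X j != 0)); last first.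
  by move=> j; rewrite (symm_wdg _ _ sX) hD !mulf_eq0 !(negPf (c0 _)) (negPf d0).
rewrite !big_distrr/= -big_split/= big_distrr/=; apply: eq_bigr => j ij.
rewrite (symm_wdg _ _ sX) hD h mul2E.
have := c0 i; have := c0 j => ? ?; field.
by do !(apply/andP; split).
Qed.

(** Since [opp] commutes with projectivities, the symmetries act linearly in
    the coordinates [nearby]. *)
Lemma symm_nearby X g s c v w : good X -> symm X g s c ->
  (forall i, w (s i) 0 = sfactor g c i * v i 0) ->
  forall i r, nearby X w r (s i) = c i * (g *m nearby X v) r i.
Proof.
move=> gX sX hw i r; have [ug h] := sX; have c0 := symm_neq0 i gX sX.
have d0 : \det g != 0 by move: ug; rewrite unitmxE unitfE.
rewrite mxE hw h (symm_opp i r gX sX) /sfactor !mul2E ![nearby _ _ _ _]mxE.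
by field; rewrite d0.
Qed.

Lemma symm_rel_nearby X g s c v w : good X -> symm X g s c ->
  (forall i, w (s i) 0 = sfactor g c i * v i 0) -> rel_by g s (nearby X v) (nearby X w).
Proof. by move=> gX sX hw i; rewrite /wdg !(symm_nearby gX sX hw); ring. Qed.

Lemma nopp_symm X g s c i : good X -> symm X g s c -> nopp X (s i) = nopp X i.
Proof.
move=> gX sX; rewrite /nopp; congr (_%:R).
rewrite -[RHS](card_imset _ (@perm_inj _ s)); apply: eq_card => j.
have d0 : \det g != 0 by have [] := sX; rewrite unitmxE unitfE.
have e l : (wdg X (s i) X (s l) == 0) = (wdg X i X l == 0).
  by rewrite (symm_wdg _ _ sX) !mulf_eq0 !(negPf (symm_neq0 _ gX sX)) (negPf d0).
rewrite inE; apply/idP/imsetP => [h|[l + ->]]; last by rewrite inE e.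
by exists (s^-1%g j); rewrite ?permKV// inE -e permKV.
Qed.

(** Weights of a Hermitian form for which the symmetries are unitary in the
    coordinates [nearby]. *)
Definition weight X i : F := \sum_j \sum_(k | wdg X j X k != 0)
  `|wdg (opp X) i X j * wdg (opp X) i X k / wdg X j X k| ^+ 2.

Lemma weight_symm X g s c i : good X -> symm X g s c ->
  weight X (s i) * `|sfactor g c i| ^+ 2 = weight X i.
Proof.
move=> gX sX; have [ug h] := sX; have c0 j := symm_neq0 j gX sX.
have d0 : \det g != 0 by move: ug; rewrite unitmxE unitfE.
have wo j : wdg (opp X) (s i) X (s j) = c j / c i * wdg (opp X) i X j.
  have -> : wdg (opp X) (s i) X (s j) = c j / (c i * \det g) * wdg (g *m opp X) i (g *m X) j.
    by rewrite /wdg !(symm_opp _ _ gX sX) !h; ring.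
  by rewrite wdg_mul; field; rewrite d0 c0.
rewrite /weight (reindex_inj (@perm_inj _ s))/= big_distrl/=; apply: eq_bigr => j _.
rewrite (reindex_inj (@perm_inj _ s))/= big_distrl/=.
apply: eq_big => [k|k]; first by rewrite (symm_wdg _ _ sX) !mulf_eq0 !(negPf (c0 _)) (negPf d0).
rewrite (symm_wdg _ _ sX) !mulf_eq0 !(negPf (c0 _)) (negPf d0)/= => jk.
rewrite -exprMn -normrM; congr (`|_| ^+ 2).
rewrite !wo /sfactor; have := c0 i; have := c0 j; have := c0 k => ? ? ?.
by field; do !(apply/andP; split).
Qed.

Lemma weight_gt0 X i : good3 X -> 0 < weight X i.
Proof.
move=> [gX tX].
have o0 : nzc (col i (opp X)) 0.
  have h : wdg X i (opp X) i != 0 by rewrite wdg_opp nopp_neq0.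
  apply: contraTT h; rewrite /nzc ![col _ _ _ _]mxE negb_or !negbK => /andP[/eqP e0 /eqP e1].
  by rewrite /wdg e0 e1 !mulr0 subrr eqxx.
have [c [d [cd oc od]]] := three_off tX o0.
have {}oc : wdg (opp X) i X c != 0 by move: oc; rewrite /wdg !mxE.
have {}od : wdg (opp X) i X d != 0 by move: od; rewrite /wdg !mxE.
have ge0 j k : 0 <= `|wdg (opp X) i X j * wdg (opp X) i X k / wdg X j X k| ^+ 2.
  by rewrite exprn_ge0.
rewrite /weight (bigD1 c)//= ltr_pwDl//; last first.
  by apply: sumr_ge0 => j _; apply: sumr_ge0 => k _; exact: ge0.
rewrite (bigD1 d)//= ltr_pwDl//; last by apply: sumr_ge0 => k _; exact: ge0.
by rewrite exprn_gt0// normr_gt0 !mulf_neq0// invr_eq0.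
Qed.

(** Values of the quadratic monomials at the points of a tuple; they span the
    tangent space of the orbit. *)
Definition qmon X : 'M[F]_(n, 3) :=
  \matrix_(i, t) (if t == 0 then X 0 i ^+ 2 else if t == 1 then X 0 i * X 1 i else X 1 i ^+ 2).

Lemma ord3 (t : 'I_3) : [\/ t = 0, t = 1 | t = 2].
Proof.
by case: t => [[|[|[|//]]] ?]; [apply: Or31|apply: Or32|apply: Or33]; apply: val_inj.
Qed.

Lemma sum3 (V : nmodType) (f : 'I_3 -> V) : \sum_t f t = f 0 + f 1 + f 2.
Proof.
rewrite !big_ord_recl big_ord0 addr0 addrA; congr (f _ + f _ + f _); exact: val_inj.
Qed.

Lemma qmonE X (h : 'cV[F]_3) i :
  (qmon X *m h) i 0 = X 0 i ^+ 2 * h 0 0 + X 0 i * X 1 i * h 1 0 + X 1 i ^+ 2 * h 2 0.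
Proof. by rewrite mxE sum3 !mxE. Qed.

Lemma qmon_inj X (h : 'cV[F]_3) : three X -> qmon X *m h = 0 -> h = 0.
Proof.
move=> [i [j [k [ij ik jk]]]] e.
have [|h0 h1 h2] := @quadratic_three_zeros _ _ X i j k (h 0 0) (h 1 0) (h 2 0) ij ik jk.
  by move=> l _; have := congr1 (fun M : 'cV[F]_n => M l 0) e; rewrite qmonE !mxE => <-; ring.
by apply/matrixP => t z; rewrite ord1 mxE; case: (ord3 t) => ->.
Qed.

(** These matrices form a complement of the scalar ones, so they stand for the
    Lie algebra of the group of projectivities; [h] lists the coefficients of the
    vector field, a binary quadratic form. *)
Definition gen (h : 'cV[F]_3) : 'M[F]_2 :=
  \matrix_(r, c) (if r == 0 then (if c == 0 then - h 1 0 else - h 2 0)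
                  else (if c == 0 then h 0 0 else 0)).

Lemma genE h : [/\ gen h 0 0 = - h 1 0, gen h 0 1 = - h 2 0, gen h 1 0 = h 0 0 & gen h 1 1 = 0].
Proof. by split; rewrite mxE. Qed.

Lemma wdg_gen X h i : wdg X i (gen h *m X) i = (qmon X *m h) i 0.
Proof.
have [h00 h01 h10 h11] := genE h.
by rewrite qmonE /wdg !mul2E h00 h01 h10 h11; ring.
Qed.

Lemma gen_decomp (A : 'M[F]_2) : exists h : 'cV[F]_3, A = (A 1 1)%:M + gen h.
Proof.
exists (\col_t (if t == 0 then A 1 0 else if t == 1 then A 1 1 - A 0 0 else - A 0 1)).
by apply/matrixP => r c; case: (ord2 r) (ord2 c) => -> [] ->; rewrite !mxE /=;
  rewrite ?mulr1n ?mulr0n; ring.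
Qed.

End Opposite.

Lemma unitmx_inj (F : fieldType) k (A : 'M[F]_k) :
  (forall h : 'cV[F]_k, A *m h = 0 -> h = 0) -> A \in unitmx.
Proof.
move=> inj; rewrite -unitmx_tr -row_free_unit -kermx_eq0; apply/rowV0P => v.
move=> /sub_kermxP vA; apply: trmx_inj; rewrite trmx0; apply: inj.
by rewrite -[A]trmxK -trmx_mul vA trmx0.
Qed.

Lemma wdgDZ (F : fieldType) m k (Y : 'M[F]_(2, m)) (Y' Y2 : 'M[F]_(2, k)) a i j :
  wdg Y i (a *: Y' + Y2) j = a * wdg Y i Y' j + wdg Y i Y2 j.
Proof. by rewrite /wdg !mxE; ring. Qed.

Lemma wdg_sum (F : fieldType) m k (I : finType) (Y : 'M[F]_(2, m)) (a : I -> F)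
    (M : I -> 'M[F]_(2, k)) i j :
  wdg Y i (\sum_t a t *: M t) j = \sum_t a t * wdg Y i (M t) j.
Proof.
rewrite /wdg !summxE !mulr_sumr -sumrB; apply: eq_bigr => t _; rewrite !mxE; ring.
Qed.

Lemma linear_col (K : comNzRingType) (V : lmodType K) m (phi : 'cV[K]_m -> V) :
  (forall a u v, phi (a *: u + v) = a *: phi u + phi v) ->
  forall y, phi y = \sum_k y k 0 *: phi (delta_mx k 0).
Proof.
move=> lin y.
have phi0 : phi 0 = 0.
  by have /eqP := lin 1 0 0; rewrite !scale1r addr0 -subr_eq subrr eq_sym => /eqP.
have {1}-> : y = \sum_k y k 0 *: delta_mx k 0.
  by rewrite {1}[y]matrix_sum_delta; apply: eq_bigr => k _; rewrite big_ord1.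
by elim/big_rec2: _ => [//|k u v _ IH]; rewrite lin IH.
Qed.

(** A slice, in the sense of Luna, for the action of the projectivities on the
    tuples: the orbits near the affine family [slice_tuple] are parametrized by
    [slice_dom] up to the finite group of the [slice_sym]. Charts and transition
    maps are built from these properties alone; [slice_return] supplies the
    openness of the charts and the analyticity of the transition maps. *)
Record slice (F : numFieldType) (d : nat) := Slice {
  slice_tuple : 'cV[F]_d -> 'M[F]_(2, 3 + d);
  slice_dir : 'I_d -> 'M[F]_(2, 3 + d);
  slice_dom : set 'cV[F]_d;
  slice_sym : {perm 'I_(3 + d)} -> set 'M[F]_d;
  slice_affine : forall v w,
    slice_tuple v = slice_tuple w + \sum_t (v - w) t 0 *: slice_dir t;
  slice_sym_unique : forall s r r', slice_sym s r -> slice_sym s r' -> r = r';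
  slice_sym1 : slice_sym 1%g 1%:M;
  slice_symM : forall s s' r r', slice_sym s r -> slice_sym s' r' ->
    slice_sym (s * s')%g (r' *m r);
  slice_symV : forall s r, slice_sym s r ->
    exists2 r', slice_sym s^-1%g r' & r *m r' = 1%:M;
  slice_dom_open : open slice_dom;
  slice_dom0 : slice_dom 0;
  slice_dom_sym : forall s r z, slice_sym s r -> slice_dom z -> slice_dom (r *m z);
  slice_stable : forall z, slice_dom z -> stable (slice_tuple z);
  slice_sym_rel : forall s r, slice_sym s r -> exists2 A, A \in unitmx &
    forall z, rel_by A s (slice_tuple z) (slice_tuple (r *m z));
  slice_rel_sym : forall s A z z', slice_dom z -> slice_dom z' -> A \in unitmx ->
    rel_by A s (slice_tuple z) (slice_tuple z') -> exists2 r, slice_sym s r & z' = r *m z;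
  slice_return : forall z p (w : 'cV[F]_p) (eta : 'I_p -> 'M[F]_(2, 3 + d)), slice_dom z ->
    exists f : 'cV[F]_p -> 'cV[F]_d,
    [/\ forall i, analytic_at (fun u => f u i 0) w, f w = z, f u @[u --> w] --> f w &
        \forall u \near w, exists2 A, A \in unitmx &
          rel_by A 1%g (slice_tuple z + \sum_t (u - w) t 0 *: eta t) (slice_tuple (f u))] }.

Section Slice.
Context {F : numFieldType} (lf : local_field F) {d : nat}.
Context (cj : {rmorphism F -> F}) (cjK : forall z, cj z * z = `|z| ^+ 2).
Context (X : 'M[F]_(2, 3 + d)) (stX : stable X).
Implicit Types (v w : 'cV[F]_(3 + d)) (z : 'cV[F]_d) (g A : 'M[F]_2) (s : {perm 'I_(3 + d)}).

Let gX : good X := stX.1.1.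
Let tX : three X := stX.1.2.

(** Tangent vectors of the orbit, and the equations of their orthogonal
    complement for the invariant Hermitian form given by the weights. *)
Let kap : 'M[F]_(3 + d, 3) := \matrix_(i, t) (qmon X i t / nopp X i).
Let Cmx : 'M[F]_(3, 3 + d) := \matrix_(t, i) (weight X i * cj (kap i t)).

Let kapE (h : 'cV[F]_3) i : (kap *m h) i 0 = (qmon X *m h) i 0 / nopp X i.
Proof. by rewrite !mxE big_distrl/=; apply: eq_bigr => t _; rewrite mxE mulrAC. Qed.

Let CmxE v t : (Cmx *m v) t 0 = \sum_i weight X i * cj (kap i t) * v i 0.
Proof. by rewrite mxE; apply: eq_bigr => i _; rewrite [Cmx _ _]mxE. Qed.

(** The form is definite on the tangent space of the orbit. *)
Let Cmx_kap (h : 'cV[F]_3) : Cmx *m (kap *m h) = 0 -> h = 0.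
Proof.
move=> e.
have : \sum_i weight X i * `|(kap *m h) i 0| ^+ 2 = 0.
  transitivity (\sum_t cj (h t 0) * (Cmx *m (kap *m h)) t 0); last first.
    by rewrite e; apply: big1 => t _; rewrite mxE mulr0.
  under [RHS]eq_bigr do rewrite CmxE big_distrr/=.
  rewrite exchange_big/=; apply: eq_bigr => i _.
  have ck : cj ((kap *m h) i 0) = \sum_t cj (kap i t) * cj (h t 0).
    by rewrite mxE rmorph_sum; apply: eq_bigr => t _; rewrite rmorphM.
  rewrite -cjK ck mulr_suml mulr_sumr.
  by apply: eq_bigr => t _; ring.
move=> s0; have z0 i : (kap *m h) i 0 = 0.
  have h0 j : true -> 0 <= weight X j * `|(kap *m h) j 0| ^+ 2.
    by move=> _; rewrite mulr_ge0 ?exprn_ge0// ltW// weight_gt0//; exact: stX.1.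
  have /eqP := s0; rewrite psumr_eq0// => /allP/(_ i (mem_index_enum i))/=.
  by rewrite mulf_eq0 gt_eqF ?(weight_gt0 _ stX.1)//= expf_eq0/= normr_eq0 => /eqP.
apply: (qmon_inj tX); apply/matrixP => i k; rewrite ord1 [RHS]mxE.
have := z0 i; rewrite kapE => /eqP; rewrite mulf_eq0 invr_eq0 (negPf (nopp_neq0 i tX gX)) orbF.
by move/eqP.
Qed.

Let slice_basis : exists B : 'M[F]_(3 + d, d), Cmx *m B = 0 /\ row_mx kap B \in unitmx.
Proof.
have uCk : Cmx *m kap \in unitmx.
  by apply: unitmx_inj => h; rewrite -mulmxA; exact: Cmx_kap.
have rC : \rank (Cmx^T) = 3.
  apply/eqP; rewrite mxrank_tr eqn_leq rank_leq_row /=.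
  by have := mxrankM_maxl Cmx kap; rewrite (mxrank_unit uCk).
have rK : \rank (kermx (Cmx^T)) = d by rewrite mxrank_ker rC addKn.
have [Bt [fB sB]] : exists Bt : 'M[F]_(d, 3 + d), row_free Bt /\ (Bt <= kermx (Cmx^T))%MS.
  have := row_base_free (kermx Cmx^T); have := eq_row_base (kermx Cmx^T).
  move: (row_base _); rewrite rK => Bt e fB; exists Bt; split=> //.
  by rewrite e.
exists Bt^T; have CB : Cmx *m Bt^T = 0.
  by apply: trmx_inj; rewrite trmx_mul trmxK trmx0; apply/sub_kermxP.
split=> //; apply: unitmx_inj => y; rewrite -[y]vsubmxK mul_row_col => e.
have h0 : usubmx y = 0.
  by apply: Cmx_kap; have := congr1 (mulmx Cmx) e; rewrite mulmxDr !mulmxA CB mul0mx addr0 mulmx0 -mulmxA.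
have z0 : dsubmx y = 0.
  move: e; rewrite h0 mulmx0 add0r => /(congr1 trmx); rewrite trmx_mul trmxK trmx0 => e.
  by apply: trmx_inj; rewrite trmx0; apply: (row_free_inj fB); rewrite e mul0mx.
by rewrite h0 z0 col_mx0.
Qed.

Section Basis.
Context (B : 'M[F]_(3 + d, d)) (CB : Cmx *m B = 0) (uB : row_mx kap B \in unitmx).

Let factor k (M : 'M[F]_(3 + d, k)) : Cmx *m M = 0 -> exists r, M = B *m r.
Proof.
move=> CM; set y := invmx (row_mx kap B) *m M.
have e : M = kap *m usubmx y + B *m dsubmx y.
  by rewrite -mul_row_col vsubmxK mulKVmx.
have u0 : usubmx y = 0.
  have CkU : Cmx *m (kap *m usubmx y) = 0.
    by have := CM; rewrite e mulmxDr [Cmx *m (B *m _)]mulmxA CB mul0mx addr0.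
  apply/matrixP => t j; rewrite [RHS]mxE.
  have : col j (usubmx y) = 0.
    by apply: Cmx_kap; rewrite colE !mulmxA -[Cmx *m _ *m _]mulmxA CkU mul0mx.
  by move=> /matrixP/(_ t 0); rewrite !mxE.
by exists (dsubmx y); rewrite {1}e u0 mulmx0 add0r.
Qed.

(** The symmetries preserve the tangent space and are unitary, so they preserve
    the orthogonal complement. *)
Let Cmx_symm g s c v w : symm X g s c ->
  (forall i, w (s i) 0 = sfactor g c i * v i 0) -> Cmx *m v = 0 -> Cmx *m w = 0.
Proof.
move=> sX hw Cv; have [ug h] := sX.
have d0 : \det g != 0 by move: ug; rewrite unitmxE unitfE.
have cd0 : cj (\det g) != 0 by rewrite fmorph_eq0.
pose G (t u : 'I_3) : F :=
  if t == 0 then (if u == 0 then g 0 0 ^+ 2 else if u == 1 then 2 * (g 0 0 * g 0 1) else g 0 1 ^+ 2)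
  else if t == 1 then (if u == 0 then g 0 0 * g 1 0
     else if u == 1 then g 0 0 * g 1 1 + g 0 1 * g 1 0 else g 0 1 * g 1 1)
  else (if u == 0 then g 1 0 ^+ 2 else if u == 1 then 2 * (g 1 0 * g 1 1) else g 1 1 ^+ 2).
have qG t i : qmon X (s i) t = c i ^+ 2 * \sum_u G t u * qmon X i u.
  by rewrite sum3 !mxE !h !mul2E; case: (ord3 t) => -> /=; rewrite /G /=; ring.
have kG t i : kap (s i) t = c i ^+ 2 * \sum_u G t u * kap i u.
  rewrite mxE qG (nopp_symm _ gX sX) -mulrA mulr_suml; congr (_ * _).
  by apply: eq_bigr => u _; rewrite [kap _ _]mxE mulrA.
have wS i : weight X (s i) * sfactor g c i * cj (c i ^+ 2) * cj (\det g) = weight X i.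
  by rewrite -(weight_symm i gX sX) -cjK /sfactor rmorphM/=; ring.
apply/matrixP => t k; rewrite ord1 [RHS]mxE; apply: (mulfI cd0); rewrite mulr0 CmxE.
rewrite (reindex_inj (@perm_inj _ s))/= mulr_sumr.
transitivity (\sum_u cj (G t u) * (Cmx *m v) u 0); last first.
  by rewrite Cv; apply: big1 => u _; rewrite mxE mulr0.
under [RHS]eq_bigr do rewrite CmxE mulr_sumr.
rewrite [RHS]exchange_big/=; apply: eq_bigr => i _.
rewrite hw kG rmorphM/= -[in RHS](wS i).
have -> : cj (\sum_u G t u * kap i u) = \sum_u cj (G t u) * cj (kap i u).
  by rewrite rmorph_sum; apply: eq_bigr => u _; rewrite rmorphM.
rewrite !sum3; ring.
Qed.

Let B_inj z z' : B *m z = B *m z' -> z = z'.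
Proof.
move=> e; have h : row_mx kap B *m (col_mx 0 z) = row_mx kap B *m (col_mx 0 z').
  by rewrite !mul_row_col !mulmx0 e.
have := congr1 (mulmx (invmx (row_mx kap B))) h; rewrite !mulKmx// => /eq_col_mx[_].
by [].
Qed.

(** The linear maps induced on the slice by the symmetries with a given
    permutation. *)
Let Rs s : set 'M[F]_d := [set r | exists g c, symm X g s c /\
  forall z i, (B *m (r *m z)) (s i) 0 = sfactor g c i * (B *m z) i 0].

Let Rs_ex g s c : symm X g s c -> exists r, 
  forall z i, (B *m (r *m z)) (s i) 0 = sfactor g c i * (B *m z) i 0.
Proof.
move=> sX; pose M : 'M[F]_(3 + d, d) :=
  \matrix_(j, l) (sfactor g c (s^-1%g j) * B (s^-1%g j) l).
have [r hr] : exists r, M = B *m r.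
  apply: factor; apply/matrixP => t l; rewrite [RHS]mxE.
  have : Cmx *m col l M = 0.
    apply: (@Cmx_symm g s c (col l B)) => //.
      by move=> i; rewrite !mxE permK.
    by rewrite !colE mulmxA CB mul0mx.
  by move=> /matrixP/(_ t 0); rewrite colE mulmxA -colE !mxE.
exists r => z i; rewrite mulmxA -hr !mxE mulr_sumr; apply: eq_bigr => l _.
by rewrite mxE permK mulrA.
Qed.

Let sfactor_unique g s c g' c' i : symm X g s c -> symm X g' s c' -> sfactor g c i = sfactor g' c' i.
Proof.
move=> sX sX'; have [ug h] := sX; have [ug' h'] := sX'.
have rg (g0 : 'M[F]_2) c0 : symm X g0 s c0 -> rel_by g0 s X X.
  by move=> [_ h0] l; rewrite /wdg !h0; ring.
have [a ea] := rel_by_unique ug tX gX gX (rg _ _ sX') (rg _ _ sX).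
have cc : c i = c' i * a.
  have gXi : nzc (g *m X) i by rewrite nzc_mul//; exact: gX.
  have e r : c i * (g *m X) r i = c' i * a * (g *m X) r i.
    by rewrite -h h' ea -mulrA -scalemxAl; congr (_ * _); rewrite mxE.
  by case/orP: gXi => /mulIf; apply; exact: e.
by rewrite /sfactor cc ea detZ; ring.
Qed.

Let Rs_unique s r r' : Rs s r -> Rs s r' -> r = r'.
Proof.
move=> [g [c [sX h]]] [g' [c' [sX' h']]].
suff e z : r *m z = r' *m z.
  apply/matrixP => i j; have := e (delta_mx j 0).
  by rewrite -!colE => /matrixP/(_ i 0); rewrite !mxE.
apply: B_inj; apply/matrixP => j k; rewrite ord1 -(permKV s j) h h'.
by rewrite (sfactor_unique _ sX sX').
Qed.

Let Rs1 : Rs 1%g 1%:M.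
Proof.
exists 1%:M, (fun=> 1); split; first exact: symm1.
by move=> z i; rewrite perm1 mul1mx /sfactor det1 expr1n !mul1r.
Qed.

Let RsM s s' r r' : Rs s r -> Rs s' r' -> Rs (s * s')%g (r' *m r).
Proof.
move=> [g [c [sX h]]] [g' [c' [sX' h']]].
exists (g' *m g), (fun i => c' (s i) * c i); split; first exact: symmM.
by move=> z i; rewrite permM -mulmxA h' h /sfactor det_mulmx; ring.
Qed.

Let RsV s r : Rs s r -> exists2 r', Rs s^-1%g r' & r *m r' = 1%:M.
Proof.
move=> Rr; have [g [c [sX h]]] := Rr.
have sV := symmV gX sX; have [r' hr'] := Rs_ex sV.
have Rr' : Rs s^-1%g r' by exists (invmx g), (fun i => (c (s^-1%g i))^-1).
exists r' => //; apply: (@Rs_unique 1%g); last exact: Rs1.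
by rewrite -(mulVg s); exact: RsM.
Qed.

Let Z z : 'M[F]_(2, 3 + d) := nearby X (B *m z).

Let Rs_rel s r : Rs s r -> exists2 A, A \in unitmx & forall z, rel_by A s (Z z) (Z (r *m z)).
Proof.
move=> [g [c [sX h]]]; exists g; first by have [] := sX.
by move=> z; exact: (symm_rel_nearby gX sX (h z)).
Qed.

(** The linearization, at two nearby points, of the equation saying that a
    projectivity relates two tuples of the slice. *)
Let TT v w : 'M[F]_(3 + d) := row_mx
  (\matrix_(i, t) wdg (nearby X w) i (gen (delta_mx t 0) *m nearby X v) i)
  (\matrix_(i, l) (- (nopp X i * B i l))).

Let wdg_gen_lin m (Y Y' : 'M[F]_(2, m)) (h : 'cV[F]_3) i :
  wdg Y' i (gen h *m Y) i = \sum_t wdg Y' i (gen (delta_mx t 0) *m Y) i * h t 0.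
Proof. by rewrite sum3 /wdg !mul2E !mxE /=; ring. Qed.

Let TTE v w h z i : (TT v w *m col_mx h z) i 0 =
  wdg (nearby X w) i (gen h *m nearby X v) i - nopp X i * (B *m z) i 0.
Proof.
rewrite mul_row_col mxE; congr (_ + _).
  by rewrite mxE wdg_gen_lin; apply: eq_bigr => t _; rewrite mxE.
rewrite !mxE mulr_sumr -sumrN; apply: eq_bigr => l _.
by rewrite mxE mulrA mulNr.
Qed.

Let TT_unit0 : TT 0 0 \in unitmx.
Proof.
apply: unitmx_inj => y; rewrite -[y]vsubmxK => e.
have : row_mx kap B *m col_mx (usubmx y) (- dsubmx y) = 0.
  apply/matrixP => i k; rewrite ord1 mul_row_col mulmxN [RHS]mxE.
  have := congr1 (fun M : 'cV[F]_(3 + d) => M i 0) e; rewrite /= TTE nearby0 wdg_gen [RHS]mxE => e'.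
  rewrite colB kapE; apply: (mulfI (nopp_neq0 i tX gX)).
  rewrite mulr0 -[RHS]e' mulrBr; congr (_ - _).
  by rewrite mulrC divfK ?nopp_neq0.
move=> /(congr1 (mulmx (invmx (row_mx kap B)))); rewrite mulKmx// mulmx0 => /matrixP h.
apply/matrixP => i k; case: (split_ordP i) => j ->; rewrite ?col_mxEu ?col_mxEd [RHS]mxE.
  by have := h (lshift d j) k; rewrite col_mxEu [RHS]mxE.
have := h (rshift 3 j) k; rewrite col_mxEd [RHS]mxE [LHS]mxE => /eqP.
by rewrite oppr_eq0 => /eqP.
Qed.

Let cont_TT : continuous (fun t : 'cV[F]_(3 + d) * 'cV[F]_(3 + d) => TT t.1 t.2).
Proof.
apply: cont_mx => i j; case: (split_ordP j) => l ->.
  rewrite (_ : (fun t => _) = fun t : 'cV[F]_(3 + d) * 'cV[F]_(3 + d) =>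
      wdg (nearby X t.2) i (gen (delta_mx l 0) *m nearby X t.1) i); last first.
    by apply/funext => t; rewrite row_mxEl mxE.
  apply: cont_wdg; first by apply: cont_nearby; exact: cont_snd.
  by apply: cont_mulmx; [exact: cst_continuous|apply: cont_nearby; exact: cont_fst].
rewrite (_ : (fun t => _) = fun=> - (nopp X i * B i l)); first exact: contC.
by apply/funext => t; rewrite row_mxEr mxE.
Qed.

(** A matrix [a%:M + gen h] relating the two tuples point by point gives the
    solution [h], [a *: (z' - z)] of a linear system with matrix [TT]. *)
Let slice_unique A z z' : TT (B *m z) (B *m z') \in unitmx -> A != 0 ->
  rel_by A 1%g (Z z) (Z z') -> z = z'.
Proof.
move=> uT A0 hA; have [h eA] := gen_decomp A; set a := A 1 1 in eA.
have T0 : TT (B *m z) (B *m z') *m col_mx h (a *: (z' - z)) = 0.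
  apply/matrixP => i k; rewrite ord1 TTE [RHS]mxE.
  have := hA i; rewrite perm1 wdgC => /eqP; rewrite oppr_eq0 => /eqP <-.
  rewrite {1}eA mulmxDl mul_scalar_mx.
  have -> : wdg (Z z') i (a *: Z z + gen h *m Z z) i =
      a * wdg (Z z') i (Z z) i + wdg (Z z') i (gen h *m Z z) i.
    exact: wdgDZ.
  rewrite wdg_nearby -scalemxAr mulmxBr colZ !colB.
  by rewrite -/(Z z) -/(Z z'); ring.
have := congr1 (mulmx (invmx (TT (B *m z) (B *m z')))) T0; rewrite mulKmx// mulmx0.
rewrite -[RHS]col_mx0 => /eq_col_mx[h0 /eqP]; rewrite scaler_eq0 subr_eq0.
case/orP => [/eqP a0|/eqP //]; exfalso; move/negP: A0; apply; apply/eqP.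
rewrite eA a0 h0; apply/matrixP => r c.
by case: (ord2 r) (ord2 c) => -> [] ->; rewrite !mxE /= ?oppr0 ?mul0rn ?addr0.
Qed.

Let nearP s v w : Prop := forall A z z', v = B *m z -> w = B *m z' -> A != 0 ->
  rel_by A s (nearby X v) (nearby X w) -> exists2 r, Rs s r & z' = r *m z.

Let cont_nearby2 : continuous (fun t : 'cV[F]_(3 + d) * 'cV[F]_(3 + d) => (nearby X t.1, nearby X t.2)).
Proof.
apply: cont_pair.
  by apply: cont_nearby; exact: cont_fst.
by apply: cont_nearby; exact: cont_snd.
Qed.

(** A relation between tuples near [X] comes from a relation of [X] with itself,
    by compactness; composed with the corresponding symmetry, it relates the
    tuples point by point, and [slice_unique] applies. *)
Let near_slice s : nbhs ((0, 0) : 'cV[F]_(3 + d) * 'cV[F]_(3 + d)) [set t | nearP s t.1 t.2].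
Proof.
have [[A [A0 hA]]|no] := pselect (exists A, A != 0 /\ rel_by A s X X); last first.
  have nu := @near_unrelated _ lf _ s X X (fun A nA hA => no (ex_intro _ A (conj nA hA))).
  have nn : nbhs ((0, 0) : 'cV[F]_(3 + d) * 'cV[F]_(3 + d))
      [set t | forall A, A != 0 -> ~ rel_by A s (nearby X t.1) (nearby X t.2)].
    apply: (@cont_nearby2 (0, 0) [set t | forall A, A != 0 -> ~ rel_by A s t.1 t.2]).
    by rewrite /= !nearby0.
  apply: filterS nn => t /= h A z z' _ _ A0 hA.
  by case: (h A A0 hA).
have uA := stable_rel_unit stX stX A0 hA.
have [c sX] := rel_by_symm gX uA hA.
have f0 i := sfactor_neq0 i gX sX.
pose pull w : 'cV[F]_(3 + d) := \col_i (w (s i) 0 / sfactor A c i).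
have cpull : continuous (fun t : 'cV[F]_(3 + d) * 'cV[F]_(3 + d) => (t.1, pull t.2)).
  apply: cont_pair; first exact: cont_fst.
  apply: cont_mx => i j; rewrite (_ : (fun t => _) = fun t : 'cV[F]_(3 + d) * 'cV[F]_(3 + d) =>
    t.2 (s i) 0 * (sfactor A c i)^-1); last by apply/funext => u; rewrite mxE.
  by apply: contM; [apply: cont_entry; exact: cont_snd|exact: contC].
have pull0 : pull 0 = 0 by apply/matrixP => i j; rewrite !mxE mul0r.
have n1 : nbhs ((0, 0) : 'cV[F]_(3 + d) * 'cV[F]_(3 + d)) [set t | TT t.1 (pull t.2) \in unitmx].
  have oT : open [set t : 'cV[F]_(3 + d) * 'cV[F]_(3 + d) | \det (TT t.1 (pull t.2)) != 0].
    by apply: open_neq0; apply: cont_det; exact: (cont_comp cpull cont_TT).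
  rewrite (_ : [set t | _] = [set t | \det (TT t.1 (pull t.2)) != 0]); last first.
    by apply/funext => t; rewrite /= unitmxE unitfE.
  apply: open_nbhs_nbhs; split=> //=.
  by rewrite pull0 -unitfE -unitmxE; exact: TT_unit0.
have n2 : nbhs ((0, 0) : 'cV[F]_(3 + d) * 'cV[F]_(3 + d)) [set t | good (nearby X t.2)].
  have cn : continuous (fun t : 'cV[F]_(3 + d) * 'cV[F]_(3 + d) => nearby X t.2).
    by apply: cont_nearby; exact: cont_snd.
  apply: cn; apply: open_nbhs_nbhs; split; first exact: open_good.
  by rewrite /= nearby0.
apply: filterS (filterI n1 n2) => -[v w] /= [uT gw] A' z z' ev ew A'0 hA'.
have [r hr] := Rs_ex sX; have Rr : Rs s r by exists A, c.
have [r' Rr' rr'] := RsV Rr.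
have e : pull w = B *m (r' *m z').
  apply/matrixP => i j; rewrite ord1 mxE ew.
  have ez : z' = r *m (r' *m z') by rewrite mulmxA rr' mul1mx.
  by rewrite [in LHS]ez hr mulrC mulKf.
have zz : z = r' *m z'.
  have hpull : rel_by A s (nearby X (pull w)) (nearby X w).
    by apply: (symm_rel_nearby gX sX) => i; rewrite mxE mulrC divfK.
  have := rel_byM gw hA' (rel_byV uA hpull); rewrite mulgV ev e.
  apply: slice_unique; first by rewrite -ev -e.
  by apply: contra_neq A'0 => /(congr1 (mulmx A)); rewrite mulKVmx// mulmx0.
by exists r => //; rewrite zz mulmxA rr' mul1mx.
Qed.

(** For an unknown projectivity [1%:M + gen h] and an unknown displacement in
    the slice, the condition of being related is an equation to which
    [analytic_implicit] applies, with linear part [TT]. *)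
Let slice_implicit (w : 'cV[F]_d) p (w1 : 'cV[F]_p) (eta : 'I_p -> 'M[F]_(2, 3 + d)) :
  TT (B *m w) (B *m w) \in unitmx ->
  exists f : 'cV[F]_p -> 'cV[F]_d,
    [/\ forall i, analytic_at (fun u => f u i 0) w1, f w1 = w, f u @[u --> w1] --> f w1 &
        \forall u \near w1, exists2 A, A \in unitmx &
          rel_by A 1%g (Z w + \sum_t (u - w1) t 0 *: eta t) (Z (f u))].
Proof.
move=> uT; set N := Z w; pose O := opp X.
pose G k := gen (usubmx (delta_mx k 0 : 'cV[F]_(3 + d))).
pose b k i := (B *m dsubmx (delta_mx k 0 : 'cV[F]_(3 + d))) i 0.
have hG y : gen (usubmx y) = \sum_k y k 0 *: G k.
  apply: (linear_col (phi := fun y => gen (usubmx y))) => a u v.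
  by apply/matrixP => r c; case: (ord2 r) (ord2 c) => -> [] ->; rewrite !mxE /=; ring.
have hb (y : 'cV[F]_(3 + d)) i : (B *m dsubmx y) i 0 = \sum_k y k 0 * b k i.
  have -> : B *m dsubmx y = \sum_k y k 0 *: (B *m dsubmx (delta_mx k 0 : 'cV[F]_(3 + d))).
    apply: (linear_col (phi := fun y : 'cV[F]_(3 + d) => B *m dsubmx y)) => a u v.
    by rewrite linearP/= mulmxDr -scalemxAr.
  by rewrite summxE; apply: eq_bigr => k _; rewrite colZ.
have [y [ya y0 ys ye]] := analytic_implicit lf w1
  (fun t => \col_i wdg N i (eta t) i)
  (fun t k => \col_i (wdg N i (G k *m eta t) i + b k i * wdg O i (eta t) i))
  (fun k k' => \col_i (b k i * wdg O i (G k' *m N) i))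
  (fun t k k' => \col_i (b k i * wdg O i (G k' *m eta t) i)) uT.
have cy : y u @[u --> w1] --> y w1.
  apply: near_mx => e e0; apply: filterS (ys e e0) => u h i j.
  by rewrite ord1 y0 subr0; exact: h.
exists (fun u => w + dsubmx (y u)); split.
- move=> i; have := analytic_addc (w i 0) (ya (rshift 3 i)).
  by congr (analytic_at _ w1); apply/funext => u; rewrite !mxE.
- by rewrite y0 [dsubmx _]linear0 addr0.
- apply: near_mx => e e0; apply: filterS (ys e e0) => u h i j.
  by rewrite ord1 y0 [dsubmx 0]linear0 addr0 addrC addKr mxE; exact: h.
have near_unit : \forall u \near w1, 1%:M + gen (usubmx (y u)) \in unitmx.
  have oU : open [set x : 'cV[F]_(3 + d) | \det (1%:M + \sum_k x k 0 *: G k) != 0].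
    apply: open_neq0; apply: cont_det; apply: cont_mx => r c.
    rewrite (_ : (fun x => _) = fun x : 'cV[F]_(3 + d) =>
      (1%:M : 'M[F]_2) r c + \sum_k x k 0 * G k r c); last first.
      by apply/funext => x; rewrite mxE summxE; congr (_ + _); apply: eq_bigr => k _; rewrite mxE.
    apply: contD; first exact: contC.
    apply: cont_sum => k; apply: contM; last exact: contC.
    by apply: cont_entry => x.
  have nU : nbhs (y w1) [set x : 'cV[F]_(3 + d) | \det (1%:M + \sum_k x k 0 *: G k) != 0].
    apply: open_nbhs_nbhs; split=> //=; rewrite y0 big1 ?addr0 ?det1 ?oner_neq0// => k _.
    by rewrite mxE scale0r.
  have nU' : \forall u \near w1, \det (1%:M + \sum_k y u k 0 *: G k) != 0 by exact: cy nU.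
  by apply: filterS nU' => u; rewrite -hG -unitfE -unitmxE.
apply: filterS (filterI near_unit ye) => u [uA eu].
exists (1%:M + gen (usubmx (y u))) => // i; rewrite perm1.
set D := \sum_t _; set H := gen _; pose bz := (B *m dsubmx (y u)) i 0.
have hD (Y : 'M[F]_(2, 3 + d)) (M : 'M[F]_2) :
    wdg Y i (M *m D) i = \sum_t (u - w1) t 0 * wdg Y i (M *m eta t) i.
  by rewrite mulmx_sumr -wdg_sum; congr wdg; apply: eq_bigr => t _; rewrite scalemxAr.
have hD1 (Y : 'M[F]_(2, 3 + d)) : wdg Y i D i = \sum_t (u - w1) t 0 * wdg Y i (eta t) i.
  exact: wdg_sum.
have hH (Y : 'M[F]_(2, 3 + d)) (M : 'M[F]_(2, 3 + d)) :
    wdg Y i (H *m M) i = \sum_k y u k 0 * wdg Y i (G k *m M) i.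
  by rewrite /H hG mulmx_suml -wdg_sum; congr wdg; apply: eq_bigr => t _; rewrite scalemxAl.
have near_wdg (M : 'M[F]_(2, 3 + d)) :
    wdg (Z (w + dsubmx (y u))) i M i = wdg N i M i + bz * wdg O i M i.
  by rewrite /wdg /N /Z mulmxDr ![nearby _ _ _ _]mxE colD -/bz; ring.
have ON : wdg O i N i = - nopp X i.
  by rewrite wdgC -wdg_opp /wdg /N /Z ![nearby _ _ _ _]mxE; ring.
rewrite wdgC near_wdg mulmxDl mul1mx mulmxDr.
have addw (Y : 'M[F]_(2, 3 + d)) (M M' : 'M[F]_(2, 3 + d)) : wdg Y i (M + M') i = wdg Y i M i + wdg Y i M' i.
  by rewrite /wdg !mxE; ring.
rewrite !addw wdgxx ON.
have s1 : (\sum_t (u - w1) t 0 *: \col_i wdg N i (eta t) i) i 0 = wdg N i D i.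
  by rewrite hD1 summxE; apply: eq_bigr => t _; rewrite colZ [X in _ * X]mxE.
have s2 : (\sum_k y u k 0 *: \sum_t (u - w1) t 0 *:
    (\col_i (wdg N i (G k *m eta t) i + b k i * wdg O i (eta t) i))) i 0 =
    wdg N i (H *m D) i + bz * wdg O i D i.
  rewrite hH summxE /bz hb mulr_suml -big_split; apply: eq_bigr => k _ /=.
  rewrite colZ hD hD1 -mulrA -mulrDr; congr (_ * _).
  rewrite summxE mulr_sumr -big_split; apply: eq_bigr => t _ /=.
  by rewrite colZ [X in _ * X = _]mxE; ring.
have s3 : (\sum_k \sum_k' (y u k 0 * y u k' 0) *: (\col_i (b k i * wdg O i (G k' *m N) i) +
    \sum_t (u - w1) t 0 *: \col_i (b k i * wdg O i (G k' *m eta t) i))) i 0 =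
    bz * (wdg O i (H *m N) i + wdg O i (H *m D) i).
  rewrite summxE !hH -big_split /bz hb mulr_suml; apply: eq_bigr => k _ /=.
  rewrite summxE mulr_sumr; apply: eq_bigr => k' _ /=.
  rewrite colZ colD mxE summxE hD.
  transitivity (y u k 0 * y u k' 0 * (b k i * wdg O i (G k' *m N) i +
    \sum_t b k i * ((u - w1) t 0 * wdg O i (G k' *m eta t) i))).
    by congr (_ * (_ + _)); apply: eq_bigr => t _; rewrite colZ [X in _ * X = _]mxE mulrCA.
  by rewrite -mulr_sumr; ring.
have := congr1 (fun M : 'cV[F]_(3 + d) => M i 0) eu; rewrite [RHS]mxE !colD s1 s2 s3.
rewrite -{1}[y u]vsubmxK TTE -/N -/H -/bz => e.
by apply/eqP; rewrite oppr_eq0; apply/eqP; rewrite -[RHS]e; ring.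
Qed.

Let good_nbhd : exists V : set 'cV[F]_(3 + d), [/\ open V, V 0,
  forall s v w, V v -> V w -> nearP s v w, forall v, V v -> stable (nearby X v) &
  forall v, V v -> TT v v \in unitmx].
Proof.
have : nbhs ((0, 0) : 'cV[F]_(3 + d) * 'cV[F]_(3 + d)) [set t | forall s, nearP s t.1 t.2].
  exact: (@filter_forall _ _ (fun (s : {perm 'I_(3 + d)}) t => nearP s t.1 t.2)
    (nbhs ((0, 0) : 'cV[F]_(3 + d) * 'cV[F]_(3 + d))) _ near_slice).
move=> [[U V] /= [UX VY] UV].
have cid : continuous (fun v : 'cV[F]_(3 + d) => v) by move=> v.
have nS : nbhs (0 : 'cV[F]_(3 + d)) [set v | stable (nearby X v)].
  have cn : continuous (fun v : 'cV[F]_(3 + d) => nearby X v) by apply: cont_nearby.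
  apply: (cn 0 [set Y | stable Y]); rewrite nearby0.
  by apply: open_nbhs_nbhs; split; [exact: (open_stable lf)|].
have oT : open [set v : 'cV[F]_(3 + d) | \det (TT v v) != 0].
  by apply: open_neq0; apply: cont_det; exact: (cont_comp (cont_pair cid cid) cont_TT).
have nT : nbhs (0 : 'cV[F]_(3 + d)) [set v | \det (TT v v) != 0].
  by apply: open_nbhs_nbhs; split=> //=; rewrite -unitfE -unitmxE.
have Q0 := filterI (filterI UX VY) (filterI nS nT); move: Q0; set Q' := _ `&` _ => Q0.
pose Q := Q'^°; have sQ : Q `<=` Q' by exact: interior_subset.
exists Q; split; first exact: open_interior.
- exact: Q0.
- by move=> s v w Qv Qw; apply: (UV (v, w)); split=> /=; [have [[]] := sQ v Qv|have [[]] := sQ w Qw].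
- by move=> v Qv; have [_ []] := sQ v Qv.
by move=> v Qv; have [_ [_]] := sQ v Qv; rewrite unitmxE unitfE.
Qed.

Lemma slice_of_basis : exists S : slice F d, slice_tuple S 0 = X.
Proof.
have [V [oV V0 VP VS VT]] := good_nbhd.
(* the intersection over the symmetries makes the domain invariant *)
pose W : set 'cV[F]_d := [set z | forall s r, Rs s r -> V (B *m (r *m z))].
have WV z : W z -> V (B *m z) by move=> /(_ _ _ Rs1); rewrite mul1mx.
have oW : open W.
  rewrite (_ : W = ~` [set z | exists s, ~ forall r, Rs s r -> V (B *m (r *m z))]); last first.
    apply/seteqP; split=> z /= h; first by case=> s; apply; exact: h.
    by move=> s; apply: contrapT => ns; apply: h; exists s.
  apply: closed_openC; apply: closed_bigU_fin => s; rewrite -openC.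
  have [[r Rr]|no] := pselect (exists r, Rs s r); last first.
    rewrite (_ : ~` _ = setT); first exact: openT.
    by apply/seteqP; split=> z //= _; apply => r Rr; case: no; exists r.
  rewrite (_ : ~` _ = (fun z => B *m (r *m z)) @^-1` V).
    apply: open_comp => // z _; move: z; apply: cont_mulmx; first exact: cst_continuous.
    by apply: cont_mulmx; [exact: cst_continuous|move=> z].
  apply/seteqP; split=> z /=; first by move=> /contrapT; exact.
  by move=> h; apply => r' Rr'; rewrite (Rs_unique Rr' Rr).
unshelve eexists.
  apply: (@Slice F d Z (fun t => \matrix_(r, i) (B i t * opp X r i)) W Rs) => //.
  - move=> v w; apply/matrixP => r i; rewrite [RHS]mxE summxE.
    have -> : \sum_t ((v - w) t 0 *: (\matrix_(r, i) (B i t * opp X r i) : 'M[F]_(2, 3 + d))) r i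
       = (B *m (v - w)) i 0 * opp X r i.
      rewrite mxE big_distrl; apply: eq_bigr => t _ /=.
      by rewrite mxE [X in _ * X]mxE; ring.
    by rewrite mulmxBr colB /Z ![nearby _ _ _ _]mxE; ring.
  - by move=> s r Rr; rewrite !mulmx0.
  - by move=> s r z Rr Wz s' r' Rr'; rewrite (mulmxA r'); exact: (Wz _ _ (RsM Rr Rr')).
  - by move=> z /WV; exact: VS.
  - move=> s A z z' /WV Vz /WV Vz' uA; apply: (VP s _ _ Vz Vz' A z z' erefl erefl).
    by apply: contraTneq uA => ->; rewrite unitmxE det0 unitr0.
  - by move=> z p w eta /WV Vz; apply: slice_implicit; exact: VT.
by rewrite /= /Z mulmx0 nearby0.
Qed.

End Basis.

Lemma slice_through : exists S : slice F d, slice_tuple S 0 = X.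
Proof. by have [B [CB uB]] := slice_basis; exact: slice_of_basis CB uB. Qed.

End Slice.

Lemma slice_exists (F : numFieldType) (lf : local_field F) d (X : 'M[F]_(2, 3 + d)) :
  stable X -> exists S : slice F d, slice_tuple S 0 = X.
Proof. by move=> stX; have [cj cjK] := lf_conj lf; exact: (@slice_through F lf d cj cjK X stX). Qed.

Section SliceTheory.
Context {F : numFieldType} {d : nat}.
Implicit Types (X Y : 'M[F]_(2, 3 + d)) (s : {perm 'I_(3 + d)}) (v w z : 'cV[F]_d) (r : 'M[F]_d).

Definition equiv_by s X Y := exists2 A, A \in unitmx & rel_by A s X Y.

Lemma equiv_byV s X Y : equiv_by s X Y -> equiv_by s^-1%g Y X.
Proof.
by move=> [A uA h]; exists (invmx A); [rewrite unitmx_inv|exact: rel_byV].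
Qed.

Lemma equiv_byM s s' X Y X' : good Y -> equiv_by s X Y -> equiv_by s' Y X' ->
  equiv_by (s * s')%g X X'.
Proof.
move=> gY [A uA h] [A' uA' h']; exists (A' *m A); first by rewrite unitmx_mul uA'.
exact: rel_byM h'.
Qed.

Lemma equiv_by_tequiv X Y : tequiv X Y <-> exists s, equiv_by s X Y.
Proof.
split; first by move=> [A uA [s h]]; exists s, A.
by move=> [s [A uA h]]; exists A => //; exists s.
Qed.

Context (S : slice F d).
Local Notation Z := (slice_tuple S).
Local Notation W := (slice_dom S).

Lemma slice_good z : W z -> good (Z z).
Proof. by move=> /slice_stable[[]]. Qed.

Lemma slice_equiv_by s z z' : W z -> W z' -> equiv_by s (Z z) (Z z') ->
  exists2 r, slice_sym S s r & z' = r *m z.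
Proof. by move=> Wz Wz' [A uA h]; exact: slice_rel_sym uA h. Qed.

Lemma slice_inj z z' : W z -> W z' -> equiv_by 1%g (Z z) (Z z') -> z = z'.
Proof.
move=> Wz Wz' /(slice_equiv_by Wz Wz')[r hr ->].
by rewrite (slice_sym_unique hr (slice_sym1 S)) mul1mx.
Qed.

Lemma slice_sym_equiv s r z : slice_sym S s r -> equiv_by s (Z z) (Z (r *m z)).
Proof. by move=> /slice_sym_rel[A uA h]; exists A. Qed.

Lemma cont_slice : continuous Z.
Proof.
rewrite (_ : slice_tuple S = fun v => Z 0 + \sum_t (v - 0) t 0 *: slice_dir S t); last first.
  by apply/funext => v; exact: slice_affine.
apply: cont_mx => i j.
rewrite (_ : (fun v => _) = fun v : 'cV[F]_d => Z 0 i j + \sum_t v t 0 * slice_dir S t i j).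
  apply: contD; first exact: contC.
  by apply: cont_sum => t; apply: contM; [apply: cont_entry => v|exact: contC].
by apply/funext => v; rewrite mxE summxE; congr (_ + _); apply: eq_bigr => t _; rewrite mxE subr0.
Qed.

Definition slice_group : set 'M[F]_d := [set r | exists s, slice_sym S s r].

Lemma slice_group_linear : finite_linear_group slice_group.
Proof.
have inv r : slice_group r -> exists2 r', slice_group r' & r *m r' = 1%:M.
  by move=> [s /slice_symV[r' hr' e]]; exists r' => //; exists s^-1%g.
split.
- have -> : slice_group = \bigcup_(s in [set: {perm 'I_(3 + d)}]) slice_sym S s.
    by apply/seteqP; split=> r [s]; exists s.
  apply: bigcup_finite => [|s _]; first exact: finite_finset.
  have [[r hr]|no] := pselect (exists r, slice_sym S s r).
    by apply: sub_finite_set (finite_set1 r) => r' hr'; exact: (slice_sym_unique hr' hr).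
  by rewrite (_ : slice_sym S s = set0)//; apply/seteqP; split=> r // hr; apply: no; exists r.
- by move=> r /inv[r' _ /mulmx1_unit[]].
- by exists 1%g; exact: slice_sym1.
- by move=> g h [s hg] [s' hh]; exists (s' * s)%g; exact: slice_symM.
- move=> r /inv[r' hr' e]; have [ur _] := mulmx1_unit e.
  by rewrite (_ : invmx r = r')// -[r']mul1mx -(mulVmx ur) -mulmxA e mulmx1.
Qed.

Lemma near_slice_group (T : topologicalType) (t : T) (Q : 'M[F]_d -> T -> Prop) :
  (forall r, slice_group r -> \forall x \near t, Q r x) ->
  \forall x \near t, forall r, slice_group r -> Q r x.
Proof.
move=> h; suff : \forall x \near t, forall s, forall r, slice_sym S s r -> Q r x.
  by apply: filterS => x hx r [s]; exact: hx.
apply: (@filter_forall _ _ (fun s x => forall r, slice_sym S s r -> Q r x) (nbhs t) _) => s.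
have [[r hr]|no] := pselect (exists r, slice_sym S s r); last first.
  by apply: nearW => x r hr; case: no; exists r.
by apply: filterS (h r (ex_intro _ s hr)) => x hx r' hr'; rewrite (slice_sym_unique hr' hr).
Qed.

(** This is [slice_return] with all entries of the tuple as parameters. *)
Lemma slice_absorbs (P : set 'cV[F]_d) z : open P -> P z -> W z ->
  nbhs (Z z) [set X | exists2 z', P z' & equiv_by 1%g X (Z z')].
Proof.
move=> oP Pz Wz.
have [f [_ f0 cf hf]] := @slice_return _ _ S z _ (0 : 'cV[F]_(2 * (3 + d)))
  (fun t => vec_mx (delta_mx 0 t)) Wz.
have nP : \forall u \near (0 : 'cV[F]_(2 * (3 + d))), P (f u).
  by apply: cf; rewrite f0; exact: open_nbhs_nbhs.
have cm : continuous (fun X => (mxvec (X - Z z))^T).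
  apply: cont_mx => i j; case/mxvec_indexP: i => a b.
  rewrite (_ : (fun X => _) = fun X => X a b - Z z a b); last first.
    by apply/funext => X; rewrite mxE ord1 mxvecE !mxE.
  by apply: contB; [apply: cont_entry => X|exact: contC].
pose E (u : 'cV[F]_(2 * (3 + d))) : 'M[F]_(2, 3 + d) :=
  Z z + \sum_t (u - 0) t 0 *: vec_mx (delta_mx 0 t).
have nQ : nbhs (0 : 'cV[F]_(2 * (3 + d))) [set u | exists2 z', P z' & equiv_by 1%g (E u) (Z z')].
  by apply: filterS (filterI nP hf) => u [Pu hu]; exists (f u) => //; exact: hu.
have nn : nbhs (Z z) [set X | exists2 z', P z' & equiv_by 1%g (E (mxvec (X - Z z))^T) (Z z')].
  apply: (cm (Z z) [set u | exists2 z', P z' & equiv_by 1%g (E u) (Z z')]).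
  by rewrite subrr [mxvec 0]linear0 trmx0.
apply: filterS nn => X [z' Pz' h]; exists z' => //; move: h; congr (equiv_by _ _ _).
rewrite /E -[RHS](addrNK (Z z)) addrC; congr (_ + _).
rewrite -[RHS]mxvecK [in RHS](row_sum_delta (mxvec (X - Z z))) linear_sum /=.
by apply: eq_bigr => t _; rewrite subr0 linearZ /= mxE.
Qed.

End SliceTheory.

Section Transition.
Context {F : numFieldType} {d : nat} (S1 S2 : slice F d).
Local Notation Z1 := (slice_tuple S1).
Local Notation Z2 := (slice_tuple S2).
Local Notation W1 := (slice_dom S1).
Local Notation W2 := (slice_dom S2).

(** The projectivity moves the first slice to an affine family through a member
    of the second one, and [slice_return] brings this family to the second
    slice. *)
Lemma slice_transition s v v' : W1 v -> W2 v' -> equiv_by s (Z1 v) (Z2 v') ->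
  exists f : 'cV[F]_d -> 'cV[F]_d,
    [/\ forall i, analytic_at (fun u => f u i 0) v, f v = v', f u @[u --> v] --> f v &
        \forall u \near v, [/\ W1 u, W2 (f u) & equiv_by s (Z1 u) (Z2 (f u))]].
Proof.
move=> Wv Wv' [A uA hA]; have [c hc] := rel_by_good uA (slice_good Wv) hA.
have c0 i : c i != 0.
  apply/negP => /eqP ci; have := slice_good Wv' (s i).
  by rewrite /nzc !hc ci !mul0r eqxx.
have [f [fa fv cf hf]] := @slice_return _ _ S2 v' _ v (fun t => \matrix_(r, j)
  (c (s^-1%g j) * (A *m slice_dir S1 t) r (s^-1%g j))) Wv'.
exists f; split=> //.
have nW1 : \forall u \near v, W1 u by apply: open_nbhs_nbhs; split=> //; exact: slice_dom_open.
have nW2 : \forall u \near v, W2 (f u).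
  by apply: cf; rewrite fv; apply: open_nbhs_nbhs; split=> //; exact: slice_dom_open.
apply: filterS (filterI (filterI nW1 nW2) hf) => u [[W1u W2u]]; set Y := (Z2 v' + _) => hY.
split=> //; rewrite -(mulg1 s).
have eY i r : Y r (s i) = c i * (A *m Z1 u) r i.
  rewrite [Z1 u](slice_affine S1 u v) mulmxDr [RHS]mulrC [X in X * _]mxE mulrDl mulrC -hc.
  rewrite /Y mxE; congr (_ + _).
  rewrite mulmx_sumr !summxE mulr_suml; apply: eq_bigr => t _.
  by rewrite -scalemxAr mxE [X in _ * X]mxE permK [in RHS]mxE; ring.
have gY : good Y.
  move=> j; rewrite -(permKV s j); have := slice_good W1u (s^-1%g j).
  by rewrite -(nzc_mul _ _ uA) /nzc !eY !mulf_eq0 !(negPf (c0 _)).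
by apply: equiv_byM gY _ hY; exists A => // i; rewrite /wdg !eY; ring.
Qed.

End Transition.

(** * The orbifold atlas *)

Section Near.
Context {F : numFieldType} {d : nat}.
Implicit Types (v w : 'cV[F]_d) (r : 'M[F]_d).

Lemma near_fixed r w (Q : 'cV[F]_d -> Prop) : r *m w = w ->
  (\forall v \near w, Q v) -> \forall v \near w, Q (r *m v).
Proof.
move=> rw nQ; have cr : continuous (fun x : 'cV[F]_d => r *m x).
  by apply: cont_mulmx; [exact: cst_continuous|move=> x].
by apply: (cr w [set x | Q x]); rewrite rw.
Qed.

Lemma eq_mulmx_near r r' w : (\forall v \near w, r *m v = r' *m v) -> r = r'.
Proof.
move=> h; apply/matrixP => i j.
have cl : continuous (fun e : F => w + e *: (delta_mx j 0 : 'cV[F]_d)).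
  apply: cont_mx => k l.
  rewrite (_ : (fun e => _) = fun e : F => w k l + e * (delta_mx j 0 : 'cV[F]_d) k l).
    by apply: contD; [exact: contC|apply: contM; [move=> e|exact: contC]].
  by apply/funext => e; rewrite !mxE.
have ne : \forall e \near (0 : F), r *m (w + e *: delta_mx j 0) = r' *m (w + e *: delta_mx j 0).
  by apply: (cl 0 [set v | r *m v = r' *m v]); rewrite scale0r addr0.
have [e e0 he] := nbhs0_neq0 ne.
have hw := nbhs_singleton h; move: he; rewrite !mulmxDr hw => /addrI.
rewrite -!scalemxAr => /(scalerI e0); rewrite -!colE => /matrixP/(_ i 0).
by rewrite !mxE.
Qed.

Lemma slice_separates (S : slice F d) w : exists2 N : set 'cV[F]_d, nbhs w N &
  forall r v, slice_group S r -> N v -> N (r *m v) -> r *m w = w.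
Proof.
have /choice[U hU] : forall r, exists U : set 'cV[F]_d, nbhs w U /\
    forall v, U v -> U (r *m v) -> r *m w = w.
  move=> r; have [rw|nrw] := pselect (r *m w = w).
    by exists setT; split=> //; exact: filterT.
  have [i hi] : exists i, (r *m w) i 0 != w i 0.
    apply: contrapT => no; apply: nrw; apply/matrixP => i j; rewrite ord1.
    by apply: contrapT => /eqP h; apply: no; exists i.
  pose e := `|(r *m w) i 0 - w i 0|; have e0 : 0 < e by rewrite normr_gt0 subr_eq0.
  have cid : continuous (fun v : 'cV[F]_d => v) by move=> v.
  have cr : continuous (fun x : 'cV[F]_d => r *m x).
    by apply: cont_mulmx; [exact: cst_continuous|].
  exists ([set v : 'cV[F]_d | `|v i 0 - w i 0| < e / 2] `&`
    [set v : 'cV[F]_d | `|(r *m v) i 0 - (r *m w) i 0| < e / 2]).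
  split.
    apply: open_nbhs_nbhs; split; last by split=> /=; rewrite subrr normr0 divr_gt0.
    apply: openI; apply: open_norm_lt; apply: contB.
    - exact: cont_entry.
    - exact: contC.
    - exact: cont_entry.
    - exact: contC.
  move=> v [_ /= h1] [/= h2 _]; exfalso.
  have : e < e.
    rewrite {2}(splitr e); apply: le_lt_trans (ltrD h1 h2).
    have -> : e = `|((r *m v) i 0 - w i 0) - ((r *m v) i 0 - (r *m w) i 0)|.
      by rewrite /e; congr `|_|; ring.
    by rewrite [leRHS]addrC; exact: ler_normB.
  by rewrite ltxx.
exists [set v | forall r, slice_group S r -> U r v].
  have : \forall v \near w, forall r, slice_group S r -> U r v.
    apply: (near_slice_group (Q := fun r v => U r v)) => r _; have [nU _] := hU r.
    by apply: filterS nU.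
  by [].
by move=> r v Rr h h'; have [_] := hU r; apply; [exact: h|exact: h'].
Qed.

End Near.

Section SliceCharts.
Context {F : numFieldType} (lf : local_field F) {d : nat}.
Local Notation Y := (small_mult_locus F (3 + d) : Type).
Implicit Types (s : {perm 'I_(3 + d)}) (z : 'cV[F]_d).

Definition slice_chart (S : slice F d) (c : chart F d Y) : Prop :=
  [/\ chart_group c = slice_group S, chart_dom c = slice_dom S &
      forall z, slice_dom S z -> represents (slice_tuple S z) (set_val (chart_map c z))].

Lemma slice_chart_exists S : exists c, slice_chart S c.
Proof.
have ex z : slice_dom S z -> exists y : Y, represents (slice_tuple S z) (set_val y).
  move=> Wz; have stz := slice_stable Wz; have [x rx] := good3_represents stz.1.
  by exists (exist _ x (mem_set ((represents_small rx).2 stz))).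
have [y0 _] := ex 0 (slice_dom0 S).
have /choice[phi hphi] : forall z, exists y : Y,
    slice_dom S z -> represents (slice_tuple S z) (set_val y).
  move=> z; have [/ex[y hy]|nz] := pselect (slice_dom S z); first by exists y.
  by exists y0.
by exists (Chart (slice_group S) (slice_dom S) phi).
Qed.

Lemma slice_chart_eq S1 S2 c1 c2 z1 z2 : slice_chart S1 c1 -> slice_chart S2 c2 ->
  slice_dom S1 z1 -> slice_dom S2 z2 ->
  chart_map c1 z1 = chart_map c2 z2 <->
  exists s, equiv_by s (slice_tuple S1 z1) (slice_tuple S2 z2).
Proof.
move=> [_ _ h1] [_ _ h2] /h1 r1 /h2 r2; rewrite -equiv_by_tequiv -(represents_eq r1 r2).
by split=> [->//|e]; exact: val_inj.
Qed.

Lemma open_slice_chart S c (V : set Y) : slice_chart S c -> V `<=` chart_image c ->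
  open V <-> open (chart_dom c `&` chart_map c @^-1` V).
Proof.
move=> [eG eW hc] sV; split=> [[U oU eU]|oP].
  rewrite eW (_ : _ `&` _ = slice_dom S `&`
    slice_tuple S @^-1` [set X | exists2 x, U x & represents X x]); last first.
    apply/seteqP; split=> z [Wz /= h]; split=> //.
      exists (set_val (chart_map c z)); last exact: hc.
      by move: h; rewrite -eU.
    have [x Ux rx] := h; rewrite -eU /=.
    by rewrite (represents_fun (hc z Wz) rx).
  apply: openI; first exact: slice_dom_open.
  apply: open_comp; first by move=> z _; exact: cont_slice.
  by apply: (open_moduli lf U).1.
pose P := chart_dom c `&` chart_map c @^-1` V.
pose N := [set X | exists2 z, P z & equiv_by 1%g X (slice_tuple S z)].
exists [set x | exists2 X, N^° X & represents X x].
  by apply: (open_moduli_image lf); exact: open_interior.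
apply/seteqP; split=> y /=.
  move=> [X /interior_subset[z [Wz Vz] hz] rX].
  rewrite eW in Wz.
  suff -> : y = chart_map c z by [].
  apply: val_inj; apply: (represents_fun _ (hc z Wz)).
  apply: (represents_tequiv rX); first exact: slice_good.
  by apply/equiv_by_tequiv; exists 1%g.
move=> Vy; have [z Wz ez] := sV y Vy; have Wz' := Wz; rewrite eW in Wz'.
exists (slice_tuple S z); last by rewrite -ez; exact: hc.
apply: slice_absorbs => //.
by split=> //=; rewrite ez.
Qed.

Lemma slice_is_chart S c : slice_chart S c -> is_chart c.
Proof.
move=> hc; have [eG eW _] := hc; split.
- by rewrite eG; exact: slice_group_linear.
- rewrite eW eG; split; [exact: slice_dom_open|exact: slice_dom0|].
  by move=> g w [s hg]; exact: slice_dom_sym hg.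
- apply/(open_slice_chart hc) => //.
  rewrite (_ : _ `&` _ = chart_dom c); first by rewrite eW; exact: slice_dom_open.
  by apply/seteqP; split=> [z []//|z Wz]; split=> //; exists z.
- rewrite eW eG => w w' Ww Ww'; rewrite (slice_chart_eq hc hc)//; split.
    by move=> [s /(slice_equiv_by Ww Ww')[r hr ->]]; exists r => //; exists s.
  by move=> [r [s hr] ->]; exists s; exact: slice_sym_equiv.
- by move=> V sV; exact: (open_slice_chart hc sV).
Qed.

(** Two charts at equivalent points: the transition map sends [v] to the only
    point of the second slice equivalent to it by the given permutation. *)
Section Compatibility.
Context (S1 S2 : slice F d) (s0 : {perm 'I_(3 + d)}).
Local Notation Z1 := (slice_tuple S1).
Local Notation Z2 := (slice_tuple S2).
Local Notation W1 := (slice_dom S1).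
Local Notation W2 := (slice_dom S2).

Let T v v' := equiv_by s0 (Z1 v) (Z2 v').

Definition transition_dom : set 'cV[F]_d := [set v | W1 v /\ exists2 v', W2 v' & T v v'].

Lemma transition_unique v v' v'' : W1 v -> W2 v' -> W2 v'' -> T v v' -> T v v'' -> v' = v''.
Proof.
move=> Wv Wv' Wv'' h h'; have := equiv_byM (slice_good Wv) (equiv_byV h) h'.
by rewrite mulVg; exact: slice_inj.
Qed.

Lemma open_transition_dom : open transition_dom.
Proof.
rewrite openE => v [Wv [v' Wv' h]].
have [f [_ _ _ hf]] := slice_transition Wv Wv' h.
by apply: filterS hf => u [W1u W2u Tu]; split=> //; exists (f u).
Qed.

Lemma transition_map : exists f : 'cV[F]_d -> 'cV[F]_d,
  [/\ forall v, transition_dom v -> W2 (f v) /\ T v (f v),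
      analytic_on transition_dom f &
      forall v, transition_dom v -> f u @[u --> v] --> f v].
Proof.
have /choice[f hf] : forall v, exists v', transition_dom v -> W2 v' /\ T v v'.
  move=> v; have [[Wv [v' Wv' h]]|nD] := pselect (transition_dom v); first by exists v'.
  by exists 0.
have loc v : transition_dom v -> exists g : 'cV[F]_d -> 'cV[F]_d,
    [/\ forall i, analytic_at (fun u => g u i 0) v, g u @[u --> v] --> f v &
        \forall u \near v, g u = f u].
  move=> Dv; have [Wfv Tfv] := hf v Dv.
  have [g [ag gv cg hg]] := slice_transition Dv.1 Wfv Tfv; exists g; split=> //.
    by rewrite -gv.
  have nD : \forall u \near v, transition_dom u.
    by apply: open_nbhs_nbhs; split=> //; exact: open_transition_dom.
  apply: filterS (filterI nD hg) => u [Du [W1u W2u Tu]]; have [W2f Tf] := hf u Du.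
  exact: (transition_unique W1u).
exists f; split=> // [v Dv i|v Dv].
  have [g [ag _ eg]] := loc v Dv; have [c hc] := ag i; exists c.
  by apply: filterS (filterI eg hc) => u [eu [hb hl]]; split=> //; rewrite -eu.
have [g [_ cg eg]] := loc v Dv.
by move=> A /cg nA; apply: filterS (filterI eg nA) => u [/= <-].
Qed.

(** A symmetry of the first slice, conjugated by the transition map, relates
    members of the second slice by a permutation that does not depend on the
    point; so it is a linear map that does not depend on the point. *)
Lemma transition_germ (f : 'cV[F]_d -> 'cV[F]_d) w r :
  (forall v, transition_dom v -> W2 (f v) /\ T v (f v)) ->
  transition_dom w -> slice_group S1 r -> r *m w = w ->
  exists2 r', slice_group S2 r' & r' *m f w = f w /\
    \forall v \near w, transition_dom (r *m v) /\ f (r *m v) = r' *m f v.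
Proof.
move=> hf Dw [s hr] rw.
have key v : transition_dom v -> transition_dom (r *m v) ->
    exists2 r', slice_sym S2 (s0^-1 * s * s0)%g r' & f (r *m v) = r' *m f v.
  move=> Dv Drv; have [W2f Tf] := hf v Dv; have [W2f' Tf'] := hf _ Drv.
  apply: slice_equiv_by => //; apply: (equiv_byM (slice_good Drv.1) _ Tf').
  exact: (equiv_byM (slice_good Dv.1) (equiv_byV Tf) (slice_sym_equiv _ hr)).
have [|r' hr' e] := key w Dw; first by rewrite rw.
exists r'; first by exists (s0^-1 * s * s0)%g.
split; first by rewrite -e rw.
have nD : \forall v \near w, transition_dom v.
  by apply: open_nbhs_nbhs; split=> //; exact: open_transition_dom.
have nrD : \forall v \near w, transition_dom (r *m v).
  exact: near_fixed nD.
apply: filterS (filterI nD nrD) => v [Dv Drv]; split=> //.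
by have [r'' hr'' ->] := key v Dv Drv; rewrite (slice_sym_unique hr'' hr').
Qed.

End Compatibility.

(** A matrix is determined by its germ at a point, so the intertwining of the
    germs of the symmetries by the transition map is a bijection between the
    stabilizers, and a morphism. *)
Lemma slice_compatible S1 S2 c1 c2 : slice_chart S1 c1 -> slice_chart S2 c2 -> compatible c1 c2.
Proof.
move=> h1 h2 w1 w2; have [eG1 eW1 _] := h1; have [eG2 eW2 _] := h2.
rewrite eW1 eW2 => Ww1 Ww2 /(slice_chart_eq h1 h2 Ww1 Ww2)[s0 T0].
pose D1 := transition_dom S1 S2 s0; pose D2 := transition_dom S2 S1 s0^-1%g.
have [f [hf af cf]] := transition_map S1 S2 s0.
have [g [hg ag cg]] := transition_map S2 S1 s0^-1%g.
have T0' := equiv_byV T0.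
have Dw1 : D1 w1 by split=> //; exists w2.
have Dw2 : D2 w2 by split=> //; exists w1.
have fD v : D1 v -> D2 (f v).
  by move=> Dv; have [W2f Tf] := hf v Dv; split=> //; exists v; [exact: Dv.1|exact: equiv_byV].
have gD u : D2 u -> D1 (g u).
  move=> Du; have [W1g Tg] := hg u Du; split=> //; exists u; first exact: Du.1.
  by rewrite -(invgK s0); exact: equiv_byV.
have fK v : D1 v -> g (f v) = v.
  move=> Dv; have [W2f Tf] := hf v Dv; have [W1g Tg] := hg _ (fD v Dv).
  by apply: (transition_unique W2f W1g Dv.1 Tg); exact: equiv_byV.
have gK u : D2 u -> f (g u) = u.
  move=> Du; have [W1g Tg] := hg u Du; have [W2f Tf] := hf _ (gD u Du).
  by apply: (transition_unique W1g W2f Du.1 Tf); rewrite -(invgK s0); exact: equiv_byV.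
have fw : f w1 = w2 by have [W2f Tf] := hf w1 Dw1; exact: (transition_unique Ww1 W2f Ww2 Tf T0).
have gw : g w2 = w1 by rewrite -fw fK.
have nD1 v : D1 v -> \forall x \near v, D1 x.
  by move=> Dv; apply: open_nbhs_nbhs; split=> //; exact: open_transition_dom.
have nD2 v : D2 v -> \forall x \near v, D2 x.
  by move=> Dv; apply: open_nbhs_nbhs; split=> //; exact: open_transition_dom.
have nf (Q : 'cV[F]_d -> Prop) : (\forall u \near w2, Q u) -> \forall v \near w1, Q (f v).
  by move=> nQ; apply: (cf w1 Dw1 [set u | Q u]); rewrite fw.
have ng (Q : 'cV[F]_d -> Prop) : (\forall v \near w1, Q v) -> \forall u \near w2, Q (g u).
  by move=> nQ; apply: (cg w2 Dw2 [set u | Q u]); rewrite gw.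
pose P r r' := \forall v \near w1, f (r *m v) = r' *m f v.
pose G1 r := slice_group S1 r /\ r *m w1 = w1.
pose G2 r := slice_group S2 r /\ r *m w2 = w2.
have P_ex r : G1 r -> exists r', G2 r' /\ P r r'.
  move=> [Rr rw]; have [r' Rr' [rw' hr']] := transition_germ hf Dw1 Rr rw.
  exists r'; split; first by split=> //; rewrite -fw.
  by apply: filterS hr' => v [].
have P_ex' r' : G2 r' -> exists r, G1 r /\ P r r'.
  move=> [Rr rw]; have [r Rr' [rw' hr]] := transition_germ hg Dw2 Rr rw.
  exists r; split; first by split=> //; rewrite -gw.
  apply: filterS (filterI (nD1 _ Dw1) (nf _ hr)) => v [Dv [D' e]].
  by rewrite -{1}(fK v Dv) -e gK.
have P_mul r1 r1' r2 r2' : r2 *m w1 = w1 -> P r1 r1' -> P r2 r2' -> P (r1 *m r2) (r1' *m r2').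
  move=> rw Pr1 Pr2; apply: filterS (filterI Pr2 (near_fixed rw Pr1)) => v [e2 e1].
  by rewrite -mulmxA e1 e2 mulmxA.
have P_fun r r' r'' : P r r' -> P r r'' -> r' = r''.
  move=> Pr Pr'; apply: (eq_mulmx_near (w := w2)).
  apply: filterS (filterI (nD2 _ Dw2) (ng _ (filterI Pr Pr'))) => u [Du /= [e e']].
  by rewrite -(gK u Du) -e -e'.
have P_inj r r' r'' : G1 r -> G1 r' -> P r r'' -> P r' r'' -> r = r'.
  move=> [_ rw] [_ rw'] Pr Pr'; apply: (eq_mulmx_near (w := w1)).
  have n1 := near_fixed rw (nD1 _ Dw1); have n2 := near_fixed rw' (nD1 _ Dw1).
  apply: filterS (filterI (filterI n1 n2) (filterI Pr Pr')) => v [[Dr Dr'] [e e']].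
  by rewrite -(fK _ Dr) e -e' fK.
have /choice[theta htheta] : forall r, exists r', G1 r -> G2 r' /\ P r r'.
  by move=> r; have [/P_ex[r' hr']|nG] := pselect (G1 r); [exists r'|exists 0].
have [N1 nN1 hN1] := slice_separates S1 w1; have [N2 nN2 hN2] := slice_separates S2 w2.
pose E := [set v | [/\ D1 v, N1 v, N2 (f v) &
  forall r, slice_group S1 r -> r *m w1 = w1 -> f (r *m v) = theta r *m f v]].
have nE : nbhs w1 E.
  have nth : \forall v \near w1, forall r, slice_group S1 r ->
      r *m w1 = w1 -> f (r *m v) = theta r *m f v.
    apply: near_slice_group => r Rr; have [rw|nrw] := pselect (r *m w1 = w1); last first.
      by apply: filterS (nD1 _ Dw1) => v _ rw; case: nrw.
    by have [_ Pr] := htheta r (conj Rr rw); move: Pr; rewrite /P; apply: filterS => v.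
  by apply: filterS (filterI (filterI (nD1 _ Dw1) nN1) (filterI (nf _ nN2) nth)) => v [[? ?] []].
(* on [E] the transition map is equivariant, and no symmetry outside of the
   stabilizers maps a point of [E] to a point of [E]; [V1] is invariant *)
pose V1 := [set v | forall r, slice_group S1 r -> r *m w1 = w1 -> E^° (r *m v)].
pose V2 := [set u | D2 u /\ V1 (g u)].
have V1E v : V1 v -> E v.
  move=> h; apply: interior_subset; rewrite -[v]mul1mx; apply: h; last exact: mul1mx.
  by exists 1%g; exact: slice_sym1.
have oV1 : open V1.
  rewrite openE => v Vv.
  have : \forall x \near v, forall r, slice_group S1 r -> r *m w1 = w1 -> E^° (r *m x); last by [].
  apply: near_slice_group => r Rr.
  have nT : \forall x \near v, True by exact: filterT.
  have [rw|nrw] := pselect (r *m w1 = w1); last by apply: filterS nT => x _ rw; case: nrw.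
  have cr : continuous (fun x : 'cV[F]_d => r *m x).
    by apply: cont_mulmx; [exact: cst_continuous|move=> x].
  have nr : \forall x \near v, E^° (r *m x).
    by apply: (cr v E^°); apply: open_nbhs_nbhs; split; [exact: open_interior|exact: Vv].
  by apply: filterS nr.
have oV2 : open V2.
  rewrite openE => u [Du Vu].
  have nV : \forall x \near u, V1 (g x) by apply: (cg u Du V1); exact: open_nbhs_nbhs.
  by apply: filterS (filterI (nD2 _ Du) nV).
have V1w : V1 w1 by move=> r _ ->; exact: nE.
have V2w : V2 w2 by split=> //; rewrite gw.
have fV v : V1 v -> V2 (f v).
  by move=> Vv; have [Dv _ _ _] := V1E v Vv; split; [exact: fD|rewrite fK].
have V1G r v : G1 r -> V1 v -> V1 (r *m v).
  move=> [[s hs] rw] Vv r' [s' hs'] rw'; rewrite mulmxA; apply: Vv.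
    by exists (s * s')%g; exact: slice_symM.
  by rewrite -mulmxA rw.
have eS1 r : chart_stab c1 w1 r <-> G1 r by rewrite /chart_stab /= eG1.
have eS2 r : chart_stab c2 w2 r <-> G2 r by rewrite /chart_stab /= eG2.
exists V1, V2, f, theta; split.
- split; split=> //.
  + by move=> v /V1E[[]]; rewrite eW1.
  + by move=> r v /eS1; exact: V1G.
  + move=> r v; rewrite eG1 => Rr /V1E[_ Nv _ _] /V1E[_ Nrv _ _]; apply/eS1; split=> //.
    exact: (hN1 r v).
  + by move=> u [[]]; rewrite eW2.
  + move=> r' u /eS2 Gr' [Du Vu]; have [r [Gr Pr]] := P_ex' r' Gr'.
    have e : theta r = r' by have [_ Pr'] := htheta r Gr; exact: P_fun Pr' Pr.
    have [_ _ _ he] := V1E _ Vu; have := he r Gr.1 Gr.2; rewrite e gK// => <-.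
    by apply: fV; exact: V1G.
  + move=> r u; rewrite eG2 => Rr [Du /V1E[_ _ Nu _]] [Dru /V1E[_ _ Nru _]]; apply/eS2; split=> //.
    by apply: (hN2 r u) => //; [rewrite -(gK u Du)|rewrite -(gK _ Dru)].
- split=> //; exists g; split.
  + by move=> _ [v Vv <-]; exact: fV.
  + by move=> _ [u [_ Vu] <-].
  + split=> [v|u]; rewrite inE; first by move=> /V1E[Dv _ _ _]; exact: fK.
    by move=> [Du _]; exact: gK.
  + by move=> v /V1E[Dv _ _ _]; exact: af.
  + by move=> u [Du _]; exact: ag.
- split; first split.
  + by move=> r /= /eS1 Gr; apply/eS2; have [] := htheta r Gr.
  + move=> r r'; rewrite !inE => /eS1 Gr /eS1 Gr' e.
    have [_ Pr] := htheta r Gr; have [_ Pr'] := htheta r' Gr'.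
    by rewrite -e in Pr'; exact: P_inj Pr Pr'.
  + move=> r' /= /eS2 Gr'; have [r [Gr Pr]] := P_ex' r' Gr'.
    exists r; first exact/eS1.
    by have [_ Pr'] := htheta r Gr; exact: P_fun Pr' Pr.
  + move=> r r' /eS1 Gr /eS1 Gr'.
    have Grr : G1 (r *m r').
      have [[s hs] rw] := Gr; have [[s' hs'] rw'] := Gr'; split; last by rewrite -mulmxA rw' rw.
      by exists (s' * s)%g; exact: slice_symM.
    have [_ Prr] := htheta _ Grr; have [_ Pr] := htheta r Gr; have [_ Pr'] := htheta r' Gr'.
    exact: P_fun Prr (P_mul _ _ _ _ Gr'.2 Pr Pr').
- by move=> r v /eS1[Rr rw] /V1E[_ _ _]; exact.
- move=> v /V1E[Dv _ _ _]; have [W2f Tf] := hf v Dv.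
  by apply/(slice_chart_eq h2 h1 W2f Dv.1); exists s0^-1%g; exact: equiv_byV.
Qed.

End SliceCharts.

Section Orbifold.
Context {F : numFieldType} (lf : local_field F).

Lemma slice_orbifold_atlas d :
  orbifold_atlas [set c : chart F d (small_mult_locus F (3 + d) : Type) | exists S, slice_chart S c].
Proof.
split.
- by move=> c [S]; exact: slice_is_chart.
- apply/seteqP; split=> // y _.
  have [X _ rX] := moduli_represents (set_val y).
  have stX : stable X by apply/(represents_small rX); exact: set_valP.
  have [S SX] := slice_exists lf stX; have [c hc] := slice_chart_exists S.
  exists c; first by exists S.
  have [_ eW hr] := hc; exists 0; first by rewrite eW; exact: slice_dom0.
  apply: val_inj; apply: (represents_fun _ rX).
  by rewrite -SX; apply: hr; exact: slice_dom0.
- by move=> c1 c2 [S1 h1] [S2 h2]; exact: (slice_compatible h1 h2).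
Qed.

Lemma three_card n (X : 'M[F]_(2, n)) : three X -> (3 <= n)%N.
Proof.
move=> [i [j [k [ij ik jk]]]].
have ne (a b : 'I_n) : wdg X a X b != 0 -> a != b by apply: contra_neq => ->; exact: wdgxx.
have := max_card [set i; j; k]%SET; rewrite card_ord; apply: leq_trans.
rewrite -finset.setUA cardsU1 cards2 !inE negb_or (ne _ _ ij) (ne _ _ ik) (ne _ _ jk).
by [].
Qed.

Lemma small_mult_orbifold n : orbifold F (small_mult_locus F n : Type).
Proof.
have [lt_n3|le_3n] := ltnP n 3; last first.
  rewrite -(subnKC le_3n); eexists; eexists; exact: slice_orbifold_atlas.
(* the stabilizer of fewer than three points is infinite, so the space is empty *)
exists 0%N, set0; split=> //.
apply/seteqP; split=> // y _; exfalso.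
have [X _ /represents_good3[_ /three_card]] := moduli_represents (set_val y).
by rewrite leqNgt lt_n3.
Qed.

End Orbifold.

Lemma local_field_moduli (F : numFieldType) (lf : local_field F) n :
  [/\ (forall x : moduli F n, closed [set x]),
      (hausdorff_space (moduli F n) <-> (n <= 4)%N),
      open (small_mult_locus F n) /\
        hausdorff_space (small_mult_locus F n : Type) /\
        orbifold F (small_mult_locus F n : Type) &
      (4 < n)%N -> forall D : fs_divisor F n,
        (n <= 2 * max_mult (val D))%N -> ~ locally_hausdorff (moduli_pt D)].
Proof.
split.
- by move=> x; exact: moduli_T1.
- split=> [h|]; last exact: moduli_hausdorff_le4.
  by rewrite leqNgt; apply/negP => n4; exact: (moduli_not_hausdorff lf n4 h).
- split; first exact: open_small_mult_locus.
  by split; [exact: small_mult_hausdorff|exact: small_mult_orbifold].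
- by move=> n4 D h; exact: (moduli_not_locally_hausdorff lf n4 h).
Qed.

Theorem theorem3p2 (R : realType) (F : numFieldType)
    (hF : F = (R : numFieldType) \/ F = (complex R : numFieldType)) (n : nat) :
  [/\ (forall x : moduli F n, closed [set x]),
      (hausdorff_space (moduli F n) <-> (n <= 4)%N),
      open (small_mult_locus F n) /\
        hausdorff_space (small_mult_locus F n : Type) /\
        orbifold F (small_mult_locus F n : Type) &
      (4 < n)%N -> forall D : fs_divisor F n,
        (n <= 2 * max_mult (val D))%N -> ~ locally_hausdorff (moduli_pt D)].
Proof.
apply: local_field_moduli.
by case: hF => ->; [exact: local_field_real|exact: local_field_complex].
Qed.
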